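(* Let $(\Gamma,\mu)$ be a transient random walk on a finitely generated group $\Gamma$ satisfying the moment condition $\sum_{g\in\Gamma}\mu(g)C^{d(g,e)}<\infty$, where $d$ and $C$ are the word metric and the Harnack constant described in the context. Assume that the Martin boundary $\partial_M\Gamma$ contains a spine $\xi_0$. For every real number $\beta\notin\{0,1\}$ there is an affine homeomorphism $\tau\mapsto\omega_\tau$ from the tracial state space $T(C^*_r(\Gamma))$ of $C^*_r(\Gamma)$ onto the simplex of $\beta$-KMS states for the flow $\alpha^{D^\mu}$ on $C(\partial_M\Gamma)\rtimes_r\Gamma$ such that $$\omega_\tau(fU_g)=f(\xi_0)\,\tau(U_g)$$ for all $f\in C(\partial_M\Gamma)$ and all $g\in\Gamma$.
   Context: A random walk $(\Gamma,\mu)$ consists of a countable discrete group $\Gamma$ with neutral element $e$ and a function $\mu:\Gamma\to[0,1]$ with $\sum_{g}\mu(g)=1$ whose support $\{g:\mu(g)>0\}$ generates $\Gamma$ as a semigroup. Put $\mu_{x,y}=\mu(x^{-1}y)$, and let $\mu^n_{x,y}$ be the entries of the $n$-th power of this matrix ($\mu^0$ is the identity matrix). The walk is transient when $G(x,y)=\sum_{n\ge0}\mu^n_{x,y}<\infty$ for all $x,y\in\Gamma$; then $G>0$. The Martin kernel is $K(g,h)=G(g,h)/G(e,h)$. The Martin compactification is the compact metrizable space containing $\Gamma$ as a dense, open, discrete subset such that every function $h\mapsto K(g,h)$, $g\in\Gamma$, extends continuously to it and such that the extensions separate the points of the complement $\partial_M\Gamma$ of $\Gamma$, which is called the Martin boundary.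 The extended kernel is also denoted $K:\Gamma\times\partial_M\Gamma\to(0,\infty)$. Left translation of $\Gamma$ on itself extends to an action of $\Gamma$ by homeomorphisms of the compactification, hence of $\partial_M\Gamma$, written $\xi\mapsto g\xi$, and $K(x,g\xi)K(g^{-1},\xi)=K(g^{-1}x,\xi)$. A spine is a point $\xi\in\partial_M\Gamma$ with $K(g,\xi)=1$ for all $g\in\Gamma$. Moment condition: $d$ is the word metric on $\Gamma$ coming from a finite symmetric set generating $\Gamma$ as a semigroup, and $C>0$ is a constant such that the Harnack inequality $G(x,z)/G(y,z)\le C^{d(x,y)}$ holds for all $x,y,z\in\Gamma$. In the reduced crossed product $C(\partial_M\Gamma)\rtimes_r\Gamma$, $\{U_g\}_{g\in\Gamma}$ denotes the canonical unitaries, so $(U_gfU_g^* )(\xi)=f(g^{-1}\xi)$; the canonical unitaries of the reduced group $C^*$-algebra $C^*_r(\Gamma)$ are also denoted $U_g$. The flow $\alpha^{D^\mu}$ is the continuous one-parameter group of automorphisms with $\alpha^{D^\mu}_t(fU_g)=fU_gK(g^{-1},\cdot)^{-it}$ for $f\in C(\partial_M\Gamma)$, $g\in\Gamma$, $t\in\mathbb R$. For $\beta\in\mathbb R$, a state $\omega$ is a $\beta$-KMS state for a flow $\alpha$ when $\omega(ab)=\omega(b\,\alpha_{i\beta}(a))$ for all $\alpha$-analytic elements $a,b$. State spaces carry the weak* topology. $T(C_r^*(\Gamma))$ may be empty. *)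

(* Defs.v *)
From HB Require Import structures.
From mathcomp Require Import all_boot all_order all_algebra complex.
From mathcomp Require Import all_classical all_reals all_analysis.

Set Implicit Arguments.
Unset Strict Implicit.
Unset Printing Implicit Defensive.

Import Order.TTheory GRing.Theory Num.Theory.
Import numFieldNormedType.Exports.

Local Open Scope classical_set_scope.
Local Open Scope complex_scope.
Local Open Scope ring_scope.

(** * Random walks *)

Definition is_word (G : groupType) (S : set G) (n : nat) (g : G) : Prop :=
  exists s : seq G,
    [/\ size s = n, forall x, x \in s -> S x & (\prod_(x <- s) x)%g = g].

(* Only nonempty words count: the neutral element also has to be reached. *)
Definition semigroup_generates (G : groupType) (S : set G) : Prop :=
  forall g, exists2 n, (0 < n)%N & is_word S n g.

Definition is_word_metric (G : groupType) (S : set G) (d : G -> G -> nat) :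
    Prop :=
  forall x y, is_word S (d x y) (x^-1 * y)%g /\
    forall n, is_word S n (x^-1 * y)%g -> (d x y <= n)%N.

Definition is_random_walk (R : realType) (G : groupType) (mu : G -> R) : Prop :=
  [/\ countable [set: G],
      forall g, 0 <= mu g <= 1,
      (\esum_(g in [set: G]) (mu g)%:E = 1)%E
    & semigroup_generates [set g | 0 < mu g]].

Fixpoint walk_power (R : realType) (G : groupType) (mu : G -> R) (n : nat)
    (x y : G) : \bar R :=
  if n is n'.+1 then
    (\esum_(z in [set: G]) (walk_power mu n' x z * (mu (z^-1 * y)%g)%:E))%E
  else ((x == y)%:R)%:E.

Definition greenE (R : realType) (G : groupType) (mu : G -> R) (x y : G) :
    \bar R :=
  (\sum_(0 <= n <oo) walk_power mu n x y)%E.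

Definition transient (R : realType) (G : groupType) (mu : G -> R) : Prop :=
  forall x y, (greenE mu x y < +oo)%E.

Definition green (R : realType) (G : groupType) (mu : G -> R) (x y : G) : R :=
  fine (greenE mu x y).

Definition martin_kernel (R : realType) (G : groupType) (mu : G -> R)
    (g h : G) : R :=
  green mu g h / green mu 1%g h.

Definition harnack (R : realType) (G : groupType) (mu : G -> R)
    (d : G -> G -> nat) (C : R) : Prop :=
  forall x y z, green mu x z / green mu y z <= C ^+ d x y.

Definition moment_condition (R : realType) (G : groupType) (mu : G -> R)
    (d : G -> G -> nat) (C : R) : Prop :=
  (\esum_(g in [set: G]) (mu g * C ^+ d g 1%g)%:E < +oo)%E.

(** * The Martin compactification *)

(* The listed properties determine the compactification up to a unique
   homeomorphism that fixes the group.  The extended kernel and the extended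
   action, unique because the group is dense, are part of the structure.  All
   points [mc_emb h] being open says that the group is open and discrete. *)
Record martin_compactification (R : realType) (G : groupType) (mu : G -> R) :=
  MartinCompactification {
    mc_space :> metricType R;
    mc_emb : G -> mc_space;
    mc_kernel : G -> mc_space -> R;
    mc_act : G -> mc_space -> mc_space;
    mc_compact : compact [set: mc_space];
    mc_inj : injective mc_emb;
    mc_open : forall h, open [set mc_emb h];
    mc_dense : dense (range mc_emb);
    mc_kernel_continuous : forall g, continuous (mc_kernel g);
    mc_kernelE : forall g h, mc_kernel g (mc_emb h) = martin_kernel mu g h;
    mc_separates : forall x y, ~ range mc_emb x -> ~ range mc_emb y ->
      (forall g, mc_kernel g x = mc_kernel g y) -> x = y;
    mc_act_continuous : forall g, continuous (mc_act g);
    mc_act1 : forall x, mc_act 1%g x = x;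
    mc_actM : forall g h x, mc_act (g * h)%g x = mc_act g (mc_act h x);
    mc_actE : forall g h, mc_act g (mc_emb h) = mc_emb (g * h)%g
  }.

Definition boundary_set (R : realType) (G : groupType) (mu : G -> R)
    (M : martin_compactification mu) : set M := ~` range (mc_emb M).
Arguments boundary_set {R G mu} M x.

Definition boundary (R : realType) (G : groupType) (mu : G -> R)
    (M : martin_compactification mu) : topologicalType :=
  set_type (boundary_set M).

Lemma boundary_actP (R : realType) (G : groupType) (mu : G -> R)
    (M : martin_compactification mu) (g : G) (x : boundary M) :
  mc_act g (\val x) \in boundary_set M.
Proof.
apply/mem_set => -[h _ hE]; have /set_mem xP := valP x; apply: xP.
exists (g^-1 * h)%g => //.
by rewrite -mc_actE hE -mc_actM mulVg mc_act1.
Qed.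

Definition boundary_act (R : realType) (G : groupType) (mu : G -> R)
    (M : martin_compactification mu) (g : G) (x : boundary M) : boundary M :=
  exist _ (mc_act g (\val x)) (boundary_actP g x).
Arguments boundary_act {R G mu} M g x.

Definition boundary_kernel (R : realType) (G : groupType) (mu : G -> R)
    (M : martin_compactification mu) (g : G) (x : boundary M) : R :=
  mc_kernel g (\val x).

Definition is_spine (R : realType) (G : groupType) (mu : G -> R)
    (M : martin_compactification mu) (x : boundary M) : Prop :=
  forall g, boundary_kernel g x = 1.

(** * Unital C*-algebras *)

(* The product is a separate operation, not that of a ring structure: Hierarchy
   Builder refuses to join normed modules with rings, because numDomainType
   already inherits from both. *)
HB.mixin Record isCStarAlgebra (R : realType) A
    of CompleteNormedModule R[i] A := {
  cmul : A -> A -> A;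
  cone : A;
  star : A -> A;
  cmulA : associative cmul;
  cmul1l : left_id cone cmul;
  cmul1r : right_id cone cmul;
  cmulDl : left_distributive cmul +%R;
  cmulDr : right_distributive cmul +%R;
  cmulZl : forall (c : R[i]) a b, cmul (c *: a) b = c *: cmul a b;
  cmulZr : forall (c : R[i]) a b, cmul a (c *: b) = c *: cmul a b;
  starK : involutive star;
  starD : {morph star : a b / a + b};
  starZ : forall (c : R[i]) a, star (c *: a) = conjc c *: star a;
  starM : forall a b, star (cmul a b) = cmul (star b) (star a);
  cstar_normM : forall a b : A, `|cmul a b| <= `|a| * `|b|;
  cstar_identity : forall a : A, `|cmul (star a) a| = `|a| ^+ 2
}.

#[short(type="cstarAlgType")]
HB.structure Definition CStarAlgebra (R : realType) :=
  { A of CompleteNormedModule R[i] A & isCStarAlgebra R A }.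

Declare Scope cstar_scope.
Delimit Scope cstar_scope with CS.
Notation "a ** b" := (cmul a b) (at level 40, left associativity) : cstar_scope.
Local Open Scope cstar_scope.

(* Functionals with the topology of pointwise convergence, that is, weak*. *)
Definition functionals (R : realType) (A : cstarAlgType R) : topologicalType :=
  {ptws A -> R[i]^o}.

Definition is_state (R : realType) (A : cstarAlgType R) (w : functionals A) :
    Prop :=
  [/\ scalar (w : A -> R[i]), forall a, 0 <= w (star a ** a) & w cone = 1].

Definition tracial_states (R : realType) (A : cstarAlgType R) :
    set (functionals A) :=
  [set w | is_state w /\ forall a b, w (a ** b) = w (b ** a)].
Arguments tracial_states {R} A w.

(* Strongly continuous one-parameter groups of *-automorphisms; bijectivity of
   [alpha t] follows from the group law. *)
Definition is_flow (R : realType) (A : cstarAlgType R) (alpha : R -> A -> A) :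
    Prop :=
  [/\ forall t, [/\ linear (alpha t),
                    {morph alpha t : a b / a ** b} &
                    {morph alpha t : a / star a}],
      forall a, alpha 0 a = a,
      forall s t a, alpha (s + t) a = alpha s (alpha t a)
    & forall a, continuous (alpha^~ a)].

(* [F] is an entire extension of t |-> alpha_t(a): it is differentiable at
   every point of the complex plane; F(z) is then denoted alpha_z(a). *)
Definition entire_extension (R : realType) (A : cstarAlgType R)
    (alpha : R -> A -> A) (a : A) (F : R[i]^o -> A) : Prop :=
  (forall z, derivable F z 1) /\ (forall t : R, F t%:C = alpha t a).

Definition analytic (R : realType) (A : cstarAlgType R)
    (alpha : R -> A -> A) (a : A) : Prop :=
  exists F, entire_extension alpha a F.

Definition kms_states (R : realType) (A : cstarAlgType R)
    (alpha : R -> A -> A) (beta : R) : set (functionals A) :=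
  [set w | is_state w /\
    forall a b F, entire_extension alpha a F -> analytic alpha b ->
      w (a ** b) = w (b ** F (0 +i* beta))].
Arguments kms_states {R A} alpha beta w.

(* [f] restricts to an affine homeomorphism of the convex set [S] of
   functionals onto [T]; its values outside [S] are irrelevant. *)
Definition affine_homeomorphism (R : realType) (B A : cstarAlgType R)
    (S : set (functionals B)) (T : set (functionals A))
    (f : functionals B -> functionals A) : Prop :=
  [/\ set_bij S T f,
      {within S, continuous f},
      exists2 g : functionals A -> functionals B,
        {in S, cancel f g} & {within T, continuous g}
    & forall (t : R) u v, 0 <= t <= 1 -> S u -> S v ->
        f (fun b => t%:C * u b + (1 - t)%:C * v b) =
        (fun a => t%:C * f u a + (1 - t)%:C * f v a)].

(** * Reduced group C*-algebras and reduced crossed products *)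

Definition l2norm (R : realType) (I : choiceType) (psi : I -> R[i]) : \bar R :=
  sqrte (\esum_(i in [set: I]) ((complex.Re `|psi i|) ^+ 2)%:E)%E.

(* Operator norm on l^2(I) *)
Definition opnorm (R : realType) (I : choiceType)
    (T : (I -> R[i]) -> (I -> R[i])) : \bar R :=
  ereal_sup [set l2norm (T psi) | psi in [set psi | (l2norm psi <= 1)%E]].

(* \sum_(g <- s) c_g lambda_g, with lambda the left regular representation
   on l^2(G) *)
Definition group_regular (R : realType) (G : groupType) (s : seq G)
    (c : G -> R[i]) (psi : G -> R[i]) : G -> R[i] :=
  fun h => \sum_(g <- s) c g * psi (g^-1 * h)%g.

(* \sum_(g <- s) f_g U_g in the regular representation on
   l^2(G, l^2(X)) = l^2(G * X) induced by the faithful representation of C(X)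
   on l^2(X) by multiplication: f acts as multiplication by (h, x) |-> f(hx)
   and U_g as translation of the first coordinate. *)
Definition crossed_regular (R : realType) (G : groupType) (X : choiceType)
    (act : G -> X -> X) (s : seq G) (f : G -> X -> R[i])
    (psi : G * X -> R[i]) : G * X -> R[i] :=
  fun p => \sum_(g <- s) f g (act p.1 p.2) * psi (g^-1 * p.1, p.2)%g.

Definition is_unitary_rep (R : realType) (G : groupType) (A : cstarAlgType R)
    (U : G -> A) : Prop :=
  [/\ U 1%g = cone, forall g h, U (g * h)%g = U g ** U h
    & forall g, star (U g) ** U g = cone /\ U g ** star (U g) = cone].

(* A model of C*_r(G): the completion of the group algebra for the norm of the
   regular representation.  Any two models are isomorphic by a unique
   *-isomorphism matching the canonical unitaries. *)
Record reduced_group_algebra (R : realType) (G : groupType) :=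
  ReducedGroupAlgebra {
    rg_algebra :> cstarAlgType R;
    rg_U : G -> rg_algebra;
    rg_U_unitary : is_unitary_rep rg_U;
    rg_dense : dense [set a | exists (s : seq G) (c : G -> R[i]),
      a = \sum_(g <- s) c g *: rg_U g];
    rg_norm : forall (s : seq G) (c : G -> R[i]), uniq s ->
      ((complex.Re `|\sum_(g <- s) c g *: rg_U g|)%:E =
       opnorm (group_regular s c))%E
  }.

(* A model of the reduced crossed product of C(X) by G, for X compact: the
   completion, for the norm of the regular representation, of the *-algebra
   of finite sums of products f U_g.  The map [rc_fun] embeds C(X); its values
   at discontinuous functions are irrelevant.  Any two models are isomorphic by
   a unique *-isomorphism matching the canonical generators. *)
Record reduced_crossed_product (R : realType) (G : groupType)
    (X : topologicalType) (act : G -> X -> X) :=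
  ReducedCrossedProduct {
    rc_algebra :> cstarAlgType R;
    rc_fun : (X -> R[i]^o) -> rc_algebra;
    rc_U : G -> rc_algebra;
    rc_fun1 : rc_fun (fun=> 1) = cone;
    rc_funD : forall f g : X -> R[i]^o, continuous f -> continuous g ->
      rc_fun (fun x => f x + g x) = rc_fun f + rc_fun g;
    rc_funZ : forall (c : R[i]) (f : X -> R[i]^o), continuous f ->
      rc_fun (fun x => c * f x) = c *: rc_fun f;
    rc_funM : forall f g : X -> R[i]^o, continuous f -> continuous g ->
      rc_fun (fun x => f x * g x) = rc_fun f ** rc_fun g;
    rc_fun_star : forall f : X -> R[i]^o, continuous f ->
      rc_fun (fun x => conjc (f x)) = star (rc_fun f);
    rc_U_unitary : is_unitary_rep rc_U;
    rc_covariant : forall g (f : X -> R[i]^o), continuous f ->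
      rc_U g ** rc_fun f ** star (rc_U g) = rc_fun (fun x => f (act g^-1%g x));
    rc_dense : dense [set a | exists (s : seq G) (f : G -> X -> R[i]^o),
      (forall g, continuous (f g)) /\ a = \sum_(g <- s) rc_fun (f g) ** rc_U g];
    rc_norm : forall (s : seq G) (f : G -> X -> R[i]^o), uniq s ->
      (forall g, continuous (f g)) ->
      ((complex.Re `|\sum_(g <- s) rc_fun (f g) ** rc_U g|)%:E =
       opnorm (crossed_regular act s f))%E
  }.

(* k^(it) for k > 0 *)
Definition powit (R : realType) (k t : R) : R[i] :=
  cos (t * ln k) +i* sin (t * ln k).

(* This determines [alpha], as the products f U_g span a dense subspace. *)
Definition is_martin_flow (R : realType) (G : groupType) (mu : G -> R)
    (M : martin_compactification mu)
    (A : reduced_crossed_product R (boundary_act M))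
    (alpha : R -> A -> A) : Prop :=
  is_flow alpha /\
  forall t g (f : boundary M -> R[i]^o), continuous f ->
    alpha t (rc_fun A f ** rc_U A g) =
    rc_fun A f ** rc_U A g **
      rc_fun A (fun x => powit (boundary_kernel g^-1%g x) (- t)).

(* Main.v *)
(** The spine is fixed by the group, so evaluation of coefficients at [xi0] is a
    *-homomorphism [pi] from the crossed product to the group algebra, with the
    inclusion [iota] as a right inverse.  The bijection is [tau |-> tau \o pi],
    with inverse [w |-> w \o iota].

    If [w] is beta-KMS, its restriction to [C(X)] is a probability measure [m]
    under which every [K(g, .) ^ beta] has integral 1.  The moment condition
    makes [sum_g mu g * K(g, .)] converge to 1 uniformly.  Bernoulli's
    inequality compares [k ^ beta] with [1 + beta * (k - 1)] and is strict for
    [k != 1] as beta is not 0 or 1; summed against [mu] it forces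
    [K(g, .) = 1] almost everywhere for [g] in the support of [mu].  By
    quasi-invariance [m] is the Dirac mass at the spine, and then
    [w (f U_g) = f xi0 * w (U_g)] by the Cauchy-Schwarz inequality.

    Conversely [tau \o pi] is invariant under the flow, so for an entire
    extension [F] of [t |-> alpha_t a] the function [z |-> tau (pi (b F(z)))] is
    entire and constant on the real line, hence constant.  This identity
    theorem is derived from Goursat's lemma for rectangles. *)

Require Import Defs.
From HB Require Import structures.
From mathcomp Require Import all_boot all_order all_algebra complex.
From mathcomp Require Import all_classical all_reals all_analysis.
From mathcomp Require Import ring lra.

Set Implicit Arguments.
Unset Strict Implicit.
Unset Printing Implicit Defensive.

Import Order.TTheory GRing.Theory Num.Theory.
Import numFieldNormedType.Exports.

Local Open Scope classical_set_scope.
Local Open Scope complex_scope.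
Local Open Scope ring_scope.
Local Open Scope cstar_scope.

(** No measure is constructed: [m] stays a positive functional on continuous functions. Integration
    only shows that the functions [mu s * kernel_gap s (g x)] have [m]-integral 0; by compactness a
    nonnegative function vanishing at their only common zero is dominated by a small constant plus a
    finite combination of them. All translates by [g] are taken because vanishing gaps at one point
    [x] give [K(s, x) = 1] only for [s] in the support of [mu], while vanishing along the orbit
    gives [K(h s, x) = K(h, x)] for all [h] and allows an induction over words.

    Homomorphisms are prescribed on finite sums, and their contractivity is an inequality between
    operator norms of regular representations. Elsewhere, identities in the completed algebras are
    checked on generators and extended by Lipschitz bounds.

    The identity theorem uses no power series. A function vanishing on the real line but not at ['i]
    is multiplied by a high power of a polynomial until it is negligible on the three other sides of
    a rectangle; then only the sign of one imaginary part is needed, not the value of a winding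
    integral. *)

(** * Real-valued norms *)

(* The norm of a module over [R[i]] takes its values in [R[i]]. *)
Definition rnorm (R : realType) (V : normedModType R[i]) (v : V) : R :=
  complex.Re `|v|.

Section RealNorm.
Context {R : realType} {V : normedModType R[i]}.
Implicit Types (u v : V) (z : R[i]).

Lemma normE v : `|v| = (rnorm v)%:C.
Proof. by have := normr_ge0 v; rewrite lecE /rnorm; case: `|v| => a b /= /andP[/eqP-> _]. Qed.

Lemma rnorm_ge0 v : 0 <= rnorm v.
Proof. by rewrite -ler0c -normE. Qed.

Lemma rnorm0 : rnorm (0 : V) = 0.
Proof. by rewrite /rnorm normr0. Qed.

Lemma rnorm_eq0 v : (rnorm v == 0) = (v == 0).
Proof. by rewrite -(normr_eq0 v) normE eq_complex /= eqxx andbT. Qed.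

Lemma rnormN v : rnorm (- v) = rnorm v.
Proof. by rewrite /rnorm normrN. Qed.

Lemma rnormBC u v : rnorm (u - v) = rnorm (v - u).
Proof. by rewrite -rnormN opprB. Qed.

Lemma rnormD u v : rnorm (u + v) <= rnorm u + rnorm v.
Proof. by rewrite -lecR rmorphD /= -!normE ler_normD. Qed.

Lemma rnormB u v : rnorm (u - v) <= rnorm u + rnorm v.
Proof. by rewrite -(rnormN v) rnormD. Qed.

Lemma rnormZ z v : rnorm (z *: v) = rnorm (z : R[i]^o) * rnorm v.
Proof. by apply: complexI; rewrite rmorphM /= -!normE normrZ. Qed.

Lemma rnorm_small v : (forall e : R, 0 < e -> rnorm v <= e) -> v = 0.
Proof.
move=> h; apply/eqP; rewrite -rnorm_eq0 eq_le rnorm_ge0 andbT.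
by apply/ler_addgt0Pl => e e0; rewrite addr0; apply: h.
Qed.

Lemma cvg_rnormP {T : Type} {F : set_system T} {FF : Filter F} (f : T -> V) v :
  f @ F --> v <-> forall e : R, 0 < e -> \forall x \near F, rnorm (v - f x) < e.
Proof.
split=> [/cvgrPdist_lt h e e0|h].
  have e0' : 0 < e%:C by rewrite ltcR.
  have := h _ e0'.
  by apply: filterS => x; rewrite normE ltcR.
apply/cvgrPdist_lt => e e0; have eE : e = (complex.Re e)%:C.
  by rewrite RRe_real // gtr0_real.
have /h : 0 < complex.Re e by rewrite -ltcR -eE.
by apply: filterS => x; rewrite normE eE ltcR.
Qed.

Lemma nbhs_rnormP v (P : set V) :
  nbhs v P <-> exists2 r : R, 0 < r & forall u, rnorm (v - u) < r -> P u.
Proof.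
split=> [/nbhs_normP[e /= e0 h]|[r r0 h]].
  have eE : e = (complex.Re e)%:C by rewrite RRe_real // gtr0_real.
  exists (complex.Re e); first by rewrite -ltcR -eE.
  by move=> u hu; apply: h; rewrite /= normE eE ltcR.
apply/nbhs_normP; exists r%:C; first by rewrite /= ltcR.
by move=> u; rewrite /= normE ltcR; exact: h.
Qed.

End RealNorm.

Section ComplexNorm.
Context {R : realType}.
Implicit Types (w z : R[i]^o) (f : R[i]^o -> R[i]^o).
Local Notation Re := (@complex.Re R).
Local Notation Im := (@complex.Im R).

Lemma rnormM w z : rnorm (w * z : R[i]^o) = rnorm w * rnorm z.
Proof. exact: rnormZ. Qed.

Lemma rnorm1 : rnorm (1 : R[i]^o) = 1.
Proof. by rewrite /rnorm normr1. Qed.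

Lemma rnormE z : rnorm z = Num.sqrt (Re z ^+ 2 + Im z ^+ 2).
Proof. by rewrite /rnorm normc_def. Qed.

Lemma rnorm_sqr z : rnorm z ^+ 2 = Re z ^+ 2 + Im z ^+ 2.
Proof. by rewrite rnormE sqr_sqrtr // addr_ge0 // sqr_ge0. Qed.

Lemma ler_abs_sqr (x y : R) : 0 <= y -> x ^+ 2 <= y ^+ 2 -> `|x| <= y.
Proof. by move=> y0; rewrite -(real_normK (num_real x)) ler_pXn2r ?nnegrE. Qed.

Lemma abs_Re_le z : `|Re z| <= rnorm z.
Proof.
by apply: ler_abs_sqr; rewrite ?rnorm_ge0 // rnorm_sqr lerDl sqr_ge0.
Qed.

Lemma abs_Im_le z : `|Im z| <= rnorm z.
Proof.
by apply: ler_abs_sqr; rewrite ?rnorm_ge0 // rnorm_sqr lerDr sqr_ge0.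
Qed.

Lemma rnorm_le_abs z : rnorm z <= `|Re z| + `|Im z|.
Proof.
rewrite -(ger0_norm (rnorm_ge0 z)) ler_abs_sqr ?addr_ge0 // rnorm_sqr.
rewrite -(real_normK (num_real (Re z))) -(real_normK (num_real (Im z))).
have := mulr_ge0 (normr_ge0 (Re z)) (normr_ge0 (Im z)); nra.
Qed.

Lemma rnorm_real (x : R) : rnorm (x%:C : R[i]^o) = `|x|.
Proof. by rewrite rnormE /= expr0n addr0 sqrtr_sqr. Qed.

Lemma Re_continuous : continuous (Re : R[i]^o -> R).
Proof.
move=> z; apply/(@cvgrPdist_lt _ R^o _ _ (nbhs_filter z)) => e e0.
apply/nbhs_rnormP; exists e => // u.
by apply: le_lt_trans; rewrite -raddfB; apply: (abs_Re_le (z - u)).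
Qed.

Lemma Im_continuous : continuous (Im : R[i]^o -> R).
Proof.
move=> z; apply/(@cvgrPdist_lt _ R^o _ _ (nbhs_filter z)) => e e0.
apply/nbhs_rnormP; exists e => // u.
by apply: le_lt_trans; rewrite -raddfB; apply: (abs_Im_le (z - u)).
Qed.

Lemma continuous_complex (T : topologicalType) (f g : T -> R) :
  continuous f -> continuous g ->
  continuous (fun x => f x +i* g x : R[i]^o).
Proof.
move=> cf cg x; apply/cvg_rnormP => e e0; near=> y.
apply: le_lt_trans (rnorm_le_abs _) _ => /=; rewrite [ltRHS](splitr e) ltrD //.
  by near: y; apply: (cvgrPdist_lt _ _).1 (cf x) _ _; rewrite divr_gt0.
by near: y; apply: (cvgrPdist_lt _ _).1 (cg x) _ _; rewrite divr_gt0.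
Unshelve. all: by end_near. Qed.

End ComplexNorm.

(** Without division by [u] the estimate also covers [u = 0], and it passes directly through bounded
    linear maps. *)
Lemma derivable_rnorm (R : realType) (V : normedModType R[i])
    (F : R[i]^o -> V) (z : R[i]^o) :
  derivable F z 1 <-> exists D : V, forall e : R, 0 < e ->
    exists2 r : R, 0 < r & forall u : R[i]^o, rnorm u < r ->
      rnorm (F (z + u) - F z - u *: D) <= e * rnorm u.
Proof.
split=> [dF|[D h]].
  exists ('D_1 F z) => e e0.
  have /cvg_rnormP/(_ e e0) := dF.
  rewrite nbhs_filterE /= => /nbhs_rnormP[r r0 h]; exists r => // u ur.
  have [->|u0] := eqVneq u 0; first by rewrite addr0 subrr scale0r subrr !rnorm0 mulr0.
  have := h u; rewrite sub0r rnormN => /(_ ur u0) /=.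
  rewrite [u *: 1]mulr1 [u + z]addrC => /ltW; rewrite -[leRHS]mulr1.
  set v := F (z + u) - F z.
  have un : 0 < rnorm u by rewrite lt_def rnorm_ge0 rnorm_eq0 u0.
  rewrite mulr1 -(ler_pM2r un) mulrC -rnormZ scalerBr scalerA mulfV // scale1r.
  by rewrite rnormBC.
apply/cvg_ex; exists D; apply/cvg_rnormP => e e0.
have [r r0 {}h] := h (e / 2) (divr_gt0 e0 (ltr0Sn R 1)).
apply/nbhs_rnormP; exists r => // u.
rewrite sub0r rnormN => /h + u0 /=.
rewrite [u *: 1]mulr1 [u + z]addrC.
have un : 0 < rnorm u by rewrite lt_def rnorm_ge0 rnorm_eq0 u0.
set v := F (z + u) - F z => hv.
rewrite -(ltr_pM2l un) -rnormZ scalerBr scalerA mulfV // scale1r rnormBC.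
by apply: le_lt_trans hv _; rewrite mulrC ltr_pM2l //; lra.
Qed.

(** * Goursat's lemma and the identity theorem *)

Section Primitive.
Context {R : realType}.
Implicit Types (g l L P : R -> R) (a b x : R).

Lemma is_derive_continuous g (l : R) x : is_derive x 1 g l -> {for x, continuous g}.
Proof. by move=> [dg _]; apply: differentiable_continuous; apply/derivable1_diffP. Qed.

Lemma MVT_unordered L l a b : (forall x, is_derive x 1 L (l x)) ->
  exists2 c, Num.min a b <= c <= Num.max a b & L b - L a = l c * (b - a).
Proof.
move=> dL; wlog ab : a b / a <= b => [H|].
  have [/H//|] := boolP (a <= b); rewrite -ltNge => ba.
  have [c cab cE] := H _ _ (ltW ba); exists c; last by lra.
  by rewrite minC maxC.
have cL : {within `[a, b], continuous L}.
  by apply: continuous_subspaceT => x; exact: is_derive_continuous (dL x).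
have [c + cE] := MVT_segment ab (fun x _ => dL x) cL.
by rewrite in_itv /= => cab; exists c; rewrite // minEle maxEle ab.
Qed.

(** The fundamental theorem of calculus differentiates the integral from [a] at interior points
    only, hence the restriction to [a < x]. *)
Lemma primitive_above g a : continuous g ->
  exists P, forall x, a < x -> is_derive x 1 P (g x).
Proof.
move=> cg; exists (fun x => (\int[lebesgue_measure]_(t in `[a, x]) g t)%R).
move=> x ax.
have xu : x < x + 1 by rewrite ltrDl.
have ig : lebesgue_measure.-integrable `[a, x + 1] (EFin \o g).
  apply: continuous_compact_integrable; first exact: segment_compact.
  exact: continuous_subspaceT.
have [dP PE] := continuous_FTC1_closed xu ig ax (cg x).
by split; [exact: dP|rewrite -derive1E PE].
Qed.

(** Integrals from different negative base points, normalized to vanish at 0, have a difference with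
    derivative 0 and so agree on their common domain; they glue to a primitive on the whole line. *)
Lemma primitive_exists g : continuous g ->
  exists P, forall x, is_derive x 1 P (g x).
Proof.
move=> cg; have /choice[Q dQ] := fun a => primitive_above a cg.
pose P a x := Q a x - Q a 0.
have PE a b x : a < 0 -> b < 0 -> a < x -> b < x -> P a x = P b x.
  wlog ab : a b / a <= b => [H a0 b0 ax bx|a0 b0 ax bx].
    by have [|/ltW] := leP a b => /H ->.
  have dD y : b < y -> is_derive y 1 (Q a \- Q b) (g y - g y).
    by move=> yb; apply: is_deriveB; apply: dQ; lra.
  have mM : Num.min 0 x <= Num.max 0 x by rewrite ge_min !le_max lexx.
  have bm : b < Num.min 0 x by rewrite lt_min b0.
  have cD : {within `[Num.min 0 x, Num.max 0 x], continuous (Q a \- Q b)}.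
    apply: continuous_in_subspaceT => y; rewrite inE /= in_itv /= => /andP[y0 _].
    by apply: is_derive_continuous (dD y _); exact: lt_le_trans bm y0.
  have [y yI|c _] := @MVT_segment R (Q a \- Q b) (fun y => g y - g y) _ _ mM _ cD.
    apply: dD; move: yI; rewrite in_itv /= => /andP[y0 _].
    exact: lt_trans bm y0.
  have [x0|x0] := leP 0 x; rewrite /P /=; lra.
exists (fun x => P (- (`|x| + 1)) x) => x.
(* The base point moves with the argument. For [|x - y| < 1] the base point [-(|y| + 1)] lies to the
   right of [b], so near [x] the fixed [b] may replace it. *)
set b := - (`|x| + 2).
have db : is_derive x 1 (P b) (g x).
  apply: is_derive_eq; last exact: (subr0 (g x)).
  apply: is_deriveB.
  by apply: dQ; rewrite /b; have := ler_norm (- x); rewrite normrN; lra.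
apply: near_eq_is_derive db.
near=> y.
have yx : `|x - y| < 1 by near: y; exact: (nbhsx_ballx x (1 : R)).
have h0 := normr_ge0 x; have h1 := normr_ge0 y.
have h2 := ler_norm (- x); have h3 := ler_norm (- y); have h4 := ler_norm (x - y).
rewrite !normrN in h2 h3.
by apply: PE; rewrite /b; lra.
Unshelve. all: by end_near. Qed.

(** Integrals below are differences of values of this function: additivity and reversal of
    orientation become ring identities, and estimates come from the mean value theorem. The value
    [g] is a default for functions without a primitive. *)
Definition primitive g : R -> R :=
  xget g [set P | forall x, is_derive x 1 P (g x)].

Lemma primitiveP g : continuous g -> forall x, is_derive x 1 (primitive g) (g x).
Proof. by move=> /primitive_exists[P dP]; apply: (@xgetPex _ g [set P | forall x, is_derive x 1 P (g x)]); exists P. Qed.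

Lemma primitive_approx g l L a b (M : R) : continuous g ->
  (forall x, is_derive x 1 L (l x)) ->
  (forall x, Num.min a b <= x <= Num.max a b -> `|g x - l x| <= M) ->
  `|(primitive g b - primitive g a) - (L b - L a)| <= M * `|b - a|.
Proof.
move=> cg dL hM.
have [|c cab cE] := @MVT_unordered (primitive g \- L) (g \- l) a b.
  by move=> x; apply: is_deriveB; apply: primitiveP.
have -> : (primitive g b - primitive g a) - (L b - L a) = (g c - l c) * (b - a).
  by move: cE => /=; lra.
by rewrite normrM ler_wpM2r // hM.
Qed.

End Primitive.

(** * Nested intervals and dyadic squares *)

Section NestedIntervals.
Context {R : realType}.

Lemma nested_intervals (u e : nat -> R) : (forall n, 0 <= e n) ->
  (forall n, u n <= u n.+1) -> (forall n, u n.+1 + e n.+1 <= u n + e n) ->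
  exists l, forall n, u n <= l <= u n + e n.
Proof.
move=> e0 uS ueS.
have ui : {homo u : m n / (m <= n)%N >-> m <= n}.
  exact: (homo_leq (@lexx _ _) (@le_trans _ _) uS).
have ued m n : (m <= n)%N -> u n + e n <= u m + e m.
  elim: n => [|n IH]; first by rewrite leqn0 => /eqP->.
  by rewrite leq_eqVlt => /predU1P[->//|/IH]; apply: le_trans.
have ub n m : u m <= u n + e n.
  apply: le_trans (ui _ _ (leq_maxr n m)) _.
  by apply: le_trans (ued _ _ (leq_maxl n m)); rewrite lerDl.
have us : has_sup (range u).
  by split; [exists (u 0%N), 0%N|exists (u 0%N + e 0%N) => _ [m _ <-]].
exists (sup (range u)) => n; apply/andP; split.
  by apply: sup_upper_bound => //; exists n.
by apply: ge_sup; [case: us|move=> _ [m _ <-]].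
Qed.

(** Here [P s t n] is a property of the square with lower left corner [(s, t)] and side [2^-n]; it
    is inherited by some quarter, and the quarters shrink to a point. *)
Lemma dyadic_nested (P : R -> R -> nat -> Prop) : P 0 0 0%N ->
  (forall s t n, P s t n -> exists s' t', [/\ P s' t' n.+1,
     s <= s' <= s + 2^-1 ^+ n.+1 & t <= t' <= t + 2^-1 ^+ n.+1]) ->
  exists s0 t0, [/\ 0 <= s0 <= 1, 0 <= t0 <= 1 & forall n, exists s t,
    [/\ P s t n, s <= s0 <= s + 2^-1 ^+ n & t <= t0 <= t + 2^-1 ^+ n]].
Proof.
move=> P0 PS.
have /choice[F HF] : forall q : R * R * nat, exists q' : R * R,
    P q.1.1 q.1.2 q.2 -> [/\ P q'.1 q'.2 q.2.+1,
     q.1.1 <= q'.1 <= q.1.1 + 2^-1 ^+ q.2.+1 &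
     q.1.2 <= q'.2 <= q.1.2 + 2^-1 ^+ q.2.+1].
  move=> [[s t] n] /=; have [/PS[s' [t' h]]|h] := pselect (P s t n).
    by exists (s', t').
  by exists (0, 0).
pose w := fix w n : R * R := if n is m.+1 then F (w m, m) else (0, 0).
have Pw n : P (w n).1 (w n).2 n.
  by elim: n => //= n IH; have [] := HF (w n, n) IH.
have e0 n : 0 <= 2^-1 ^+ n :> R by rewrite exprn_ge0 // invr_ge0.
have step n := HF (w n, n) (Pw n).
have hS n : (2^-1 ^+ n : R) = 2^-1 ^+ n.+1 + 2^-1 ^+ n.+1.
  by rewrite exprS; set x := _ ^+ n; lra.
have [s0 hs0] : exists l, forall n, (w n).1 <= l <= (w n).1 + 2^-1 ^+ n.
  apply: nested_intervals => // n; have [_ /andP[a b] _] := step n => //.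
  by rewrite (hS n) addrA lerD2r.
have [t0 ht0] : exists l, forall n, (w n).2 <= l <= (w n).2 + 2^-1 ^+ n.
  apply: nested_intervals => // n; have [_ _ /andP[a b]] := step n => //.
  by rewrite (hS n) addrA lerD2r.
exists s0, t0; split.
- by have := hs0 0%N; rewrite /= expr0 add0r.
- by have := ht0 0%N; rewrite /= expr0 add0r.
- by move=> n; exists (w n).1, (w n).2.
Qed.

End NestedIntervals.

(** * Contour integrals over rectangles *)

Section Goursat.
Context {R : realType}.
Local Notation C := (R[i]^o).
Implicit Types (f : C -> C) (phi : R -> C).
Local Notation Re := (@complex.Re R).
Local Notation Im := (@complex.Im R).

Definition cprimitive phi (t : R) : R[i] :=
  primitive (fun s => Re (phi s)) t +i* primitive (fun s => Im (phi s)) t.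

(** The comparison is with the explicit primitive of the affine function; real and imaginary parts
    are estimated separately, hence the factor 2. *)
Lemma cprimitive_affine phi (a d : R[i]) (M s t : R) : continuous phi ->
  (forall x, Num.min s t <= x <= Num.max s t ->
    rnorm (phi x - (a + d * x%:C) : C) <= M) ->
  rnorm (cprimitive phi t - cprimitive phi s -
    (a * (t - s)%:C + d * ((t ^+ 2 - s ^+ 2) / 2)%:C) : C) <= 2 * M * `|t - s|.
Proof.
move=> cphi hM.
have dL (p q x : R) : is_derive x 1 (fun t => p * t + q * (t ^+ 2 / 2)) (p + q * x).
  by apply: is_derive_eq; rewrite !scaler0 /GRing.scale /=; lra.
have cR : continuous (fun s => Re (phi s)).
  by move=> x; apply: continuous_comp; [exact: cphi|exact: Re_continuous].
have cI : continuous (fun s => Im (phi s)).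
  by move=> x; apply: continuous_comp; [exact: cphi|exact: Im_continuous].
have hR x : Num.min s t <= x <= Num.max s t ->
    `|Re (phi x) - (Re a + Re d * x)| <= M.
  move=> /hM; apply: le_trans; apply: le_trans (abs_Re_le _).
  rewrite le_eqVlt; apply/orP; left; apply/eqP; congr `|_|.
  by case: (phi x) (a) (d) => f1 f2 [a1 a2] [d1 d2] /=; lra.
have hI x : Num.min s t <= x <= Num.max s t ->
    `|Im (phi x) - (Im a + Im d * x)| <= M.
  move=> /hM; apply: le_trans; apply: le_trans (abs_Im_le _).
  rewrite le_eqVlt; apply/orP; left; apply/eqP; congr `|_|.
  by case: (phi x) (a) (d) => f1 f2 [a1 a2] [d1 d2] /=; lra.
have := primitive_approx cR (dL (Re a) (Re d)) hR.
have := primitive_approx cI (dL (Im a) (Im d)) hI.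
move=> hi hr; apply: le_trans (rnorm_le_abs _) _.
apply: (@le_trans _ _ (M * `|t - s| + M * `|t - s|)); last by lra.
rewrite lerD //.
  apply: le_trans hr; rewrite le_eqVlt; apply/orP; left; apply/eqP; congr `|_|.
  by case: (a) (d) => a1 a2 [d1 d2] /=; lra.
apply: le_trans hi; rewrite le_eqVlt; apply/orP; left; apply/eqP; congr `|_|.
by case: (a) (d) => a1 a2 [d1 d2] /=; lra.
Qed.

Definition hprim f (y x : R) : R[i] := cprimitive (fun x => f (x +i* y)) x.
Definition vprim f (x y : R) : R[i] := cprimitive (fun y => f (x +i* y)) y.

(** The integral of [f] around the rectangle, counterclockwise for [x1 < x2] and [y1 < y2]. The
    factor ['i] is [dz = i dy] on vertical sides. The end points may come in any order, which only
    changes the sign. *)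
Definition contour f (x1 x2 y1 y2 : R) : R[i] :=
  (hprim f y1 x2 - hprim f y1 x1) + 'i%C * (vprim f x2 y2 - vprim f x2 y1)
  - (hprim f y2 x2 - hprim f y2 x1) - 'i%C * (vprim f x1 y2 - vprim f x1 y1).

Lemma contour_split f (x1 x2 x3 y1 y2 y3 : R) :
  contour f x1 x3 y1 y3 = contour f x1 x2 y1 y2 + contour f x2 x3 y1 y2
    + contour f x1 x2 y2 y3 + contour f x2 x3 y2 y3.
Proof. by rewrite /contour; ring. Qed.

Lemma continuous_hline f y : continuous f -> continuous (fun x : R => f (x +i* y)).
Proof.
move=> cf x; apply: (@continuous_comp _ C _ (fun x : R => x +i* y : C)); last exact: cf.
by apply: continuous_complex => // ?; [exact: cvg_id|exact: cvg_cst].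
Qed.

Lemma continuous_vline f x : continuous f -> continuous (fun y : R => f (x +i* y)).
Proof.
move=> cf y; apply: (@continuous_comp _ C _ (fun y : R => x +i* y : C)); last exact: cf.
by apply: continuous_complex => // ?; [exact: cvg_cst|exact: cvg_id].
Qed.

(** An affine function has a primitive, so its contour integral is 0 and only the deviation from it
    contributes, at most [2 * M] times the length on each side. *)
Lemma contour_approx f (a d : R[i]) (M x1 x2 y1 y2 : R) : continuous f ->
  (forall x y, Num.min x1 x2 <= x <= Num.max x1 x2 ->
    Num.min y1 y2 <= y <= Num.max y1 y2 ->
    rnorm (f (x +i* y) - (a + d * (x +i* y)) : C) <= M) ->
  rnorm (contour f x1 x2 y1 y2 : C) <= 4 * M * (`|x2 - x1| + `|y2 - y1|).
Proof.
move=> cf hM.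
have mm (p q : R) : Num.min p q <= p <= Num.max p q.
  by rewrite ge_min le_max lexx.
have mm' (p q : R) : Num.min p q <= q <= Num.max p q.
  by rewrite ge_min le_max lexx !orbT.
have xyE (x y : R) : x +i* y = x%:C + 'i%C * y%:C.
  by apply/eqP; rewrite eq_complex /=; apply/andP; split; apply/eqP; lra.
have hH y : Num.min y1 y2 <= y <= Num.max y1 y2 ->
    rnorm (hprim f y x2 - hprim f y x1 - ((a + d * 'i%C * y%:C) * (x2 - x1)%:C +
       d * ((x2 ^+ 2 - x1 ^+ 2) / 2)%:C) : C) <= 2 * M * `|x2 - x1|.
  move=> hy; apply: cprimitive_affine; first exact: continuous_hline.
  move=> x hx; have := hM x y hx hy; congr (rnorm _ <= _).
  by rewrite xyE; ring.
have hV x : Num.min x1 x2 <= x <= Num.max x1 x2 ->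
    rnorm (vprim f x y2 - vprim f x y1 - ((a + d * x%:C) * (y2 - y1)%:C +
       (d * 'i%C) * ((y2 ^+ 2 - y1 ^+ 2) / 2)%:C) : C) <= 2 * M * `|y2 - y1|.
  move=> hx; apply: cprimitive_affine; first exact: continuous_vline.
  move=> y hy; have := hM x y hx hy; congr (rnorm _ <= _).
  by rewrite xyE; ring.
have := hH _ (mm y1 y2); have := hH _ (mm' y1 y2).
have := hV _ (mm x1 x2); have := hV _ (mm' x1 x2).
set v2 : C := _ - _ - _; set v1 : C := _ - _ - _.
set h2 : C := _ - _ - _; set h1 : C := _ - _ - _.
have i1 : rnorm ('i%C : C) = 1 by rewrite rnormE /= expr0n expr1n add0r sqrtr1.
have -> : contour f x1 x2 y1 y2 = h1 + 'i%C * v2 - h2 - 'i%C * v1.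
  by rewrite /contour /h1 /h2 /v1 /v2 !rmorphB /=; ring.
move=> b1 b2 b3 b4.
apply: le_trans (rnormB _ _) _; rewrite rnormM i1 mul1r.
apply: le_trans (lerD (rnormB _ _) (lexx _)) _.
apply: le_trans (lerD (lerD (rnormD _ _) (lexx _)) (lexx _)) _; rewrite rnormM i1 mul1r.
move: b1 b2 b3 b4; set X := `|x2 - x1|; set Y := `|y2 - y1|; lra.
Qed.

Lemma between_affine (x a s h s0 : R) : s <= s0 <= s + h ->
  Num.min (x + a * s) (x + a * (s + h)) <= x + a * s0 <=
  Num.max (x + a * s) (x + a * (s + h)).
Proof.
move=> /andP[h1 h2]; rewrite ge_min le_max.
have [a0|a0] := leP 0 a.
  by apply/andP; split; apply/orP; [left|right]; rewrite lerD2l ler_wpM2l.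
by apply/andP; split; apply/orP; [right|left]; rewrite lerD2l ler_wnM2l // ltW.
Qed.

Lemma between_dist (p q x y : R) : Num.min p q <= x <= Num.max p q ->
  Num.min p q <= y <= Num.max p q -> `|x - y| <= `|q - p|.
Proof.
move=> /andP[a1 a2] /andP[b1 b2]; rewrite ler_norml.
have h1 := ler_norm (q - p); have h2 := ler_norm (- (q - p)).
rewrite normrN in h2; move: a1 a2 b1 b2.
by have [pq|pq] := leP p q; lra.
Qed.

End Goursat.

(** * Vanishing of contour integrals *)

Section Cauchy.
Context {R : realType}.
Local Notation C := (R[i]^o).
Implicit Types (f : C -> C).
Local Notation Re := (@complex.Re R).
Local Notation Im := (@complex.Im R).

(** The side lengths are signed, so a box may extend from its corner in any of the four
    directions. *)
Definition box_contour f (x y a b : R) : R[i] := contour f x (x + a) y (y + b).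

Lemma box_contour_quarters f (x y a b : R) : box_contour f x y a b =
  box_contour f x y (a / 2) (b / 2) + box_contour f (x + a / 2) y (a / 2) (b / 2) +
  box_contour f x (y + b / 2) (a / 2) (b / 2) +
  box_contour f (x + a / 2) (y + b / 2) (a / 2) (b / 2).
Proof.
rewrite /box_contour (@contour_split _ f _ (x + a / 2) _ _ (y + b / 2) _).
have -> : x + a / 2 + a / 2 = x + a by lra.
by have -> : y + b / 2 + b / 2 = y + b by lra.
Qed.

Lemma geometric_small (q M e : R) : 0 <= q < 1 -> 0 < e -> exists n, M * q ^+ n < e.
Proof.
move=> /andP[q0 q1] e0; have [M0|M0] := leP M 0.
  by exists 0%N; rewrite expr0 mulr1; apply: le_lt_trans e0.
have /cvgrPdist_lt/(_ (e / M) (divr_gt0 e0 M0)) : q ^+ n @[n --> \oo] --> 0.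
  by apply: cvg_expr; rewrite ger0_norm.
move=> [n _ /(_ n (leqnn n))]; rewrite sub0r normrN ger0_norm ?exprn_ge0 //.
by exists n; rewrite mulrC -ltr_pdivlMr.
Qed.

Lemma half_pow_small (M e : R) : 0 < e -> exists n, M * 2^-1 ^+ n < e.
Proof.
by apply: geometric_small; rewrite invr_ge0 ler0n invf_lt1 // ltr1n.
Qed.

(** Bisection: some quarter always keeps a quarter of the integral. At the limit point
    differentiability makes [f] affine up to an error small relative to the size of the box, which
    forces a smaller integral. *)
Lemma goursat_contradiction f (c x y a b : R) : 0 < c ->
  continuous f ->
  (forall s t, 0 <= s <= 1 -> 0 <= t <= 1 ->
    derivable f ((x + a * s) +i* (y + b * t) : C) 1) ->
  c <= rnorm (box_contour f x y a b : C) -> False.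
Proof.
move=> c0 cf df hc.
(* [s] and [t] are relative coordinates in the unit square, so the signs of [a] and [b] require no
   cases. *)
pose P s t n := c * (4^-1) ^+ n <=
  rnorm (box_contour f (x + a * s) (y + b * t) (a * 2^-1 ^+ n) (b * 2^-1 ^+ n) : C).
have P0 : P 0 0 0%N by rewrite /P !expr0 !mulr0 !addr0 !mulr1.
have PS s t n : P s t n -> exists s' t', [/\ P s' t' n.+1,
     s <= s' <= s + 2^-1 ^+ n.+1 & t <= t' <= t + 2^-1 ^+ n.+1].
  rewrite /P box_contour_quarters.
  have E z : z * 2^-1 ^+ n / 2 = z * 2^-1 ^+ n.+1 :> R by rewrite exprS; ring.
  rewrite !E; set h := 2^-1 ^+ n.+1.
  have h0 : 0 <= h by rewrite /h exprn_ge0 // invr_ge0.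
  have -> : x + a * s + a * h = x + a * (s + h) by lra.
  have -> : y + b * t + b * h = y + b * (t + h) by lra.
  have -> : c * 4^-1 ^+ n = 4 * (c * 4^-1 ^+ n.+1) by rewrite exprS; field.
  set B := fun s t => box_contour f (x + a * s) (y + b * t) (a * h) (b * h).
  rewrite -[box_contour f (x + a * s) (y + b * t) _ _]/(B s t).
  rewrite -[box_contour f (x + a * (s + h)) (y + b * t) _ _]/(B (s + h) t).
  rewrite -[box_contour f (x + a * s) (y + b * (t + h)) _ _]/(B s (t + h)).
  rewrite -[box_contour f (x + a * (s + h)) (y + b * (t + h)) _ _]/(B (s + h) (t + h)).
  set K := c * _ => hK; suff [s' [t' [hB hs ht]]] : exists s' t',
      [/\ K <= rnorm (B s' t' : C), s <= s' <= s + h & t <= t' <= t + h].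
    by exists s', t'.
  have := le_trans hK (rnormD _ _); have := rnormD (B s t + B (s + h) t : C) (B s (t + h)).
  have := rnormD (B s t : C) (B (s + h) t).
  have [k1|k1] := leP K (rnorm (B s t : C)).
    by move=> *; exists s, t; split => //; lra.
  have [k2|k2] := leP K (rnorm (B (s + h) t : C)).
    by move=> *; exists (s + h), t; split => //; lra.
  have [k3|k3] := leP K (rnorm (B s (t + h) : C)).
    by move=> *; exists s, (t + h); split => //; lra.
  by move=> *; exists (s + h), (t + h); split; lra.
have [s0 [t0 [hs0 ht0 hst]]] := dyadic_nested P0 PS.
have /derivable_rnorm[d hd] := df s0 t0 hs0 ht0.
set p : C := (x + a * s0) +i* (y + b * t0) in hd.
pose T := `|a| + `|b|.
have T0 : 0 <= T by rewrite addr_ge0.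
(* An error [e |z - p|] bounds the integral over the n-th box by [4 e T^2 4^-n], which has to be
   below [c 4^-n]; the 1 keeps the denominator positive and the inequality strict. *)
pose e := c / (4 * (T * T) + 1).
have TT : 0 <= T * T by rewrite mulr_ge0.
have e0 : 0 < e by rewrite divr_gt0 //; lra.
have [r r0 hr] := hd e e0.
have [n hn] := half_pow_small T r0.
have [s [t [hP hs ht]]] := hst n.
set h := 2^-1 ^+ n in hn hs ht hP.
have h0 : 0 < h by rewrite /h exprn_gt0 // invr_gt0.
have hP' : rnorm (box_contour f (x + a * s) (y + b * t) (a * h) (b * h) : C) <=
    4 * (e * (T * h)) * (T * h).
  have -> : T * h = `|x + a * s + a * h - (x + a * s)| + `|y + b * t + b * h - (y + b * t)|.
    rewrite !(addrAC _ (_ * h)) !subrr !add0r !normrM (gtr0_norm h0); rewrite /T; lra.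
  rewrite -/(box_contour _ _ _ _ _).
  (* The affine function is the tangent [f p + d (z - p)] at [p]. *)
  apply: (@contour_approx _ _ (f p - d * p) d) => // x' y' hx' hy'.
  have hx0 := between_affine x a hs; have hy0 := between_affine y b ht.
  rewrite !mulrDr !addrA in hx0 hy0.
  have dx := between_dist hx' hx0; have dy := between_dist hy' hy0.
  set D := (X in _ <= _ * X).
  have : rnorm (x' +i* y' - p : C) <= D.
    by apply: le_trans (rnorm_le_abs _) _; apply: lerD.
  have DE : D = T * h.
    by rewrite /D !(addrAC _ (_ * h)) !subrr !add0r !normrM (gtr0_norm h0) /T; lra.
  move=> hD; have := hr (x' +i* y' - p); rewrite subrKC.
  move=> H; have := H (le_lt_trans hD _); rewrite DE => /(_ hn) {}H.
  apply: (@le_trans _ _ (e * rnorm (x' +i* y' - p : C))); last first.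
    by rewrite -DE ler_wpM2l // ltW.
  apply: le_trans H; rewrite le_eqVlt; apply/orP; left; apply/eqP; congr rnorm.
  by rewrite /GRing.scale /=; ring.
move: (le_trans hP hP'); rewrite /P -/h.
have -> : (4^-1 : R) ^+ n = h * h.
  by rewrite -expr2 /h -exprM mulnC exprM; congr (_ ^+ _); field.
have hh : 0 < h * h by rewrite mulr_gt0.
have -> : 4 * (e * (T * h)) * (T * h) = (4 * e * (T * T)) * (h * h) by ring.
rewrite ler_pM2r // /e => H.
have D0 : 0 < 4 * (T * T) + 1 by lra.
have : c * (4 * (T * T) + 1) <= 4 * c * (T * T).
  rewrite -ler_pdivlMr // (le_trans H) // le_eqVlt; apply/orP; left; apply/eqP.
  by field; lra.
by lra.
Qed.

Lemma goursat f (x y a b : R) : continuous f ->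
  (forall s t, 0 <= s <= 1 -> 0 <= t <= 1 ->
    derivable f ((x + a * s) +i* (y + b * t) : C) 1) ->
  box_contour f x y a b = 0.
Proof.
move=> cf df; apply/eqP; have [//|n0] := eqVneq (box_contour f x y a b) 0.
have c0 : 0 < rnorm (box_contour f x y a b : C).
  by rewrite lt_def rnorm_ge0 rnorm_eq0 n0.
by case: (goursat_contradiction c0 cf df (lexx _)).
Qed.

(* The corner is approached by halving: at each step the three other quarters
   contribute nothing. *)
Lemma goursat_corner f (x y a b : R) : continuous f -> a != 0 -> b != 0 ->
  (forall z : C, z != x +i* y -> derivable f z 1) -> box_contour f x y a b = 0.
Proof.
move=> cf a0 b0 df.
have E n : box_contour f x y a b = box_contour f x y (a * 2^-1 ^+ n) (b * 2^-1 ^+ n).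
  elim: n => [|n ->]; first by rewrite expr0 !mulr1.
  rewrite box_contour_quarters.
  have Ez z : z * 2^-1 ^+ n / 2 = z * 2^-1 ^+ n.+1 :> R by rewrite exprS; ring.
  rewrite !Ez; set h := 2^-1 ^+ n.+1.
  have h0 : 0 < h by rewrite exprn_gt0 // invr_gt0.
  (* In some coordinate the three other quarters are at offset [z h (1 + s)] from the corner, so
     they miss it and [goursat] applies to them. *)
  have nz z s : z != 0 -> 0 <= s -> z * h + z * h * s != 0 :> R.
    move=> z0 s0; rewrite -{1}[z * h]mulr1 -mulrDr; have h1 : h != 0 by rewrite gt_eqF.
    by have s1 : 1 + s != 0 by [rewrite gt_eqF //; lra]; rewrite !mulf_neq0.
  rewrite (@goursat _ (x + a * h)) ?(@goursat _ x (y + b * h)) ?(@goursat _ (x + a * h) (y + b * h)) ?addr0 //.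
  - move=> s t /andP[s0 _] /andP[t0 _]; apply: df; apply/eqP => -[H _].
    by move: (nz a s a0 s0); rewrite (_ : a * h + _ = 0) ?eqxx //; lra.
  - move=> s t /andP[s0 _] /andP[t0 _]; apply: df; apply/eqP => -[_ H].
    by move: (nz b t b0 t0); rewrite (_ : b * h + _ = 0) ?eqxx //; lra.
  - move=> s t /andP[s0 _] /andP[t0 _]; apply: df; apply/eqP => -[H _].
    by move: (nz a s a0 s0); rewrite (_ : a * h + _ = 0) ?eqxx //; lra.
apply: (@rnorm_small R C) => e e0.
(* Near the corner continuity alone bounds [f] by [M]; comparison with the affine function 0 then
   bounds the integral by a multiple of the box size. *)
have [r r0 hr] := (nbhs_rnormP _ _).1 ((cvg_rnormP _ _).1 (cf (x +i* y : C)) 1 ltr01).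
pose T := `|a| + `|b|.
pose M := rnorm (f (x +i* y)) + 1.
have [n hn] := half_pow_small T r0.
have [m hm] := half_pow_small (4 * M * T) e0.
set k := maxn n m.
have h0 j : 0 < 2^-1 ^+ j :> R by rewrite exprn_gt0 // invr_gt0.
have hnk : 2^-1 ^+ k <= 2^-1 ^+ n :> R.
  by rewrite ler_wiXn2l ?leq_maxl // ?invr_ge0 // invf_le1 // ler1n.
have hmk : 2^-1 ^+ k <= 2^-1 ^+ m :> R.
  by rewrite ler_wiXn2l ?leq_maxr // ?invr_ge0 // invf_le1 // ler1n.
have T0 : 0 <= T by rewrite addr_ge0.
have M0 : 0 <= M by rewrite /M addr_ge0 ?rnorm_ge0.
rewrite (E k); set h := 2^-1 ^+ k in hnk hmk *.
have hk : 0 < h by exact: h0.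
have Th : T * h < r by apply: le_lt_trans hn; rewrite ler_wpM2l.
have DE : `|x + a * h - x| + `|y + b * h - y| = T * h.
  by rewrite !(addrAC _ (_ * h)) !subrr !add0r !normrM (gtr0_norm hk) /T; lra.
apply: (@le_trans _ _ (4 * M * (T * h))); last first.
  by rewrite mulrA ltW // (le_lt_trans _ hm) // ler_wpM2l // !mulr_ge0.
rewrite -DE; apply: (@contour_approx _ _ 0 0) => // x' y' hx' hy'.
rewrite mul0r addr0 subr0.
have mm (p q : R) : Num.min p q <= p <= Num.max p q.
  by rewrite ge_min le_max lexx.
have dx := between_dist (mm x (x + a * h)) hx'; have dy := between_dist (mm y (y + b * h)) hy'.
have := hr (x' +i* y'); rewrite (le_lt_trans (rnorm_le_abs _)); last first.
  by apply: le_lt_trans (lerD dx dy) _; rewrite DE.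
move=> /(_ isT) H; rewrite -[f (x' +i* y')](subrKC (f (x +i* y))).
by rewrite (le_trans (rnormD _ _)) // /M lerD2l rnormBC ltW.
Qed.

End Cauchy.

(** * Difference quotients in the role of Cauchy's formula *)

Section DifferenceQuotient.
Context {R : realType}.
Local Notation C := (R[i]^o).
Implicit Types (f h : C -> C) (z : C).
Local Notation Re := (@complex.Re R).
Local Notation Im := (@complex.Im R).

Lemma derivable_continuousC f z : derivable f z 1 -> {for z, continuous f}.
Proof. by move=> df; apply: differentiable_continuous; apply/derivable1_diffP. Qed.

Lemma segment_bounded h (phi : R -> C) (a b : R) : continuous h -> continuous phi ->
  exists M, forall t, a <= t <= b -> rnorm (h (phi t)) <= M.
Proof.
move=> ch cphi; have [ab|ab] := leP a b; last first.
  by exists 0 => t; lra.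
have cg : {within `[a, b], continuous (fun t : R => rnorm (h (phi t)))}.
  apply: continuous_subspaceT => t; apply/(@cvgrPdist_lt _ R^o _ _ (nbhs_filter t)) => e e0.
  have ct : {for t, continuous (h \o phi)} by apply: continuous_comp; [exact: cphi|exact: ch].
  near=> s; have : rnorm (h (phi t) - h (phi s)) < e.
    by near: s; exact: (cvg_rnormP _ _).1 ct e e0.
  apply: le_lt_trans.
  rewrite ler_norml; have := rnormD (h (phi t) - h (phi s)) (h (phi s)).
  have := rnormD (h (phi s) - h (phi t)) (h (phi t)).
  rewrite !subrK (rnormBC (h (phi s))) /=; lra.
have [c _ hc] := EVT_max ab cg.
by exists (rnorm (h (phi c))) => t tab; apply: hc; rewrite in_itv.
Unshelve. all: by end_near. Qed.

Lemma rnormV z : rnorm (z^-1 : C) = (rnorm z)^-1.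
Proof. by apply: complexI; rewrite -!normE normfV normE fmorphV. Qed.

(** The value at [z0] makes the quotient continuous there, which is what [goursat_corner] asks of
    the exceptional corner. *)
Definition difference_quotient f (z0 z : C) : C :=
  if z == z0 then 'D_1 f z0 else (f z - f z0) / (z - z0).

Lemma difference_quotient_derivable f (z0 z : C) :
  (forall z, derivable f z 1) -> z != z0 -> derivable (difference_quotient f z0) z 1.
Proof.
move=> df zz0.
apply: (@near_eq_derivable _ _ _ ((f \- cst (f z0)) * (fun z => (z - z0)^-1))).
  near=> w; rewrite /difference_quotient /= ifN //; near: w.
  apply/nbhs_rnormP; exists (rnorm (z - z0)).
    by rewrite lt_def rnorm_ge0 rnorm_eq0 subr_eq0 zz0.
  by move=> w; apply: contraTneq => ->; rewrite ltxx.
apply: derivableM; first by apply: derivableB; [exact: df|exact: derivable_cst].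
apply: derivableV; first by rewrite subr_eq0.
by apply: derivableB; [exact: derivable_id|exact: derivable_cst].
Unshelve. all: by end_near. Qed.

Lemma difference_quotient_continuous f (z0 : C) :
  (forall z, derivable f z 1) -> continuous (difference_quotient f z0).
Proof.
move=> df z; have [->|zz0] := eqVneq z z0; last first.
  exact/derivable_continuousC/difference_quotient_derivable.
apply/(@cvg_rnormP _ C _ _ (nbhs_filter z0)) => e e0.
have [r r0 hr] := (nbhs_rnormP _ _).1 ((cvg_rnormP _ _).1 (df z0) e e0).
apply/nbhs_rnormP; exists r => // u ur.
rewrite /difference_quotient eqxx; case: eqVneq => [_|uz0]; first by rewrite subrr rnorm0.
have := hr (u - z0); rewrite sub0r opprB => /(_ ur); rewrite subr_eq0 => /(_ uz0) /=.
by rewrite [(u - z0) *: 1]mulr1 subrK mulrC.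
Qed.

Lemma difference_quotient_contour f (x1 x2 y1 y2 : R) (z0 : C) :
  x1 < Re z0 -> Re z0 < x2 -> y1 < Im z0 -> Im z0 < y2 ->
  (forall z, derivable f z 1) -> contour (difference_quotient f z0) x1 x2 y1 y2 = 0.
Proof.
case: z0 => a b /= ax1 ax2 by1 by2 df; set g := difference_quotient _ _.
have cg : continuous g by exact: difference_quotient_continuous.
have dg z : z != a +i* b -> derivable g z 1 by exact: difference_quotient_derivable.
have hc p q : p != 0 -> q != 0 -> contour g a (a + p) b (b + q) = 0.
  by move=> p0 q0; apply: goursat_corner.
rewrite (contour_split g x1 a x2 y1 b y2).
(* The rectangle is cut at [z0]; reversing orientations makes [z0] the base corner of each of the
   four pieces. *)
have sx u v w t : contour g u v w t = - contour g v u w t by rewrite /contour; ring.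
have sy u v w t : contour g u v w t = - contour g u v t w by rewrite /contour; ring.
have hc' u v : u != a -> v != b -> contour g a u b v = 0.
  by move=> ua vb; rewrite -(hc (u - a) (v - b)) ?subr_eq0 // !subrKC.
rewrite (sx x1 a y1 b) (sy a x1 y1 b) (sy a x2 y1 b) (sx x1 a b y2).
rewrite !hc' ?(gt_eqF ax2) ?(gt_eqF by2) ?(lt_eqF ax1) ?(lt_eqF by1) //.
by rewrite !oppr0 !addr0.
Qed.

(* If [f] is smaller than [1/1000] on the boundary of the rectangle and [1] at
   ['i], the imaginary part of the contour integral of [(f - 1) / (z - 'i)] is
   negative, since every side winds positively around ['i]. *)
Lemma no_peak_at_i f : (forall z, derivable f z 1) -> f 'i%C = 1 ->
  (forall t : R, -10 <= t <= 10 -> f (t +i* 0) = 0) ->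
  (forall t : R, -10 <= t <= 10 -> rnorm (f (t +i* 20)) <= 1000^-1) ->
  (forall t : R, 0 <= t <= 20 -> rnorm (f (10 +i* t)) <= 1000^-1) ->
  (forall t : R, 0 <= t <= 20 -> rnorm (f ((-10) +i* t)) <= 1000^-1) -> False.
Proof.
move=> df f1 hb ht hr hl.
have cg := @difference_quotient_continuous f 'i%C df.
have := @difference_quotient_contour f (-10) 10 0 20 'i%C _ _ _ _ df.
set g := difference_quotient f 'i%C in cg *.
have gE (x y : R) : (x != 0) || (y != 1) -> g (x +i* y) =
    (f (x +i* y) - 1) / (x +i* (y - 1)).
  move=> xy; rewrite /g /difference_quotient f1 ifN; last first.
    by rewrite eq_complex /=; case/orP: xy => /negPf ->; rewrite ?andbF.
  by congr (_ / _); apply/eqP; rewrite eq_complex /= subr0 !eqxx.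
(* With [w = z - 'i] one has [g = f / w - w^-1], and [|w| >= 1] on the boundary, so [g] is within
   [1/1000] of [- w^-1], whose real and imaginary parts are explicit. *)
have split (x y : R) : 1 <= x ^+ 2 + (y - 1) ^+ 2 ->
    rnorm (f (x +i* y)) <= 1000^-1 ->
    `|Re (g (x +i* y)) + x / (x ^+ 2 + (y - 1) ^+ 2)| <= 1000^-1 /\
    `|Im (g (x +i* y)) - (y - 1) / (x ^+ 2 + (y - 1) ^+ 2)| <= 1000^-1.
  move=> xy fxy; set w : C := x +i* (y - 1).
  have w1 : 1 <= rnorm w by rewrite rnormE /= -[leLHS]sqrtr1 ler_wsqrtr.
  have w0 : w != 0 by rewrite -rnorm_eq0 gt_eqF // (lt_le_trans ltr01).
  have fw : rnorm (f (x +i* y) / w) <= 1000^-1.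
    by rewrite rnormM (le_trans _ fxy) // ler_piMr ?rnorm_ge0 // rnormV invf_le1 ?(lt_le_trans ltr01).
  have gw : g (x +i* y) = f (x +i* y) / w - w^-1.
    rewrite gE ?mulrBl ?div1r // -negb_and; apply: contraTN xy.
    by move=> /andP[/eqP-> /eqP->]; rewrite subrr expr0n /= addr0 -ltNge ltr01.
  rewrite gw !raddfB /=; split.
    by rewrite subrK (le_trans (abs_Re_le _)).
  by rewrite opprK addrK (le_trans (abs_Im_le _)).
move=> E; have {E} : contour g (-10) 10 0 20 = 0 by apply: E => /=; lra.
move/(congr1 Im); apply/eqP; rewrite lt_eqF //.
have imE (a b c d p q r s : C) :
    Im ((a - b) + 'i%C * (c - d) - (p - q) - 'i%C * (r - s)) =
    (Im a - Im b) + (Re c - Re d) - (Im p - Im q) - (Re r - Re s).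
  by case: a b c d p q r s => [? ?] [? ?] [? ?] [? ?] [? ?] [? ?] [? ?] [? ?] /=; lra.
rewrite /contour imE /=.
have dR (phi : R -> C) : continuous phi -> continuous (fun t => Re (phi t)).
  by move=> cphi t; apply: continuous_comp; [exact: cphi|exact: Re_continuous].
have dI (phi : R -> C) : continuous phi -> continuous (fun t => Im (phi t)).
  by move=> cphi t; apply: continuous_comp; [exact: cphi|exact: Im_continuous].
have min1 : Num.min (-10) 10 = -10 :> R by rewrite minEle ifT //; lra.
have max1 : Num.max (-10) 10 = 10 :> R by rewrite maxEle ifT //; lra.
have min2 : Num.min 0 20 = 0 :> R by rewrite minEle ifT //; lra.
have max2 : Num.max 0 20 = 20 :> R by rewrite maxEle ifT //; lra.
have [c1] := MVT_unordered (-10) 10 (primitiveP (dI _ (@continuous_hline _ g 0 cg))).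
have [c2] := MVT_unordered (-10) 10 (primitiveP (dI _ (@continuous_hline _ g 20 cg))).
have [c3] := MVT_unordered 0 20 (primitiveP (dR _ (@continuous_vline _ g 10 cg))).
have [c4] := MVT_unordered 0 20 (primitiveP (dR _ (@continuous_vline _ g (-10) cg))).
rewrite min1 max1 min2 max2 => c4I E4 c3I E3 c2I E2 c1I E1.
rewrite E1 E2 E3 E4.
have sq (x y : R) : 1 <= x ^+ 2 -> 1 <= x ^+ 2 + y ^+ 2.
  by move=> x1; rewrite (le_trans x1) // lerDl sqr_ge0.
have sq' (x y : R) : 1 <= y ^+ 2 -> 1 <= x ^+ 2 + y ^+ 2 by rewrite addrC; exact: sq.
have b1 : 1 <= c1 ^+ 2 + (0 - 1) ^+ 2 by apply: sq'; lra.
have b2 : 1 <= c2 ^+ 2 + (20 - 1) ^+ 2 by apply: sq'; lra.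
have b3 : 1 <= 10 ^+ 2 + (c3 - 1) ^+ 2 by apply: sq; lra.
have b4 : 1 <= (-10) ^+ 2 + (c4 - 1) ^+ 2 by apply: sq; lra.
have n0 : rnorm (f (c1 +i* 0)) <= 1000^-1 by rewrite hb // rnorm0; lra.
have [_ s1] := split c1 0 b1 n0.
have [_ s2] := split c2 20 b2 (ht _ c2I).
have [s3 _] := split 10 c3 b3 (hr _ c3I).
have [s4 _] := split (-10) c4 b4 (hl _ c4I).
have inv0 (x : R) : 1 <= x -> 0 < x^-1 by rewrite invr_gt0; exact: lt_le_trans.
have i2 := inv0 _ b2; have i3 := inv0 _ b3; have i4 := inv0 _ b4.
(* By the mean value theorem each side is 20 times a value of [g]. The bottom side has main term at
   most [-20/101]; the other main terms have the same sign, and the four errors total at most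
   [80/1000]. *)
have i1 : 101^-1 <= (c1 ^+ 2 + (0 - 1) ^+ 2)^-1.
  have le101 : c1 ^+ 2 + (0 - 1) ^+ 2 <= 101.
    by move/andP: c1I => []; clear; nra.
  by rewrite lef_pV2 // posrE (lt_le_trans ltr01) // (le_trans b1).
move: s1 s2 s3 s4 i1 i2 i3 i4; clear; rewrite !ler_norml.
set i1 := (c1 ^+ 2 + _)^-1; set i2 := (c2 ^+ 2 + _)^-1.
set i3 := (10 ^+ 2 + _)^-1; set i4 := ((-10) ^+ 2 + _)^-1.
set g1 := Im _; set g2 := Im _; set g3 := Re _; set g4 := Re _.
clearbody i1 i2 i3 i4 g1 g2 g3 g4; lra.
Qed.

End DifferenceQuotient.

(** * Localization by powers of a polynomial *)

Section EntireFunctions.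
Context {R : realType}.
Local Notation C := (R[i]^o).
Implicit Types (f h : C -> C) (z : C).
Local Notation Re := (@complex.Re R).
Local Notation Im := (@complex.Im R).

Lemma rnormX z n : rnorm (z ^+ n : C) = rnorm z ^+ n.
Proof. by elim: n => [|n IH]; rewrite ?expr0 ?rnorm1 // !exprS rnormM IH. Qed.

Lemma derivable_quadratic (c d z : C) : derivable (fun z : C => c - (z - d) ^+ 2 : C) z 1.
Proof.
have -> : (fun z : C => c - (z - d) ^+ 2 : C) = cst c - (id - cst d : C -> C) ^+ 2 by [].
apply: derivableB; first exact: derivable_cst.
by apply: derivableX; apply: derivableB; [exact: derivable_id|exact: derivable_cst].
Qed.

(** The modulus grows when [z] moves down from [20 'i] along the imaginary axis. On the three sides
    off the real line it is at most [sqrt 8000000 < 2829], reached at the lower corners, while at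
    ['i] it is [2500 + 19^2 = 2861]. On the real side it may be larger, but there the function to be
    localized vanishes. *)
Definition peak z : C := (2500 : R)%:C - (z - 0 +i* 20) ^+ 2.

Lemma derivable_peak z : derivable peak z 1.
Proof. exact: derivable_quadratic. Qed.

Lemma rnorm_sqr_peak x y : rnorm (peak (x +i* y)) ^+ 2 =
  (2500 - x ^+ 2 + (y - 20) ^+ 2) ^+ 2 + (2 * x * (y - 20)) ^+ 2.
Proof.
have -> : peak (x +i* y) = (2500 - x ^+ 2 + (y - 20) ^+ 2) +i* (- (2 * x * (y - 20))).
  have -> : peak (x +i* y) = (2500 : R)%:C - (x +i* (y - 20)) ^+ 2.
    rewrite /peak; congr (_ - _ ^+ 2).
    by apply/eqP; rewrite eq_complex /= subr0 !eqxx.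
  by apply/eqP; rewrite expr2 eq_complex /=; apply/andP; split; apply/eqP; lra.
by rewrite rnorm_sqr /= sqrrN.
Qed.

Lemma rnorm_peak_at_i : rnorm (peak 'i%C) = 2861.
Proof.
have sq_inj (s t : R) : 0 <= s -> 0 <= t -> s ^+ 2 = t ^+ 2 -> s = t.
  by move=> s0 t0 /eqP; rewrite eqrXn2 // => /eqP.
apply: sq_inj; [exact: rnorm_ge0|lra|].
by rewrite [LHS](rnorm_sqr_peak 0 1); lra.
Qed.

Lemma rnorm_peak_le x y :
  (2500 - x ^+ 2 + (y - 20) ^+ 2) ^+ 2 + (2 * x) ^+ 2 * (y - 20) ^+ 2 <= 2829 ^+ 2 ->
  rnorm (peak (x +i* y)) <= 2829.
Proof.
rewrite -exprMn -rnorm_sqr_peak => H.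
have h2829 : 0 <= 2829 :> R by lra.
by have := ler_abs_sqr h2829 H; rewrite (ger0_norm (rnorm_ge0 _)).
Qed.

Lemma rnorm_peak_top t : -10 <= t <= 10 -> rnorm (peak (t +i* 20)) <= 2829.
Proof.
move=> ht; apply: rnorm_peak_le; have : 0 <= t ^+ 2 <= 100 by rewrite sqr_ge0 /=; nra.
by clear; rewrite subrr; set x := t ^+ 2; nra.
Qed.

Lemma rnorm_peak_side (s t : R) : s ^+ 2 = 100 -> 0 <= t <= 20 ->
  rnorm (peak (s +i* t)) <= 2829.
Proof.
move=> s2 ht; apply: rnorm_peak_le; rewrite exprMn s2.
have : 0 <= (t - 20) ^+ 2 <= 400 by rewrite sqr_ge0 /=; nra.
by clear; set x := (t - 20) ^+ 2; nra.
Qed.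

(* [|peak|] is larger at ['i] than on the three sides of the
   rectangle off the real line, so that its powers localize [h] at ['i]. *)
Lemma entire_zero_at_i h : (forall z, derivable h z 1) ->
  (forall t : R, h t%:C = 0) -> h 'i%C = 0.
Proof.
move=> dh h0; apply/eqP; apply: contrapT => /negP hi.
have ch : continuous h by move=> z; exact: derivable_continuousC.
have cid : continuous (id : R -> R) by move=> ?; exact: cvg_id.
have ccst (c : R) : continuous (cst c : R -> R) by move=> ?; exact: cvg_cst.
have [M1 hM1] := @segment_bounded _ h _ (-10) 10 ch (continuous_complex cid (ccst 20)).
have [M2 hM2] := @segment_bounded _ h _ 0 20 ch (continuous_complex (ccst 10) cid).
have [M3 hM3] := @segment_bounded _ h _ 0 20 ch (continuous_complex (ccst (-10)) cid).
pose M := Num.max M1 (Num.max M2 M3).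
have [a [b [ab pib topa sidea]]] : exists a b : R, [/\ 0 <= a < b,
    rnorm (peak 'i%C) = b,
    forall t, -10 <= t <= 10 -> rnorm (peak (t +i* 20)) <= a &
    forall s t : R, s ^+ 2 = 100 -> 0 <= t <= 20 -> rnorm (peak (s +i* t)) <= a].
  exists 2829, 2861; split; first lra.
  - exact: rnorm_peak_at_i.
  - exact: rnorm_peak_top.
  - exact: rnorm_peak_side.
have /andP[a0 altb] := ab.
have b0 : 0 < b := le_lt_trans a0 altb.
have p0 : peak 'i%C != 0 by rewrite -rnorm_eq0 pib gt_eqF.
have hi0 : 0 < rnorm (h 'i%C) by rewrite lt_def rnorm_ge0 rnorm_eq0 hi.
have [n hn] : exists n, (M / rnorm (h 'i%C)) * (a / b) ^+ n <= 1000^-1.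
  have [||n hn] := @geometric_small _ (a / b) (M / rnorm (h 'i%C)) 1000^-1.
  - by rewrite divr_ge0 ?(ltW b0) // ltr_pdivrMr // mul1r.
  - lra.
  - by exists n; exact: ltW.
(* Normalized to be 1 at ['i]. It keeps the zeros of [h] on the real line, so bounds are needed on
   the three other sides only. *)
pose f z : C := (h 'i%C * peak 'i%C ^+ n)^-1 * (h z * peak z ^+ n).
have fle z : rnorm (h z) <= M -> rnorm (peak z : C) <= a -> rnorm (f z) <= 1000^-1.
  move=> hz pz; apply: le_trans hn; rewrite /f !rnormM rnormV !rnormM !rnormX pib.
  rewrite expr_div_n mulrACA -invfM [leRHS]mulrC ler_wpM2l //.
    by rewrite invr_ge0 mulr_ge0 ?rnorm_ge0 // exprn_ge0 // ltW.
  by rewrite ler_pM ?exprn_ge0 ?rnorm_ge0 // lerXn2r ?nnegrE ?rnorm_ge0.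
apply: (@no_peak_at_i _ f).
- move=> z; have -> : f = cst (h 'i%C * peak 'i%C ^+ n)^-1 * (h * peak ^+ n).
    by apply/funext => w; rewrite /f !mulrfctE exprfctE.
  apply: derivableM; first exact: derivable_cst.
  by apply: derivableM => //; apply: derivableX; exact: derivable_peak.
- by rewrite /f mulVf // mulf_neq0 // expf_neq0.
- by move=> t _; rewrite /f -[t +i* 0]/(t%:C) h0 mul0r mulr0.
- move=> t ht; apply: fle; first by rewrite (le_trans (hM1 t ht)) // le_max lexx.
  exact: topa.
- move=> t ht; apply: fle; first by rewrite (le_trans (hM2 t ht)) // !le_max lexx orbT.
  by apply: sidea => //; lra.
- move=> t ht; apply: fle; first by rewrite (le_trans (hM3 t ht)) // !le_max lexx !orbT.
  by apply: sidea => //; lra.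
Qed.

(** The substitution [z |-> beta z] preserves the real line and carries ['i] to [i beta], which
    reduces the claim to the point ['i]. *)
Theorem entire_constant_on_real_line h (c : C) : (forall z, derivable h z 1) ->
  (forall t : R, h t%:C = c) -> forall beta, h (0 +i* beta) = c.
Proof.
move=> dh hc beta; have [->|b0] := eqVneq beta 0; first exact: (hc 0).
have iE : (0 +i* beta : C) = beta%:C * 'i%C.
  by apply/eqP; rewrite eq_complex /=; apply/andP; split; apply/eqP; lra.
apply/eqP; rewrite -subr_eq0; apply/eqP; rewrite iE.
apply: (@entire_zero_at_i (fun z => h (beta%:C * z) - c)); last first.
  by move=> t; rewrite -rmorphM hc subrr.
move=> z; apply: derivableB; last exact: derivable_cst.
have /derivable_rnorm[D hD] := dh (beta%:C * z).
apply/derivable_rnorm; exists (beta%:C * D) => e e0.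
have nb : 0 < `|beta| by rewrite normr_gt0.
have [r r0 hr] := hD (e / `|beta|) (divr_gt0 e0 nb).
exists (r / `|beta|); first by rewrite divr_gt0.
move=> u ur; have := hr (beta%:C * u).
rewrite rnormM rnorm_real mulrC -ltr_pdivlMr // => /(_ ur).
rewrite -mulrDr [rnorm u * _]mulrC mulrA divfK ?gt_eqF //.
by apply: le_trans; rewrite /GRing.scale /= mulrCA mulrA.
Qed.

End EntireFunctions.

(** * C*-algebras and their states *)

Section Completeness.
Context {R : realType} {V : completeNormedModType R[i]}.

Lemma geometric_cvg (u : nat -> V) (M q : R) : 0 <= q < 1 ->
  (forall n, rnorm (u n.+1 - u n) <= M * q ^+ n) ->
  exists l, forall e : R, 0 < e -> exists N, forall n, (N <= n)%N -> rnorm (l - u n) < e.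
Proof.
move=> /andP[q0 q1] hu.
have q1' : 0 < 1 - q by rewrite subr_gt0.
have M0 : 0 <= M by have := hu 0%N; rewrite expr0 mulr1; apply: le_trans; exact: rnorm_ge0.
have tail n m : rnorm (u (n + m)%N - u n) <= M / (1 - q) * q ^+ n.
  suff H : rnorm (u (n + m)%N - u n) <= M / (1 - q) * q ^+ n * (1 - q ^+ m).
    apply: le_trans H _; rewrite ler_piMr ?mulr_ge0 ?invr_ge0 ?exprn_ge0 ?(ltW q1') //.
    by rewrite gerBl exprn_ge0.
  elim: m => [|m IH]; first by rewrite addn0 subrr rnorm0 expr0 subrr mulr0.
  rewrite addnS -(subrK (u (n + m)%N) (u _.+1)) -addrA.
  apply: le_trans (rnormD _ _) _; apply: le_trans (lerD (hu _) IH) _.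
  rewrite exprD exprS le_eqVlt; apply/orP; left; apply/eqP; field.
  by rewrite gt_eqF.
have cu : cvg (u @ \oo).
  apply: cauchy_cvg; apply: cauchy_exP => e e0.
  have eE : e = (complex.Re e)%:C by rewrite RRe_real // gtr0_real.
  have e0' : 0 < complex.Re e by rewrite -ltcR -eE.
  have M1 : 0 < M / (1 - q) + 1.
    by rewrite ltr_wpDl // divr_ge0 // ltW.
  have /cvgrPdist_lt/(_ _ (divr_gt0 e0' M1)) : q ^+ n @[n --> \oo] --> 0.
    by apply: cvg_expr; rewrite ger0_norm.
  move=> [N _ /(_ N (leqnn N))]; rewrite sub0r normrN ger0_norm ?exprn_ge0 // => hN.
  exists (u N); exists N => // n /= Nn.
  rewrite -ball_normE /= normE eE ltcR rnormBC -(subnKC Nn).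
  apply: le_lt_trans (tail _ _) _; rewrite ltr_pdivlMr // in hN.
  by apply: le_lt_trans hN; rewrite mulrC ler_wpM2l ?exprn_ge0 // lerDl.
exists (lim (u @ \oo)) => e e0.
have [N _ hN] := (cvg_rnormP _ _).1 cu e e0.
by exists N => n; apply: hN.
Qed.

End Completeness.

Section CStar.
Context {R : realType} {A : cstarAlgType R}.
Implicit Types (a b x y : A).

Lemma cmul0l a : 0 ** a = 0.
Proof. by apply: (addrI (0 ** a)); rewrite -cmulDl !addr0. Qed.

Lemma cmul0r a : a ** 0 = 0.
Proof. by apply: (addrI (a ** 0)); rewrite -cmulDr !addr0. Qed.

Lemma cmulNl a b : (- a) ** b = - (a ** b).
Proof. by rewrite -scaleN1r cmulZl scaleN1r. Qed.

Lemma cmulNr a b : a ** (- b) = - (a ** b).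
Proof. by rewrite -scaleN1r cmulZr scaleN1r. Qed.

Lemma cmulBl a b x : (a - b) ** x = a ** x - b ** x.
Proof. by rewrite cmulDl cmulNl. Qed.

Lemma cmulBr a b x : x ** (a - b) = x ** a - x ** b.
Proof. by rewrite cmulDr cmulNr. Qed.

Lemma cmul_suml (I : Type) (s : seq I) (P : pred I) (F : I -> A) x :
  (\sum_(i <- s | P i) F i) ** x = \sum_(i <- s | P i) (F i ** x).
Proof. by elim/big_rec2: _ => [|i _ b _ <-]; rewrite ?cmul0l ?cmulDl. Qed.

Lemma cmul_sumr (I : Type) (s : seq I) (F : I -> A) x :
  x ** (\sum_(i <- s) F i) = \sum_(i <- s) (x ** F i).
Proof. by elim/big_rec2: _ => [|i _ b _ <-]; rewrite ?cmul0r ?cmulDr. Qed.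

Lemma star0 : star (0 : A) = 0.
Proof. by apply: (addrI (star 0)); rewrite -starD !addr0. Qed.

Lemma starN a : star (- a) = - star a.
Proof. by apply: (addIr (star a)); rewrite -starD !addNr star0. Qed.

Lemma starB a b : star (a - b) = star a - star b.
Proof. by rewrite starD starN. Qed.

Lemma star1 : star (cone : A) = cone.
Proof. by rewrite -[LHS]cmul1l -{1}[cone]starK -starM cmul1l starK. Qed.

Lemma star_sum (I : Type) (s : seq I) (F : I -> A) :
  star (\sum_(i <- s) F i) = \sum_(i <- s) star (F i).
Proof. by elim/big_rec2: _ => [|i _ b _ <-]; rewrite ?star0 ?starD. Qed.

Lemma rnorm_cmul a b : rnorm (a ** b) <= rnorm a * rnorm b.
Proof. by rewrite -lecR rmorphM /= -!normE cstar_normM. Qed.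

Lemma rnorm_starmul a : rnorm (star a ** a) = rnorm a ^+ 2.
Proof. by apply: complexI; rewrite rmorphXn /= -!normE cstar_identity. Qed.

Lemma rnorm_star a : rnorm (star a) = rnorm a.
Proof.
have le b : rnorm b <= rnorm (star b).
  have [->|b0] := eqVneq b 0; first by rewrite star0.
  have : rnorm b ^+ 2 <= rnorm (star b) * rnorm b by rewrite -rnorm_starmul rnorm_cmul.
  by rewrite expr2 ler_pM2r // lt_def rnorm_ge0 rnorm_eq0 b0.
by apply/eqP; rewrite eq_le le -{2}[a]starK le.
Qed.

(* [x = (b + x ^ 2) / 2] makes [1 - b] the square of [1 - x]; the map
   [x |-> (b + x ^ 2) / 2] contracts the ball of radius [1 - sqrt (1 - |b|)]. *)
Lemma selfadjoint_sqrt b : star b = b -> rnorm b < 1 ->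
  exists x, star x = x /\ cone - b = star (cone - x) ** (cone - x).
Proof.
move=> bb b1.
have b0 := rnorm_ge0 b.
(* The smaller root of [r = (|b| + r^2) / 2], which is why the ball of radius [r] is invariant. *)
pose r := 1 - Num.sqrt (1 - rnorm b).
have s0 : 0 < Num.sqrt (1 - rnorm b) by rewrite sqrtr_gt0 subr_gt0.
have s1 : Num.sqrt (1 - rnorm b) <= 1 by rewrite -[leRHS]sqrtr1 ler_wsqrtr // gerBl.
have r0 : 0 <= r by rewrite subr_ge0.
have r1 : r < 1 by rewrite gtrBl.
have rE : rnorm b + r * r = 2 * r.
  have := sqr_sqrtr (_ : 0 <= 1 - rnorm b); rewrite subr_ge0 => /(_ (ltW b1)).
  by rewrite /r; set s := Num.sqrt _ => H; nra.
pose T x : A := (2^-1 : R)%:C *: (b + x ** x).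
have half y : rnorm ((2^-1 : R)%:C *: y : A) = 2^-1 * rnorm y.
  by rewrite rnormZ rnorm_real ger0_norm // invr_ge0.
have TB x y : rnorm x <= r -> rnorm y <= 1 ->
    rnorm (T x - T y) <= (r + rnorm y) / 2 * rnorm (x - y).
  move=> hx hy; rewrite /T -scalerBr half opprD addrACA subrr add0r.
  have -> : x ** x - y ** y = x ** (x - y) + (x - y) ** y.
    by rewrite cmulBr cmulBl addrA subrK.
  have := rnormD (x ** (x - y)) ((x - y) ** y).
  have := rnorm_cmul x (x - y); have := rnorm_cmul (x - y) y.
  have := rnorm_ge0 (x - y); nra.
pose u := fix u n : A := if n is m.+1 then T (u m) else 0.
have ur n : rnorm (u n) <= r.
  elim: n => [|n IH] /=; first by rewrite rnorm0.
  rewrite half; have := rnormD b (u n ** u n); have := rnorm_cmul (u n) (u n).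
  have := rnorm_ge0 (u n); nra.
have ustar n : star (u n) = u n.
  by elim: n => [|n IH] /=; rewrite ?star0 // starZ starD starM IH bb conjc_real.
have [||x hx] := @geometric_cvg _ _ u (rnorm (u 1%N - u 0%N)) r.
- by rewrite r0.
- elim=> [|n IH]; first by rewrite expr0 mulr1.
  rewrite exprS mulrCA; apply: le_trans (ler_wpM2l r0 IH).
  apply: le_trans (TB (u n.+1) (u n) (ur _) (le_trans (ur n) (ltW r1))) _.
  rewrite ler_wpM2r ?rnorm_ge0 // ler_pdivrMr // mulr2n.
  by have := ur n; lra.
have xx : star x = x.
  apply/eqP; rewrite -subr_eq0; apply/eqP/rnorm_small => e e0.
  have [N /(_ N (leqnn N)) hN] := hx (e / 2) (divr_gt0 e0 (ltr0Sn _ 1)).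
  rewrite -(subrK (u N) (star x)) -addrA -{1}(ustar N) -starB.
  apply: le_trans (rnormD _ _) _; rewrite rnorm_star (rnormBC (u N)).
  by rewrite [leRHS](splitr e) lerD ?ltW.
have Tx : T x = x.
  apply/eqP; rewrite -subr_eq0; apply/eqP/rnorm_small => e e0.
  have h2 : 0 < Num.min 1 (e / 4) by rewrite lt_min ltr01 divr_gt0.
  have [N hN] := hx _ h2.
  have := hN N (leqnn N); have := hN N.+1 (leqnSn N); rewrite !lt_min.
  move=> /andP[_ n1] /andP[n2 n3].
  have x2 : rnorm x <= 2.
    rewrite -(subrK (u N) x); apply: le_trans (rnormD _ _) _.
    by have := ur N; lra.
  rewrite -(subrK (T (u N)) (T x)) -addrA; apply: le_trans (rnormD _ _) _.
  have -> : rnorm (T (u N) - x) = rnorm (x - u N.+1) by rewrite rnormBC.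
  have : rnorm (T x - T (u N)) <= (rnorm x + rnorm (u N)) / 2 * rnorm (x - u N).
    rewrite /T -scalerBr half opprD addrACA subrr add0r.
    have -> : x ** x - u N ** u N = x ** (x - u N) + (x - u N) ** u N.
      by rewrite cmulBr cmulBl addrA subrK.
    have := rnormD (x ** (x - u N)) ((x - u N) ** u N).
    have := rnorm_cmul x (x - u N); have := rnorm_cmul (x - u N) (u N); lra.
  have := ur N; have := rnorm_ge0 (x - u N); have := rnorm_ge0 (u N).
  set p := rnorm (x - u N) in n3 *; nra.
exists x; split=> //.
rewrite starB star1 xx cmulBl !cmulBr cmul1l cmul1r.
have : b + x ** x = x + x.
  rewrite -{3 4}Tx /T -scalerDl -rmorphD /=.
  have -> : 2^-1 + 2^-1 = 1 :> R by lra.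
  by rewrite scale1r.
move=> /(canRL (addrK _)) ->.
by rewrite cmul1l -[x + x - _]addrA opprD addrA.
Qed.

End CStar.

(** * States: positivity, boundedness and the Cauchy-Schwarz inequality *)

Section States.
Context {R : realType} {A : cstarAlgType R}.
Implicit Types (w : functionals A) (a b x y : A).
Local Notation Re := (@complex.Re R).
Local Notation Im := (@complex.Im R).

Section Linear.
Context (w : A -> R[i]) (lw : scalar w).

Lemma scalarD a b : w (a + b) = w a + w b.
Proof. by rewrite -[a]scale1r lw mul1r scale1r. Qed.

Lemma scalar0 : w 0 = 0.
Proof. by apply: (addrI (w 0)); rewrite -scalarD !addr0. Qed.

Lemma scalarZ (c : R[i]) a : w (c *: a) = c * w a.
Proof. by rewrite -[c *: a]addr0 lw scalar0 addr0. Qed.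

Lemma scalarN a : w (- a) = - w a.
Proof. by apply: (addrI (w a)); rewrite -scalarD !subrr scalar0. Qed.

Lemma scalarB a b : w (a - b) = w a - w b.
Proof. by rewrite scalarD scalarN. Qed.

Lemma scalar_sum (I : Type) (s : seq I) (F : I -> A) :
  w (\sum_(i <- s) F i) = \sum_(i <- s) w (F i).
Proof. by elim/big_rec2: _ => [|i _ b _ <-]; rewrite ?scalar0 ?scalarD. Qed.

End Linear.

Section State.
Context (w : functionals A) (sw : is_state w).

Lemma state_scalar : scalar (w : A -> R[i]). Proof. by case: sw. Qed.
Lemma state_pos a : 0 <= w (star a ** a). Proof. by case: sw. Qed.
Lemma state1 : w cone = 1. Proof. by case: sw. Qed.

Let wD := scalarD state_scalar.
Let wZ := scalarZ state_scalar.
Let wN := scalarN state_scalar.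
Let wB := scalarB state_scalar.

(** Positivity at [b + 1] makes [w b + w (star b)] real; [b = a] and [b = i a] give the two parts of
    [w (star a)]. *)
Lemma state_star a : w (star a) = conjc (w a).
Proof.
have real b : Im (w (star b)) + Im (w b) = 0.
  have := ger0_Im (state_pos (b + cone)).
  rewrite starD star1 cmulDl !cmulDr !cmul1l cmul1r !wD state1 !raddfD /=.
  by rewrite (ger0_Im (state_pos b)) add0r addr0.
have h1 := real a; have := real ('i%C *: a).
rewrite starZ !wZ.
case: (w (star a)) (w a) h1 => p q [r s] /= h1 h2.
by apply/eqP; rewrite eq_complex /=; apply/andP; split; apply/eqP; lra.
Qed.

(** Positivity at [a - w(a) 1]: a variance is nonnegative. *)
Lemma state_sqr_le a : rnorm (w a : R[i]^o) ^+ 2 <= Re (w (star a ** a)).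
Proof.
have := state_pos (a - (w a) *: cone).
rewrite starB starZ star1 cmulBl !cmulBr !cmulZl !cmulZr cmul1l cmul1r.
rewrite cmul1l !wB !wZ state1 state_star mulr1 mulrC subrr subr0 subr_ge0.
rewrite lecE => /andP[_]; apply: le_trans; rewrite rnorm_sqr.
by case: (w a) => p q /=; lra.
Qed.

(** After division by [e + |a|^2] the element [star a ** a] has norm below 1, so [selfadjoint_sqrt]
    writes [1] minus it as a positive element. *)
Lemma state_starmul_le a : Re (w (star a ** a)) <= rnorm a ^+ 2.
Proof.
apply/ler_addgt0Pl => e e0.
set n := rnorm a ^+ 2; have n0 : 0 <= n by rewrite exprn_ge0 // rnorm_ge0.
have ne : 0 < e + n by rewrite ltr_wpDr.
pose b := ((e + n)^-1)%:C *: (star a ** a).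
have bb : star b = b by rewrite /b starZ conjc_real starM starK.
have b1 : rnorm b < 1.
  rewrite /b rnormZ rnorm_real gtr0_norm ?invr_gt0 // rnorm_starmul mulrC.
  by rewrite ltr_pdivrMr // mul1r ltrDr.
have [x [_ hx]] := selfadjoint_sqrt bb b1.
have := state_pos (cone - x); rewrite -hx wB state1 wZ subr_ge0 lecE => /andP[_].
case: (w (star a ** a)) => p q /=; rewrite mul0r subr0 mulrC ler_pdivrMr //.
by rewrite mul1r.
Qed.

Lemma state_bound a : rnorm (w a : R[i]^o) <= rnorm a.
Proof.
rewrite -(@ler_pXn2r _ 2) ?nnegrE ?rnorm_ge0 //.
exact: le_trans (state_sqr_le a) (state_starmul_le a).
Qed.

Lemma state_cauchy_schwarz x y :
  rnorm (w (star x ** y) : R[i]^o) ^+ 2 <= Re (w (star x ** x)) * Re (w (star y ** y)).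
Proof.
pose c : R[i] := w (star x ** y); rewrite -/c rnorm_sqr.
pose k := Re (w (star y ** y)); pose p := Re (w (star x ** x)); rewrite -/k -/p.
have yxE : w (star y ** x) = conjc c by rewrite -state_star starM starK.
have xxE : w (star x ** x) = p%:C.
  have := state_pos x; rewrite lecE => /andP[/eqP i0 _].
  by apply/eqP; rewrite eq_complex /= eqxx /=; apply/eqP.
have p0 : 0 <= p by have := state_pos x; rewrite xxE lecE => /andP[].
have k0 : 0 <= k by have := state_pos y; rewrite lecE => /andP[].
(* Positivity at [y + t c x]; the factor [c] turns both cross terms into [t |c|^2]. *)
have h (t : R) : 0 <= k + 2 * t * (Re c ^+ 2 + Im c ^+ 2) +
    t ^+ 2 * (Re c ^+ 2 + Im c ^+ 2) * p.
  have := state_pos (y + (t%:C * c) *: x).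
  rewrite starD starZ cmulDl !cmulDr !cmulZl !cmulZr !wD !wZ xxE yxE -/c.
  rewrite lecE => /andP[_]; rewrite /= /k; case: (w _) (c) => a b [u v] /=; lra.
have n0 := addr_ge0 (sqr_ge0 (Re c)) (sqr_ge0 (Im c)).
clear xxE yxE; clearbody k p; move: p0 h n0.
generalize (Re c ^+ 2 + Im c ^+ 2) => n + h n0.
rewrite le_eqVlt => /predU1P[p0|p0].
  rewrite -p0 mul0r leNgt; apply/negP => n1.
  (* For [p = 0] the polynomial is affine in [t], and here it takes the value [-1]. *)
  have := h (- (k + 1) / (2 * n)); rewrite -p0 mulr0 addr0.
  have -> : 2 * (- (k + 1) / (2 * n)) * n = - (k + 1) by field; rewrite gt_eqF.
  by rewrite opprD addrA subrr add0r oppr_ge0 ler10.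
(* The minimizer of the quadratic polynomial in [t]. *)
have := h (- p^-1); have -> : k + 2 * - p^-1 * n + (- p^-1) ^+ 2 * n * p = k - n / p.
  by field; rewrite gt_eqF.
by rewrite subr_ge0 ler_pdivrMr // mulrC.
Qed.

Lemma state_null x y : w (star x ** x) = 0 -> w (star x ** y) = 0.
Proof.
move=> x0; apply/eqP; rewrite -(@rnorm_eq0 R R[i]^o) -sqrf_eq0 eq_le sqr_ge0 andbT.
by apply: le_trans (state_cauchy_schwarz x y) _; rewrite x0 mul0r.
Qed.

End State.
End States.

(* A map is specified through approximations: [p i] runs over a dense set of
   [V] and [q i] is the prescribed value at [p i]. *)
Lemma dense_extension (R : realType) (V W : completeNormedModType R[i])
    (I : Type) (p : I -> V) (q : I -> W) :
  (forall v (e : R), 0 < e -> exists i, rnorm (v - p i) < e) ->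
  (forall i j, rnorm (q i - q j) <= rnorm (p i - p j)) ->
  exists T : V -> W, (forall i, T (p i) = q i) /\
    forall u v, rnorm (T u - T v) <= rnorm (u - v).
Proof.
move=> dp qp.
have pw n : 0 < 2^-1 ^+ n :> R by rewrite exprn_gt0 // invr_gt0.
(* The limit is characterized by all approximants of [v], not by one sequence, so that values at
   different points can be compared through arbitrary approximants. *)
have /choice[T hT] : forall v, exists l, forall e : R, 0 < e ->
    exists d : R, 0 < d /\ forall i, rnorm (v - p i) < d -> rnorm (l - q i) < e.
  move=> v; have /choice[s hs] := fun n => dp v _ (pw n).
  have [||l hl] := @geometric_cvg _ _ (fun n => q (s n)) 2 2^-1.
  - by rewrite invr_ge0 ler0n invf_lt1 // ltr1n.
  - move=> n; apply: le_trans (qp _ _) _.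
    rewrite -(subrK v (p _)) -addrA; apply: le_trans (rnormD _ _) _.
    rewrite rnormBC; have := hs n.+1; have := hs n; rewrite exprS.
    by have := pw n; lra.
  exists l => e e0.
  have [N hN] := hl _ (divr_gt0 e0 (ltr0Sn R 1)).
  have /cvgrPdist_lt/(_ _ (divr_gt0 e0 (ltr0Sn R 3))) : (2^-1 : R) ^+ n @[n --> \oo] --> 0.
    by apply: cvg_expr; rewrite ger0_norm ?invr_ge0 // invf_lt1 // ltr1n.
  move=> [M _ hM]; set n := maxn N M.
  have := hM n (leq_maxr N M); rewrite /= sub0r normrN gtr0_norm // => hn.
  exists (e / 4); split=> [|i hi]; first by rewrite divr_gt0.
  rewrite -(subrK (q (s n)) l) -addrA; apply: le_lt_trans (rnormD _ _) _.
  have := hN n (leq_maxl N M); have := qp (s n) i; have := hs n.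
  have : rnorm (p (s n) - p i) <= rnorm (v - p (s n)) + rnorm (v - p i).
    have -> : p (s n) - p i = (p (s n) - v) + (v - p i) by rewrite addrA subrK.
    by apply: le_trans (rnormD _ _) _; rewrite (rnormBC v (p (s n))).
  by lra.
have TB u v : rnorm (T u - T v) <= rnorm (u - v).
  apply/ler_addgt0Pl => e e0; have e4 : 0 < e / 4 by rewrite divr_gt0.
  have [d1 [d10 h1]] := hT u _ e4; have [d2 [d20 h2]] := hT v _ e4.
  have m1 : 0 < Num.min d1 (e / 4) by rewrite lt_min d10.
  have m2 : 0 < Num.min d2 (e / 4) by rewrite lt_min d20.
  have [k] := dp u _ m1; have [j] := dp v _ m2; rewrite !lt_min.
  move=> /andP[/h2 hj j4] /andP[/h1 hi i4].
  have -> : T u - T v = (T u - q k) + ((q k - q j) + (q j - T v)).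
    by rewrite !addrA !subrK.
  apply: le_trans (rnormD _ _) _; have := rnormD (q k - q j) (q j - T v).
  have := qp k j; rewrite (rnormBC (q j)).
  have -> : p k - p j = (p k - u) + ((u - v) + (v - p j)).
    by rewrite !addrA !subrK.
  have := rnormD (p k - u) (u - v + (v - p j)); have := rnormD (u - v) (v - p j).
  by rewrite (rnormBC (p k)); lra.
exists T; split=> // i; apply/eqP; rewrite -subr_eq0; apply/eqP/rnorm_small => e e0.
have [d [d0 /(_ i)]] := hT (p i) e e0.
by rewrite subrr rnorm0 => /(_ d0)/ltW.
Qed.

(** * Regular representations *)

Section Esum.
Context {R : realType} {T : choiceType}.
Local Open Scope ereal_scope.
Implicit Types (a : T -> \bar R).

Lemma esum_ge1 a i : (forall i, 0 <= a i) -> a i <= \esum_(i in [set: T]) a i.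
Proof.
move=> a0; rewrite -(esum_set1 (a0 i)) esum_mkcond; apply: le_esum => j _.
by case: ifP.
Qed.

Lemma esumZ_le a (c : \bar R) : (forall i, 0 <= a i) -> 0 <= c ->
  \esum_(i in [set: T]) (c * a i) <= c * \esum_(i in [set: T]) a i.
Proof.
move=> a0 c0; apply: ge_ereal_sup => _ [X [finX _] <-].
rewrite -ge0_mule_fsumr //; apply: lee_pmul => //; first exact: fsume_ge0.
by apply: ereal_sup_ubound; exists X.
Qed.

(** For finite [c] other than 0 the missing inequality is [esumZ_le] for the family [c * a] and the
    factor [c^-1]. *)
Lemma esumZ a (c : \bar R) : (forall i, 0 <= a i) -> 0 <= c ->
  \esum_(i in [set: T]) (c * a i) = c * \esum_(i in [set: T]) a i.
Proof.
move=> a0 c0; apply/eqP; rewrite eq_le esumZ_le //=.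
have [a00|[j aj]] : (forall j, a j = 0) \/ exists j, 0 < a j.
  have [h|/existsNP[j h]] := pselect (forall j, a j = 0); [by left|right].
  by exists j; rewrite lt_def a0 andbT; apply/eqP.
  by rewrite !esum1 ?mule0 // => i _; rewrite a00 ?mule0.
have ca0 i : 0 <= c * a i by rewrite mule_ge0.
case: c c0 ca0 => [c| |//] c0 ca0; last first.
  have := esum_ge1 j ca0; rewrite {1}(gt0_mulye aj); exact: le_trans (leey _).
have [->|c1] := eqVneq c 0%R; first by rewrite mul0e esum_ge0 // => i _; rewrite mul0e.
have c2 : (0 < c)%R by rewrite lt_def c1.
have := @esumZ_le (fun i => c%:E * a i) (c^-1)%:E ca0.
rewrite lee_fin invr_ge0 (ltW c2) => /(_ isT).
rewrite (@eq_esum _ _ _ _ a); last by move=> i _; rewrite muleA -EFinM mulVf // mul1e.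
by move=> /(@lee_wpmul2l _ c%:E c0); rewrite muleA -EFinM mulfV // mul1e.
Qed.

End Esum.

Section L2.
Context {R : realType}.
Local Open Scope ereal_scope.

Definition sqsum (I : choiceType) (psi : I -> R[i]) : \bar R :=
  \esum_(i in [set: I]) (rnorm (psi i : R[i]^o) ^+ 2)%:E.

Lemma l2normE (I : choiceType) (psi : I -> R[i]) : l2norm psi = sqrte (sqsum psi).
Proof. by []. Qed.

Lemma sqsum_ge0 (I : choiceType) (psi : I -> R[i]) : 0 <= sqsum psi.
Proof. by apply: esum_ge0 => i _; rewrite lee_fin sqr_ge0. Qed.

Lemma l2norm_le (I : choiceType) (psi : I -> R[i]) (c : R) : (0 <= c)%R ->
  (l2norm psi <= c%:E) = (sqsum psi <= (c ^+ 2)%:E).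
Proof.
move=> c0; rewrite l2normE -[RHS]lee_sqrt ?lee_fin ?sqr_ge0 //.
by congr (_ <= _); rewrite /= sqrtr_sqr ger0_norm.
Qed.

Lemma opnorm_le (I : choiceType) (T : (I -> R[i]) -> I -> R[i]) (c : R) : (0 <= c)%R ->
  (forall psi, sqsum psi <= 1 -> sqsum (T psi) <= (c ^+ 2)%:E) -> opnorm T <= c%:E.
Proof.
move=> c0 h; apply: ge_ereal_sup => _ [psi /= + <-].
rewrite (l2norm_le _ (@ler01 R)) expr1n => /h.
by rewrite l2norm_le.
Qed.

Lemma sqsum_opnorm (I : choiceType) (T : (I -> R[i]) -> I -> R[i]) (c : R) psi :
  (0 <= c)%R -> opnorm T <= c%:E -> sqsum psi <= 1 -> sqsum (T psi) <= (c ^+ 2)%:E.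
Proof.
move=> c0 Tc p1; rewrite -l2norm_le //; apply: le_trans Tc.
apply: ereal_sup_ubound; exists psi => //=.
by rewrite (l2norm_le _ (@ler01 R)) expr1n.
Qed.

Lemma sqsumZ (I : choiceType) (c : R[i]) (psi : I -> R[i]) :
  sqsum (fun i => c * psi i)%R = (rnorm (c : R[i]^o) ^+ 2)%:E * sqsum psi.
Proof.
rewrite -esumZ ?lee_fin ?sqr_ge0 //; last by move=> i; rewrite lee_fin sqr_ge0.
by apply: eq_esum => i _; rewrite rnormM exprMn EFinM.
Qed.

Lemma sqsum_opnorm_homogeneous (I : choiceType) (T : (I -> R[i]) -> I -> R[i]) (c : R) psi :
  (0 <= c)%R -> (forall (z : R[i]) phi, T (fun i => z * phi i)%R = (fun i => z * T phi i)%R) ->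
  opnorm T <= c%:E -> sqsum psi < +oo -> sqsum (T psi) <= (c ^+ 2)%:E * sqsum psi.
Proof.
move=> c0 hT Tc pfin; have := sqsum_ge0 psi.
case E : (sqsum psi) pfin => [t| |//] // _; rewrite lee_fin => t0.
apply/lee_addgt0Pr => e e0; rewrite -EFinM -EFinD.
(* Slightly more than [t], hence positive even for [psi = 0], so that dividing by its root puts
   [psi] in the unit ball; after multiplication by [c ^+ 2] the excess costs at most [e]. *)
pose r := (t + e / (c ^+ 2 + 1))%R.
have c1 : (0 < c ^+ 2 + 1)%R by rewrite ltr_wpDl // sqr_ge0.
have r0 : (0 < r)%R by rewrite ltr_wpDl // divr_gt0.
pose z : R[i] := ((Num.sqrt r)^-1)%:C.
have nz : (rnorm (z : R[i]^o) ^+ 2 = r^-1)%R.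
  by rewrite rnorm_real ger0_norm ?invr_ge0 ?sqrtr_ge0 // exprVn sqr_sqrtr // ltW.
have p1 : sqsum (fun i => z * psi i)%R <= 1.
  rewrite sqsumZ nz E -EFinM lee_fin mulrC ler_pdivrMr // mul1r lerDl.
  by rewrite divr_ge0 // ltW.
have := sqsum_opnorm c0 Tc p1; rewrite hT sqsumZ nz.
rewrite muleC -lee_pdivlMr ?invr_gt0 // invrK -EFinM => /le_trans -> //.
rewrite lee_fin /r mulrDr lerD2l mulrCA ler_piMr ?(ltW e0) //.
by rewrite ler_pdivrMr // mul1r lerDl.
Qed.

End L2.

Section RegularRepresentations.
Context {R : realType} {G : groupType}.
Local Open Scope ereal_scope.

Lemma opnorm_ge0 (I : choiceType) (T : (I -> R[i]) -> I -> R[i]) : 0 <= opnorm T.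
Proof.
apply: le_trans (sqrte_ge0 (sqsum (T (fun=> 0%R)))) _.
apply: ereal_sup_ubound; exists (fun=> 0%R) => //=.
rewrite (l2norm_le _ (@ler01 R)) expr1n /sqsum esum1 ?lee_fin //.
by move=> i _; rewrite rnorm0 expr0n.
Qed.

Lemma group_regularZ (s : seq G) (c : G -> R[i]) (z : R[i]) phi :
  group_regular s c (fun i => z * phi i)%R = (fun i => z * group_regular s c phi i)%R.
Proof.
apply/funext => h; rewrite /group_regular mulr_sumr.
by apply: eq_bigr => g _; rewrite mulrCA.
Qed.

(* At a fixed point [x0] the fibre of the crossed regular representation over
   [x0] is the group regular representation. *)
Lemma opnorm_group_le_crossed (X : choiceType) (act : G -> X -> X) (x0 : X)
    (s : seq G) (f : G -> X -> R[i]) : (forall g, act g x0 = x0) ->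
  opnorm (group_regular s (fun g => f g x0)) <= opnorm (crossed_regular act s f).
Proof.
move=> fix0; have := opnorm_ge0 (crossed_regular act s f).
case E : (opnorm (crossed_regular act s f)) => [c| |//]; last by rewrite !leey.
rewrite lee_fin => c0; apply: opnorm_le => // psi p1.
pose lift (phi : G -> R[i]) (p : G * X) : R[i] := if p.2 == x0 then phi p.1 else 0%R.
have sqlift phi : sqsum (lift phi) = sqsum phi.
  have inj : set_inj [set: G] (fun g => (g, x0)) by move=> g h _ _ [].
  rewrite /sqsum (@eq_esum _ _ _ (fun g => (rnorm (phi g : R[i]^o) ^+ 2)%:E)
    (fun g => (rnorm (lift phi (g, x0) : R[i]^o) ^+ 2)%:E)); last first.
    by move=> g _; rewrite /lift /= eqxx.
  rewrite -(@esum_image R G _ _ _ (fun p => (rnorm (lift phi p : R[i]^o) ^+ 2)%:E) inj).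
  rewrite [RHS]esum_mkcond; apply: eq_esum => -[g x] _; case: ifPn => //.
  rewrite notin_setE /lift /=; case: eqVneq => [->|_]; first by case; exists g.
  by rewrite rnorm0 expr0n.
have <- : sqsum (crossed_regular act s f (lift psi)) =
    sqsum (group_regular s (fun g => f g x0) psi).
  rewrite -sqlift; congr sqsum; apply/funext => -[h x].
  rewrite /crossed_regular /group_regular /lift /=; case: eqVneq => [->|_].
    by apply: eq_bigr => g _; rewrite fix0.
  by rewrite big1 // => g _; rewrite mulr0.
by apply: (sqsum_opnorm c0 _ _); rewrite ?E ?sqlift.
Qed.

(** With constant coefficients the crossed regular representation is a direct sum, over the points
    of [X], of copies of the regular representation of [G]. *)
Lemma opnorm_crossed_le_group (X : choiceType) (act : G -> X -> X)
    (s : seq G) (c : G -> R[i]) :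
  opnorm (crossed_regular act s (fun g _ => c g)) <= opnorm (group_regular s c).
Proof.
have := opnorm_ge0 (group_regular s c).
case E : (opnorm (group_regular s c)) => [k| |//]; last by rewrite !leey.
rewrite lee_fin => k0; apply: opnorm_le => // psi p1.
have swap (phi : G * X -> R[i]) : sqsum phi = \esum_(x in [set: X]) sqsum (fun h : G => phi (h, x)).
  rewrite /sqsum (esum_esum (I := [set: X]) (J := fun=> [set: G])
    (a := fun x h => (rnorm (phi (h, x) : R[i]^o) ^+ 2)%:E)); last first.
    by move=> x h _ _; rewrite lee_fin sqr_ge0.
  apply: (@reindex_esum _ _ _ _ _ (fun p : X * G => (p.2, p.1)) 
    (fun p => (rnorm (phi p : R[i]^o) ^+ 2)%:E)); split => //.
  - by move=> [x h] [y g] _ _ /= [-> ->].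
  - by move=> [h x] _; exists (x, h).
rewrite swap in p1; rewrite swap.
apply: (@le_trans _ _ (\esum_(x in [set: X]) ((k ^+ 2)%:E * sqsum (fun h : G => psi (h, x))))).
  apply: le_esum => x _; apply: (@sqsum_opnorm_homogeneous _ _ (group_regular s c)) => //.
  - exact: group_regularZ.
  - by rewrite E.
  - apply: le_lt_trans (ltry 1); apply: le_trans p1.
    by apply: (esum_ge1 x) => y; exact: sqsum_ge0.
rewrite esumZ ?lee_fin ?sqr_ge0 //; last by move=> x; exact: sqsum_ge0.
by rewrite -[leRHS]mule1 lee_wpmul2l // lee_fin sqr_ge0.
Qed.

Lemma opnorm_crossed_function_le (X : choiceType) (act : G -> X -> X)
    (f : X -> R[i]) (c : R) : (0 <= c)%R -> (forall x, rnorm (f x : R[i]^o) <= c)%R ->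
  opnorm (crossed_regular act [:: 1%g] (fun=> f)) <= c%:E.
Proof.
move=> c0 fc; apply: opnorm_le => // psi p1.
apply: (@le_trans _ _ ((c ^+ 2)%:E * sqsum psi)); last first.
  by rewrite -[leRHS]mule1 lee_wpmul2l // lee_fin sqr_ge0.
rewrite -esumZ ?lee_fin ?sqr_ge0 //; last by move=> p; rewrite lee_fin sqr_ge0.
apply: le_esum => -[h x] _; rewrite /crossed_regular big_seq1 /= invg1 mul1g.
rewrite rnormM -EFinM lee_fin exprMn ler_wpM2r ?sqr_ge0 //.
by rewrite ler_pXn2r ?nnegrE ?rnorm_ge0.
Qed.

End RegularRepresentations.

(** * Green function and Martin kernel *)

Section EsumMore.
Context {R : realType}.
Local Open Scope ereal_scope.

Lemma exchange_esum (T1 T2 : choiceType) (a : T1 -> T2 -> \bar R) :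
  (forall i j, 0 <= a i j) ->
  \esum_(i in [set: T1]) \esum_(j in [set: T2]) a i j =
  \esum_(j in [set: T2]) \esum_(i in [set: T1]) a i j.
Proof.
move=> a0; rewrite (esum_esum (J := fun=> [set: T2])) //.
rewrite (esum_esum (J := fun=> [set: T1]) (a := fun j i => a i j)) //.
apply: (@reindex_esum _ _ _ _ _ (fun p : T2 * T1 => (p.2, p.1)) (fun p => a p.1 p.2)).
split=> //; first by move=> [x h] [y g] _ _ /= [-> ->].
by move=> [h x] _; exists (x, h).
Qed.

Lemma esum_supp1 (T : choiceType) (a : T -> \bar R) (i : T) : 0 <= a i ->
  (forall j, j != i -> a j = 0) -> \esum_(j in [set: T]) a j = a i.
Proof.
move=> a0 ai; rewrite -[RHS](esum_set1 a0) [RHS]esum_mkcond.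
apply: eq_esum => j _; case: ifPn => //; rewrite notin_setE /= => /eqP.
exact: ai.
Qed.

Lemma esum_seq (T : choiceType) (a : T -> \bar R) (l : seq T) : uniq l ->
  (forall i, 0 <= a i) -> \esum_(i in [set` l]) a i = \sum_(i <- l) a i.
Proof. by move=> ul a0; rewrite fsbig_seq // esum_fset //; exact: finite_seq. Qed.

Lemma sum_seq_le_esum (T : choiceType) (a : T -> \bar R) (l : seq T) : uniq l ->
  (forall i, 0 <= a i) -> \sum_(i <- l) a i <= \esum_(i in [set: T]) a i.
Proof.
move=> ul a0; rewrite -esum_seq // esum_mkcond; apply: le_esum => i _.
by case: ifP.
Qed.

(** The bound is stated for every larger list so that lists controlling different series can be
    merged. *)
Lemma esum_tail (T : choiceType) (a : T -> \bar R) (e : R) : (forall i, 0 <= a i) ->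
  \esum_(i in [set: T]) a i < +oo -> (0 < e)%R ->
  exists2 l : seq T, uniq l & forall l' : seq T, {subset l <= l'} ->
    \esum_(i in ~` [set` l']) a i <= e%:E.
Proof.
move=> a0 fin e0.
have fin' : \esum_(i in [set: T]) a i \is a fin_num.
  by rewrite ge0_fin_numE // esum_ge0.
have [_ [F [/finite_seqP[l ->] _] <-] hF] := ub_ereal_sup_adherent e0 fin'.
exists (undup l); first exact: undup_uniq.
move=> l' sub; have tot : \esum_(i in [set: T]) a i =
    \esum_(i in [set` l']) a i + \esum_(i in ~` [set` l']) a i.
  by rewrite (esumID [set` l']) ?setTI // => i _; exact: a0.
have hl : \sum_(i \in [set` l]) a i <= \esum_(i in [set` l']) a i.
  apply: esum_ge; exists [set` l] => //; split; first exact: finite_seq.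
  by move=> i li; apply: sub; rewrite mem_undup.
move: fin' hF; rewrite -/(esum _ _) => fin' hF.
have hF' : \esum_(i in [set: T]) a i < \esum_(i in [set` l']) a i + e%:E.
  by rewrite -lteBlDr //; exact: lt_le_trans hF hl.
have finl : \esum_(i in [set` l']) a i \is a fin_num.
  rewrite ge0_fin_numE ?esum_ge0 //; apply: le_lt_trans fin; rewrite tot leeDl //.
  exact: esum_ge0.
by move: hF'; rewrite tot lteD2lE // => /ltW.
Qed.

End EsumMore.

Section Walk.
Context {R : realType} {G : groupType} (mu : G -> R).
Hypothesis mu0 : forall g, (0 <= mu g)%R.
Local Open Scope ereal_scope.

Lemma walk_power_ge0 n x y : 0 <= walk_power mu n x y.
Proof.
elim: n x y => [|n IH] x y /=; first by rewrite lee_fin ler0n.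
by apply: esum_ge0 => z _; rewrite mule_ge0 ?lee_fin.
Qed.

Let wp0 := walk_power_ge0.

Lemma walk_power_translate n g x y :
  walk_power mu n (g * x)%g (g * y)%g = walk_power mu n x y.
Proof.
elim: n x y => [|n IH] x y /=; first by rewrite (inj_eq (mulgI g)).
rewrite (@reindex_esum _ _ _ [set: G] _ (fun z => g * z)%g); last first.
  split=> //; first by move=> z w _ _ /mulgI.
  by move=> z _; exists (g^-1 * z)%g => //; rewrite mulVKg.
by apply: eq_esum => z _; rewrite IH invgM -mulgA mulKg.
Qed.

(** [walk_power] splits off the last step; harmonicity in the first variable of the Green function
    needs the first step. *)
Lemma walk_powerSl n x y : walk_power mu n.+1 x y =
  \esum_(z in [set: G]) ((mu (x^-1 * z)%g)%:E * walk_power mu n z y).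
Proof.
elim: n x y => [|n IH] x y.
  rewrite /= (@esum_supp1 _ _ _ x) ?eqxx ?mul1e ?lee_fin //; last first.
    by move=> z /negPf; rewrite eq_sym => ->; rewrite mul0e.
  rewrite (@esum_supp1 _ _ _ y) ?eqxx ?mule1 ?lee_fin // => z /negPf ->.
  by rewrite mule0.
rewrite -[LHS]/(\esum_(z in [set: G])
  (walk_power mu n.+1 x z * (mu (z^-1 * y)%g)%:E)).
transitivity (\esum_(z in [set: G]) \esum_(w in [set: G])
    ((mu (x^-1 * w)%g)%:E * walk_power mu n w z * (mu (z^-1 * y)%g)%:E)).
  apply: eq_esum => z _; rewrite IH muleC -esumZ ?lee_fin //.
    by apply: eq_esum => w _; rewrite muleC.
  by move=> w; rewrite mule_ge0 ?lee_fin.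
rewrite exchange_esum; last by move=> *; rewrite !mule_ge0 ?lee_fin.
apply: eq_esum => w _; rewrite [walk_power _ _.+1 _ _]/= -esumZ ?lee_fin //.
  by apply: eq_esum => z _; rewrite muleA.
by move=> z; rewrite mule_ge0 ?lee_fin.
Qed.

Lemma greenE_ge0 x y : 0 <= greenE mu x y.
Proof. by apply: nneseries_ge0 => n _ _; exact: wp0. Qed.

Lemma greenE_esum x y : greenE mu x y = \esum_(n in [set: nat]) walk_power mu n x y.
Proof. by rewrite -nneseries_esumT. Qed.

Lemma greenE_translate g x y : greenE mu (g * x)%g (g * y)%g = greenE mu x y.
Proof.
by rewrite !greenE_esum; apply: eq_esum => n _; rewrite walk_power_translate.
Qed.

Lemma greenE_rec x y : greenE mu x y =
  ((x == y)%:R)%:E + \esum_(z in [set: G]) ((mu (x^-1 * z)%g)%:E * greenE mu z y).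
Proof.
rewrite {1}/greenE nneseries_recl //; congr (_ + _).
rewrite -(@nneseries_addn _ _ 1) // nneseries_esumT //.
under eq_esum do rewrite addn1.
under eq_esum do rewrite walk_powerSl.
rewrite exchange_esum; last by move=> *; rewrite mule_ge0 ?lee_fin.
by apply: eq_esum => z _; rewrite esumZ ?lee_fin // greenE_esum.
Qed.

(** The path that spells the word has positive weight and bounds the matrix entry from below. *)
Lemma walk_power_word (l : seq G) x : (forall g, g \in l -> (0 < mu g)%R) ->
  0 < walk_power mu (size l) x (x * \prod_(g <- l) g)%g.
Proof.
elim: l x => [|g l IH] x hl; first by rewrite big_nil mulg1 /= eqxx lte_fin.
rewrite big_cons walk_powerSl mulgA.
have gl : (0 < mu g)%R by apply: hl; rewrite inE eqxx.
apply: (@lt_le_trans _ _ ((mu (x^-1 * (x * g))%g)%:E *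
    walk_power mu (size l) (x * g)%g (x * g * \prod_(h <- l) h)%g)).
  rewrite mulKg mule_gt0 ?lte_fin // IH // => h hh; apply: hl.
  by rewrite inE hh orbT.
apply: (esum_ge1 (a := fun z => (mu (x^-1 * z)%g)%:E *
  walk_power mu (size l) z (x * g * \prod_(h <- l) h)%g)).
by move=> z; rewrite mule_ge0 ?lee_fin.
Qed.

Lemma greenE_gt0 x y : semigroup_generates [set g | (0 < mu g)%R] ->
  0 < greenE mu x y.
Proof.
move=> /(_ (x^-1 * y)%g)[n _ [l [_ hl prodl]]].
rewrite greenE_esum.
apply: lt_le_trans (esum_ge1 (size l) (fun n => wp0 n x y)).
by have := walk_power_word x hl; rewrite prodl mulVKg.
Qed.

End Walk.

Section MartinKernel.
Context {R : realType} {G : groupType} (mu : G -> R).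
Hypothesis rw : is_random_walk mu.
Hypothesis tr : transient mu.
Local Notation K := (martin_kernel mu).

Let mu0 g : 0 <= mu g. Proof. by case: rw => _ /(_ g)/andP[]. Qed.

Lemma greenEE x y : greenE mu x y = (green mu x y)%:E.
Proof. by rewrite fineK // ge0_fin_numE ?greenE_ge0 // tr. Qed.

Lemma green_gt0 x y : 0 < green mu x y.
Proof. by rewrite -lte_fin -greenEE greenE_gt0 //; case: rw. Qed.

Lemma green_translate g x y : green mu (g * x)%g (g * y)%g = green mu x y.
Proof. by rewrite /green greenE_translate. Qed.

Lemma martin_kernel_gt0 g h : 0 < K g h.
Proof. by rewrite divr_gt0 ?green_gt0. Qed.

Lemma martin_kernel1 h : K 1%g h = 1.
Proof. by rewrite /martin_kernel divff // gt_eqF ?green_gt0. Qed.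

Lemma martin_kernel_cocycle x g h : K x (g * h)%g * K g^-1%g h = K (g^-1 * x)%g h.
Proof.
rewrite /martin_kernel -(green_translate g^-1%g x) -(green_translate g^-1%g 1%g).
by rewrite mulKg mulg1 mulrA divfK // gt_eqF // green_gt0.
Qed.

(** At [h = 1] the diagonal term of [greenE_rec] would remain. This exception is one isolated point
    of the compactification and disappears on the boundary. *)
Lemma martin_kernel_harmonic h : h != 1%g ->
  (\esum_(g in [set: G]) (mu g * K g h)%:E = 1)%E.
Proof.
move=> h1; have := greenE_rec mu0 1%g h.
rewrite eq_sym (negPf h1) add0e greenEE => E.
have g0 := green_gt0 1%g h.
have -> : (\esum_(g in [set: G]) (mu g * K g h)%:E =
   ((green mu 1%g h)^-1)%:E * \esum_(g in [set: G]) ((mu (1^-1 * g)%g)%:E * greenE mu g h))%E.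
  rewrite -esumZ ?lee_fin ?invr_ge0 ?(ltW g0) //; last first.
    by move=> g; rewrite mule_ge0 ?lee_fin ?greenE_ge0.
  apply: eq_esum => g _; rewrite greenEE invg1 mul1g -!EFinM; congr _%:E.
  by rewrite /martin_kernel; ring.
by rewrite -E -EFinM mulVf // gt_eqF.
Qed.

Section Harnack.
Context (d : G -> G -> nat) (C : R).
Hypothesis C0 : 0 < C.
Hypothesis har : harnack mu d C.
Hypothesis moment : moment_condition mu d C.

Lemma martin_kernel_le g h : K g h <= C ^+ d g 1%g.
Proof. exact: har. Qed.

(** A positive lower bound uniform in [h] survives the passage to the boundary, where it gives
    strict positivity of the kernel. *)
Lemma martin_kernel_ge g h : (C ^+ d 1%g g)^-1 <= K g h.
Proof.
have := har 1%g g h.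
rewrite -[leLHS]invf_div -/(K g h) => H.
by rewrite -[leRHS]invrK lef_pV2 ?posrE ?invr_gt0 ?martin_kernel_gt0 ?exprn_gt0 //.
Qed.

(* The moment condition makes the tail of [sum_g mu g * K g h] small
   uniformly in [h]. *)
Lemma martin_kernel_sum_near1 (e : R) (s : G) : 0 < e -> exists l : seq G,
  [/\ uniq l, s \in l, 1 - e <= \sum_(g <- l) mu g <= 1 &
    forall h, h != 1%g -> 1 - e <= \sum_(g <- l) mu g * K g h <= 1].
Proof.
move=> e0; case: rw => _ mu01 mu1 _.
have bound (a : G -> R) (l : seq G) : uniq l -> (forall g, 0 <= a g) ->
    (\esum_(g in [set: G]) (a g)%:E = 1)%E ->
    (\esum_(g in ~` [set` l]) (a g)%:E <= e%:E)%E -> 1 - e <= \sum_(g <- l) a g <= 1.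
  move=> ul a0 a1 ae; have a0' g : (0 <= (a g)%:E)%E by rewrite lee_fin.
  have := sum_seq_le_esum ul a0'; rewrite a1 sumEFin lee_fin => ->; rewrite andbT.
  have := a1; rewrite (esumID [set` l]) ?setTI // => /esym E.
  move: E; rewrite esum_seq // sumEFin.
  move: ae; have := esum_ge0 (fun g (_ : (~` [set` l]) g) => a0' g).
  case: (\esum_(g in _) _)%E => [t| |] //; rewrite !lee_fin => t0 te.
  by move=> -[E]; lra.
have mc0 g : (0 <= (mu g * C ^+ d g 1%g)%:E)%E.
  by rewrite lee_fin mulr_ge0 // exprn_ge0 // ltW.
have [l1 ul1 hl1] := esum_tail mc0 moment e0.
have [] := @esum_tail _ _ (fun g => (mu g)%:E) e _ _ e0.
- by move=> g; rewrite lee_fin.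
- by rewrite mu1 ltry.
(* One list serves both series, that of [mu] and the dominating moment series. It contains [s] so
   that later the term at [s] is bounded by the sum over the list. *)
move=> l2 ul2 hl2; exists (undup (s :: l1 ++ l2)); set l := undup _.
have sub1 : {subset l1 <= l} by move=> g gl; rewrite mem_undup inE mem_cat gl orbT.
have sub2 : {subset l2 <= l} by move=> g gl; rewrite mem_undup inE mem_cat gl !orbT.
have ul : uniq l by exact: undup_uniq.
split=> //; first by rewrite mem_undup inE eqxx.
  by apply: bound => //; exact: hl2.
move=> h h1; apply: bound => //.
- by move=> g; rewrite mulr_ge0 // ltW // martin_kernel_gt0.
- exact: martin_kernel_harmonic.
- apply: le_trans (hl1 _ sub1); apply: le_esum => g _.
  by rewrite lee_fin ler_wpM2l // martin_kernel_le.
Qed.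

End Harnack.
End MartinKernel.

(** * Extension of the kernel identities to the Martin boundary *)

Section Boundary.
Context {R : realType} {G : groupType} {mu : G -> R}.
Context {M : martin_compactification mu}.
Hypothesis rw : is_random_walk mu.
Hypothesis tr : transient mu.
Local Notation X := (boundary M).
Local Notation K := (@boundary_kernel R G mu M).
Local Notation act := (boundary_act M).

Lemma mc_closed_all (P : set M) : closed P -> (forall h, P (mc_emb M h)) -> forall x, P x.
Proof.
move=> cP hP x; apply: contrapT => nPx.
have oP : open (~` P) by rewrite openC.
have [y [nP [h _ hE]]] := mc_dense (ex_intro _ x nPx) oP.
by apply: nP; rewrite -hE.
Qed.

Lemma closed_eq_continuous (T : topologicalType) (f g : T -> R) :
  continuous f -> continuous g -> closed [set x | f x = g x].
Proof.
move=> cf cg.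
have -> : [set x | f x = g x] = (f \- g) @^-1` [set 0].
  by apply/seteqP; split=> x /=; [move=> ->; rewrite subrr|move/eqP; rewrite subr_eq0 => /eqP].
apply: closed_comp; last exact: closed_eq.
by move=> x _; apply: continuousB; [exact: cf|exact: cg].
Qed.

Lemma closed_le_continuous (T : topologicalType) (f : T -> R) (c : R) :
  continuous f -> closed [set x | f x <= c].
Proof.
by move=> cf; apply: (@closed_comp _ _ f [set y | y <= c]) => //; exact: closed_le.
Qed.

Lemma closed_ge_continuous (T : topologicalType) (f : T -> R) (c : R) :
  continuous f -> closed [set x | c <= f x].
Proof.
by move=> cf; apply: (@closed_comp _ _ f [set y | c <= y]) => //; exact: closed_ge.
Qed.

Lemma boundary_val_continuous : continuous (\val : X -> M).
Proof. exact: initial_continuous. Qed.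

Lemma boundary_kernel_continuous g : continuous (K g).
Proof.
move=> x; apply: (@continuous_comp X M R \val (mc_kernel g)).
  exact: boundary_val_continuous.
exact: mc_kernel_continuous.
Qed.

Lemma boundary_act_continuous g : continuous (act g).
Proof.
apply: continuous_comp_initial => x.
apply: (@continuous_comp X M M \val (mc_act g)).
  exact: boundary_val_continuous.
exact: mc_act_continuous.
Qed.

Lemma boundary_not_emb (x : X) h : \val x <> mc_emb M h.
Proof. by move=> E; have /set_mem := valP x; apply; exists h. Qed.

Lemma boundary_compact : compact [set: X].
Proof.
have cl : closed (boundary_set M).
  rewrite /boundary_set -openC setCK.
  have -> : range (mc_emb M) = \bigcup_(h in [set: G]) [set mc_emb M h].
    by apply/seteqP; split=> [_ [h _ <-]|_ [h _ ->]]; exists h.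
  by apply: bigcup_open => h _; exact: mc_open.
have cpt : compact (boundary_set M).
  by apply: subclosed_compact (@mc_compact _ _ _ M) _.
move=> F PF _.
have FB : F (\val @^-1` boundary_set M).
  by apply: filterS filterT => x _; have /set_mem := valP (x : X).
have [p [Bp clp]] := cpt (\val @ F) _ FB.
have Bp' := mem_set Bp; exists (exist _ p Bp'); split=> // U V FU.
rewrite nbhsE => -[W [[W0 oW0 <-] /= Wp] WV].
have FU' : F (\val @^-1` (\val @` U)) by apply: filterS FU => x Ux; exists x.
have [_ [[x Ux <-] W0x]] := clp (\val @` U) W0 FU' (open_nbhs_nbhs (conj oW0 Wp)).
by exists x; split => //; apply: WV.
Qed.

Lemma boundary_kernel1 x : K 1%g x = 1.
Proof.
apply: (@mc_closed_all [set x | mc_kernel 1%g x = 1]).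
  apply: (@closed_eq_continuous _ (mc_kernel 1%g) (cst 1)) => //.
    exact: mc_kernel_continuous.
  by move=> y; exact: cvg_cst.
by move=> h /=; rewrite mc_kernelE martin_kernel1.
Qed.

Lemma boundary_kernel_cocycle y g x : K y (act g x) * K g^-1%g x = K (g^-1 * y)%g x.
Proof.
apply: (@mc_closed_all [set x | mc_kernel y (mc_act g x) * mc_kernel g^-1%g x =
   mc_kernel (g^-1 * y)%g x]).
  apply: closed_eq_continuous; last exact: mc_kernel_continuous.
  move=> z; apply: cvgM; last exact: mc_kernel_continuous.
  by apply: continuous_comp; [exact: mc_act_continuous|exact: mc_kernel_continuous].
by move=> h /=; rewrite mc_actE !mc_kernelE martin_kernel_cocycle.
Qed.

Lemma boundary_separates (x y : X) : (forall g, K g x = K g y) -> x = y.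
Proof.
move=> h; apply/val_inj/mc_separates => //.
  by have /set_mem := valP x.
by have /set_mem := valP y.
Qed.

(** The cocycle identity gives [K(h, g x0) = 1 = K(h, x0)] for all [h], and the kernels separate
    boundary points. *)
Lemma spine_fixed (x0 : X) g : is_spine x0 -> act g x0 = x0.
Proof.
move=> sp; apply: boundary_separates => h.
by have := boundary_kernel_cocycle h g x0; rewrite !sp mulr1.
Qed.

Section Harnack.
Context (d : G -> G -> nat) (C : R).
Hypothesis C0 : 0 < C.
Hypothesis har : harnack mu d C.
Hypothesis moment : moment_condition mu d C.

Lemma boundary_kernel_gt0 g x : 0 < K g x.
Proof.
apply: (@lt_le_trans _ _ (C ^+ d 1%g g)^-1); first by rewrite invr_gt0 exprn_gt0.
apply: (@mc_closed_all [set x | (C ^+ d 1%g g)^-1 <= mc_kernel g x]).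
  exact/closed_ge_continuous/mc_kernel_continuous.
by move=> h /=; rewrite mc_kernelE martin_kernel_ge.
Qed.

Lemma boundary_kernel_sum_near1 (e : R) (s : G) : 0 < e -> exists l : seq G,
  [/\ s \in l, 1 - e <= \sum_(g <- l) mu g <= 1 &
    forall x : X, 1 - e <= \sum_(g <- l) mu g * K g x <= 1].
Proof.
move=> e0; have [l [_ sl ml hl]] := martin_kernel_sum_near1 rw tr C0 har moment s e0.
exists l; split=> // x.
pose S (y : M) := \sum_(g <- l) mu g * mc_kernel g y.
have cS : continuous S.
  rewrite /S => y; apply: cvg_big => [|g _]; first exact: add_continuous.
  by apply: cvgM; [exact: cvg_cst|exact: mc_kernel_continuous].
(* The estimate may fail at the image of [1]. Adding this point yields a closed set containing the
   image of [G], hence everything, and a boundary point is different from the added one. *)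
have : ([set y | 1 - e <= S y <= 1] `|` [set mc_emb M 1%g]) (\val x).
  apply: mc_closed_all => [|h].
    apply: closedU; last first.
      exact/accessible_closed_set1/hausdorff_accessible/metric_hausdorff.
    have -> : [set y | 1 - e <= S y <= 1] = [set y | 1 - e <= S y] `&` [set y | S y <= 1].
      by apply/seteqP; split=> y /=; [move=> /andP[]|move=> [-> ->]].
    by apply: closedI; [exact: closed_ge_continuous|exact: closed_le_continuous].
  have [->|h1] := eqVneq h 1%g; [by right|left].
  by rewrite /S /=; under eq_bigr do rewrite mc_kernelE; exact: hl.
by case=> // /boundary_not_emb.
Qed.

End Harnack.
End Boundary.

(** * Bernoulli's inequality and positive functionals *)

Section ConvexityOfExp.
Context {R : realType}.
Implicit Types (x y s k beta : R).

(** The graph lies strictly above its tangent at the intermediate point [m]: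
    [expR (x - m) > 1 + (x - m)], and likewise for [y]. *)
Lemma expR_strict_convex x y s : x != y -> 0 < s < 1 ->
  expR (s * x + (1 - s) * y) < s * expR x + (1 - s) * expR y.
Proof.
move=> xy /andP[s0 s1]; set m := s * x + (1 - s) * y.
have E z : expR z = expR m * expR (z - m) by rewrite -expRD addrC subrK.
have xm : x - m != 0.
  have -> : x - m = (1 - s) * (x - y) by rewrite /m; ring.
  by apply: mulf_neq0; rewrite subr_eq0 // gt_eqF.
have ym : y - m != 0.
  have -> : y - m = s * (y - x) by rewrite /m; ring.
  by apply: mulf_neq0; rewrite ?subr_eq0 1?eq_sym // lt_eqF.
have h1 := expR_gt1Dx xm; have h2 := expR_gt1Dx ym; have m0 := expR_gt0 m.
rewrite (E x) (E y); set u := expR (x - m) in h1 *; set v := expR (y - m) in h2 *.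
have -> : s * (expR m * u) + (1 - s) * (expR m * v) = expR m * (s * u + (1 - s) * v).
  by ring.
rewrite -{1}[expR m]mulr1 ltr_pM2l //.
have h3 : s * (1 + (x - m)) < s * u by rewrite ltr_pM2l.
have h4 : (1 - s) * (1 + (y - m)) < (1 - s) * v by rewrite ltr_pM2l // subr_gt0.
have : s * (1 + (x - m)) + (1 - s) * (1 + (y - m)) = 1 by rewrite /m; ring.
lra.
Qed.

(** Bernoulli's inequality is reversed for exponents between 0 and 1; the sign makes the gap
    nonnegative in all cases. *)
Definition bernoulli_sign beta : R := if (0 < beta) && (beta < 1) then -1 else 1.

Definition bernoulli_gap beta k : R :=
  bernoulli_sign beta * (expR (beta * ln k) - 1 - beta * (k - 1)).

(** Strict convexity of [expR] at the points [0], [L] and [beta * L] with [L = ln k]: the middle one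
    is [beta * L] for [0 < beta < 1], [0] for [beta < 0], and [L] for [beta > 1]. *)
Lemma bernoulli_gap_gt0 beta k : beta != 0 -> beta != 1 -> 0 < k -> k != 1 ->
  0 < bernoulli_gap beta k.
Proof.
move=> b0 b1 k0 k1; set L := ln k; have kE : k = expR L by rewrite /L lnK.
have L0 : L != 0 by rewrite /L ln_eq0.
rewrite /bernoulli_gap /bernoulli_sign -/L kE.
have bL : beta * L != 0 by rewrite mulf_neq0.
case: ifPn => [b01|].
  have := expR_strict_convex L0 b01; rewrite mulr0 addr0 expR0; lra.
rewrite negb_and -!leNgt => /orP[bn|bg].
  have bn' : beta < 0 by rewrite lt_def eq_sym b0.
  have b10 : 0 < 1 - beta by lra.
  have s01 : 0 < - beta / (1 - beta) < 1.
    rewrite divr_gt0 ?oppr_gt0 //= ltr_pdivrMr //; lra.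
  have LbL : L != beta * L.
    by rewrite -subr_eq0 -{1}[L]mul1r -mulrBl mulf_neq0 // gt_eqF.
  have := expR_strict_convex LbL s01.
  have -> : - beta / (1 - beta) * L + (1 - - beta / (1 - beta)) * (beta * L) = 0.
    by field; rewrite gt_eqF.
  have -> : 1 - - beta / (1 - beta) = (1 - beta)^-1 by field; rewrite gt_eqF.
  rewrite expR0 -(ltr_pM2l b10) mulr1 mulrDr !mulrA mulfV ?gt_eqF // mul1r.
  have -> : (1 - beta) * - beta / (1 - beta) = - beta by field; rewrite gt_eqF.
  lra.
have bg' : 1 < beta by rewrite lt_def b1.
have beta0 : 0 < beta by lra.
have s01 : 0 < beta^-1 < 1 by rewrite invr_gt0 beta0 invf_lt1.
have := expR_strict_convex bL s01.
rewrite mulr0 addr0 expR0 mulrA mulVf // mul1r -(ltr_pM2l beta0).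
have -> : beta * (beta^-1 * expR (beta * L) + (1 - beta^-1) * 1) =
  expR (beta * L) + beta - 1 by field.
lra.
Qed.

Lemma bernoulli_gap_ge0 beta k : beta != 0 -> beta != 1 -> 0 < k ->
  0 <= bernoulli_gap beta k.
Proof.
move=> b0 b1 k0; have [->|k1] := eqVneq k 1; last exact/ltW/bernoulli_gap_gt0.
by rewrite /bernoulli_gap ln1 mulr0 expR0 !subrr mulr0 subr0 mulr0.
Qed.

Lemma bernoulli_gap_eq0 beta k : beta != 0 -> beta != 1 -> 0 < k ->
  bernoulli_gap beta k = 0 -> k = 1.
Proof.
move=> b0 b1 k0 E; apply/eqP; apply: contrapT => /negP k1.
by have := bernoulli_gap_gt0 b0 b1 k0 k1; rewrite E ltxx.
Qed.

Lemma abs_bernoulli_sign beta : `|bernoulli_sign beta| = 1.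
Proof. by rewrite /bernoulli_sign; case: ifP; rewrite ?normrN normr1. Qed.

End ConvexityOfExp.

Lemma compact_finite_subcover (T : topologicalType) (x0 : T) (A : set T) :
  compact A -> cover_compact A.
Proof.
(* [compact_cover] speaks of pointed spaces; [x0] serves as the base point. *)
pose T' : ptopologicalType := HB.pack (Topological.sort T) (isPointed.Build T x0).
have : compact (A : set T') -> cover_compact (A : set T') by rewrite compact_cover.
by [].
Qed.

(* By compactness a continuous [f >= 0] vanishing at the only common zero of the
   [phi i] is at most [e + sum_k n_k * phi (i_k)]. *)
Lemma positive_functional_null (R : realType) (X : topologicalType) (m : (X -> R) -> R)
    (I : choiceType) (phi : I -> X -> R) (i0 : I) (x0 : X) (f : X -> R) :
  compact [set: X] ->
  (forall f g : X -> R, continuous f -> continuous g -> m (fun x => f x + g x) = m f + m g) ->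
  (forall (c : R) (f : X -> R), continuous f -> m (fun x => c * f x) = c * m f) ->
  (forall f : X -> R, continuous f -> (forall x, 0 <= f x) -> 0 <= m f) ->
  m (fun=> 1) = 1 ->
  (forall i, continuous (phi i)) -> (forall i x, 0 <= phi i x) ->
  (forall i, m (phi i) = 0) -> (forall x, (forall i, phi i x = 0) -> x = x0) ->
  continuous f -> (forall x, 0 <= f x) -> f x0 = 0 -> m f = 0.
Proof.
move=> cX mD mZ m0 m1 cphi phi0 mphi zphi cf f0 fx0.
apply/eqP; rewrite eq_le m0 // andbT; apply/ler_addgt0Pl => e e0; rewrite addr0.
pose U (p : I * nat) := [set x | f x < e + p.2%:R * phi p.1 x].
have cup p : continuous (fun x => e + p.2%:R * phi p.1 x : R).
  move=> x; apply: cvgD; first exact: cvg_cst.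
  by apply: cvgM; [exact: cvg_cst|exact: cphi].
have oU p : setT p -> open (U p).
  move=> _; have -> : U p = (fun x => e + p.2%:R * phi p.1 x - f x) @^-1` [set y | 0 < y].
    by apply/seteqP; split=> x /=; rewrite subr_gt0.
  apply: open_comp; last exact: open_gt.
  by move=> x _; apply: cvgB; [exact: cup|exact: cf].
have cov : [set: X] `<=` cover setT U.
  move=> x _; have [h|/existsNP[i phix]] := pselect (forall i, phi i x = 0).
    by exists (i0, 0%N) => //; rewrite /U /= (zphi x h) fx0 mul0r addr0.
  have p0 : 0 < phi i x by rewrite lt_def phi0 andbT; apply/eqP.
  (* The coefficient exceeds [f x / phi i x]. Where all [phi i] vanish, [f] is 0 and the coefficient
     0 was enough. *)
  exists (i, (Num.truncn (f x / phi i x)).+1) => //; rewrite /U /=.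
  apply: ltr_wpDl; first exact: ltW.
  by rewrite -ltr_pdivrMr // truncnS_gt.
have [D _ covD] := compact_finite_subcover x0 cX oU cov.
pose S (l : seq (I * nat)) x := \sum_(p <- l) p.2%:R * phi p.1 x.
have cS l : continuous (S l).
  move=> x; apply: cvg_big => [|p _]; first exact: add_continuous.
  by apply: cvgM; [exact: cvg_cst|exact: cphi].
have S0 l x : 0 <= S l x by apply: sumr_ge0 => p _; rewrite mulr_ge0.
have mS l : m (S l) = 0.
  elim: l => [|p l IH].
    have -> : S [::] = (fun=> 0 * 1) by apply/funext => x; rewrite /S big_nil mul0r.
    by rewrite mZ ?mul0r // => x; exact: cvg_cst.
  have -> : S (p :: l) = (fun x => p.2%:R * phi p.1 x + S l x).
    by apply/funext => x; rewrite /S big_cons.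
  rewrite mD ?mZ ?mphi ?IH ?mulr0 ?addr0 // => x.
  by apply: cvgM; [exact: cvg_cst|exact: cphi].
pose l := finmap.enum_fset D.
have cst1 : continuous (fun _ : X => 1 : R) by move=> x; exact: cvg_cst.
have ce : continuous (fun x => e * 1 + S l x : R).
  by move=> x; apply: cvgD; [exact: cvg_cst|exact: cS].
have cNf : continuous (fun x => -1 * f x).
  by move=> x; apply: cvgM; [exact: cvg_cst|exact: cf].
have : 0 <= m (fun x => (e * 1 + S l x) + -1 * f x).
  apply: m0 => [|x].
    by move=> x; apply: cvgD; [exact: ce|exact: cNf].
  rewrite mulN1r subr_ge0; have [p Dp /ltW] := covD x Logic.I.
  rewrite mulr1 => /le_trans; apply; rewrite lerD2l /S (big_rem p) //= lerDl.
  by apply: sumr_ge0 => q _; rewrite mulr_ge0.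
rewrite mD // mD // ?mZ // ?m1 ?mS.
  by rewrite mulr1 addr0 mulN1r subr_ge0.
by move=> x; apply: cvgM; [exact: cvg_cst|exact: cst1].
Qed.

(** * Homomorphisms defined on dense sums *)

Section LipschitzMaps.
Context {R : realType}.

(** States, star homomorphisms and multiplications by a fixed element are Lipschitz, and by
    [dense_lipschitz_eq] an identity between such maps can be tested on a dense family, one variable
    at a time. *)
Definition lipschitz_map (V W : normedModType R[i]) (F : V -> W) : Prop :=
  exists k : R, forall u v, rnorm (F u - F v) <= k * rnorm (u - v).

Lemma lipschitz_nonneg (V W : normedModType R[i]) (F : V -> W) : lipschitz_map F ->
  exists2 k : R, 0 <= k & forall u v, rnorm (F u - F v) <= k * rnorm (u - v).
Proof.
move=> [k hk]; exists `|k| => // u v; apply: le_trans (hk u v) _.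
by rewrite ler_wpM2r ?rnorm_ge0 // ler_norm.
Qed.

Lemma lipschitz_comp (U V W : normedModType R[i]) (E : V -> W) (F : U -> V) :
  lipschitz_map E -> lipschitz_map F -> lipschitz_map (fun x => E (F x)).
Proof.
move=> /lipschitz_nonneg[k k0 hk] [k' hk']; exists (k * k') => u v.
by apply: le_trans (hk _ _) _; rewrite -mulrA ler_wpM2l.
Qed.

Lemma lipschitz_id (V : normedModType R[i]) : lipschitz_map (fun x : V => x).
Proof. by exists 1 => u v; rewrite mul1r. Qed.

Lemma lipschitz_cst (V W : normedModType R[i]) (c : W) : lipschitz_map (fun _ : V => c).
Proof. by exists 0 => u v; rewrite subrr rnorm0 mul0r. Qed.

Lemma lipschitz_add (V W : normedModType R[i]) (E F : V -> W) :
  lipschitz_map E -> lipschitz_map F -> lipschitz_map (fun x => E x + F x).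
Proof.
move=> [k hk] [k' hk']; exists (k + k') => u v.
rewrite opprD addrACA mulrDl; apply: le_trans (rnormD _ _) _.
exact: lerD.
Qed.

Lemma lipschitz_scale (V W : normedModType R[i]) (c : R[i]) (F : V -> W) :
  lipschitz_map F -> lipschitz_map (fun x => c *: F x).
Proof.
move=> [k hk]; exists (rnorm (c : R[i]^o) * k) => u v.
by rewrite -scalerBr rnormZ -mulrA ler_wpM2l ?rnorm_ge0.
Qed.

Lemma lipschitz_cmull (V : normedModType R[i]) (A : cstarAlgType R) (a : A) (F : V -> A) :
  lipschitz_map F -> lipschitz_map (fun x => a ** F x).
Proof.
move=> [k hk]; exists (rnorm a * k) => u v; rewrite -cmulBr.
by apply: le_trans (rnorm_cmul _ _) _; rewrite -mulrA ler_wpM2l ?rnorm_ge0.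
Qed.

Lemma lipschitz_cmulr (V : normedModType R[i]) (A : cstarAlgType R) (a : A) (F : V -> A) :
  lipschitz_map F -> lipschitz_map (fun x => F x ** a).
Proof.
move=> [k hk]; exists (k * rnorm a) => u v; rewrite -cmulBl.
by apply: le_trans (rnorm_cmul _ _) _; rewrite mulrAC ler_wpM2r ?rnorm_ge0.
Qed.

Lemma lipschitz_star (V : normedModType R[i]) (A : cstarAlgType R) (F : V -> A) :
  lipschitz_map F -> lipschitz_map (fun x => star (F x)).
Proof. by move=> [k hk]; exists k => u v; rewrite -starB rnorm_star. Qed.

Lemma lipschitz_state (V : normedModType R[i]) (A : cstarAlgType R) (w : functionals A)
    (F : V -> A) : is_state w ->
  lipschitz_map F -> lipschitz_map (fun x => w (F x) : R[i]^o).
Proof.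
move=> sw [k hk]; exists k => u v.
by rewrite -(scalarB (state_scalar sw)) (le_trans (state_bound sw _)).
Qed.

Lemma dense_lipschitz_eq (V W : normedModType R[i]) (I : Type) (p : I -> V)
    (E F : V -> W) :
  (forall v (e : R), 0 < e -> exists i, rnorm (v - p i) < e) ->
  lipschitz_map E -> lipschitz_map F -> (forall i, E (p i) = F (p i)) ->
  forall v, E v = F v.
Proof.
move=> dp /lipschitz_nonneg[k k0 hk] /lipschitz_nonneg[k' k'0 hk'] EF v.
apply/eqP; rewrite -subr_eq0; apply/eqP/rnorm_small => e e0.
have K0 : 0 < k + k' + 1 by rewrite ltr_wpDl // addr_ge0.
have [j hj] := dp v _ (divr_gt0 e0 K0).
have -> : E v - F v = (E v - E (p j)) + (F (p j) - F v) by rewrite EF addrA subrK.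
apply: le_trans (rnormD _ _) _; rewrite (rnormBC (F (p j))).
apply: le_trans (lerD (hk _ _) (hk' _ _)) _; rewrite -mulrDl.
rewrite ltr_pdivlMr // in hj; apply: le_trans (ltW hj).
by rewrite mulrC ler_wpM2l ?rnorm_ge0 // lerDl.
Qed.

End LipschitzMaps.

Section SumExtension.
Context {R : realType} {V W : cstarAlgType R}.

Definition is_star_hom (T : V -> W) : Prop :=
  [/\ linear T, {morph T : a b / a ** b}, {morph T : a / star a}, T cone = cone &
    forall a, rnorm (T a) <= rnorm a].

Lemma star_hom_lipschitz (T : V -> W) : is_star_hom T -> lipschitz_map T.
Proof.
move=> [lT _ _ _ bT]; exists 1 => u v; rewrite mul1r.
have -> : T u - T v = T (u - v); last exact: bT.
have -> : u - v = -1 *: v + u by rewrite scaleN1r addrC.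
by rewrite lT scaleN1r addrC.
Qed.

(** The norm inequality makes [sum p |-> sum q] well defined on finite sums. The parallel closure
    conditions give the algebraic laws on the generators, and density carries them to [V]. *)
Lemma sum_extension (K : Type) (p : K -> V) (q : K -> W) :
  (forall v (e : R), 0 < e -> exists l, rnorm (v - \sum_(k <- l) p k) < e) ->
  (forall l, rnorm (\sum_(k <- l) q k) <= rnorm (\sum_(k <- l) p k)) ->
  (forall (c : R[i]) k, exists k', p k' = c *: p k /\ q k' = c *: q k) ->
  (forall k1 k2, exists k', p k' = p k1 ** p k2 /\ q k' = q k1 ** q k2) ->
  (forall k, exists k', p k' = star (p k) /\ q k' = star (q k)) ->
  (exists k, p k = cone /\ q k = cone) ->
  exists T : V -> W, is_star_hom T /\ forall k, T (p k) = q k.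
Proof.
move=> dp qp hscale hmul hstar hone.
pose P l := \sum_(k <- l) p k; pose Q l := \sum_(k <- l) q k.
(* Scaling by [-1] turns the norm inequality for sums into one for differences of sums, as
   [dense_extension] requires. *)
have QN l : exists l', P l' = - P l /\ Q l' = - Q l.
  elim: l => [|k l [l' [h1 h2]]]; first by exists [::]; rewrite /P /Q !big_nil !oppr0.
  have [k' [h3 h4]] := hscale (-1) k; exists (k' :: l').
  by rewrite /P /Q !big_cons !opprD -/(P l) -/(Q l) -h1 -h2 h3 h4 !scaleN1r.
have QB i j : rnorm (Q i - Q j) <= rnorm (P i - P j).
  have [j' [<- <-]] := QN j.
  by rewrite /P /Q -!big_cat; exact: qp.
have [T [TP TB]] := dense_extension dp QB.
have Tp k : T (p k) = q k.
  by have := TP [:: k]; rewrite /P /Q !big_seq1.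
have lT : lipschitz_map T by exists 1 => u v; rewrite mul1r.
have TD u v : T (u + v) = T u + T v.
  move: v; apply: (dense_lipschitz_eq dp).
  - by apply: lipschitz_comp => //; apply: lipschitz_add; [exact: lipschitz_cst|exact: lipschitz_id].
  - by apply: lipschitz_add => //; exact: lipschitz_cst.
  move=> j; move: u; apply: (dense_lipschitz_eq dp).
  - by apply: lipschitz_comp => //; apply: lipschitz_add; [exact: lipschitz_id|exact: lipschitz_cst].
  - by apply: lipschitz_add => //; exact: lipschitz_cst.
  by move=> i; rewrite -big_cat !TP /Q big_cat.
have T0 : T 0 = 0 by apply: (addrI (T 0)); rewrite -TD !addr0.
have Tsum (I : Type) (l : seq I) (F : I -> V) : T (\sum_(i <- l) F i) = \sum_(i <- l) T (F i).
  by elim/big_rec2: _ => [//|i _ b _ <-]; rewrite TD.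
have TZ c u : T (c *: u) = c *: T u.
  move: u; apply: (dense_lipschitz_eq dp).
  - by apply: lipschitz_comp => //; apply: lipschitz_scale; exact: lipschitz_id.
  - exact: lipschitz_scale.
  move=> l; rewrite scaler_sumr !Tsum scaler_sumr; apply: eq_bigr => k _.
  by have [k' [<- h]] := hscale c k; rewrite !Tp.
exists T; split=> //; split.
- by move=> c u v; rewrite TD TZ.
- move=> u; apply: (dense_lipschitz_eq dp).
  + by apply: lipschitz_comp => //; apply: lipschitz_cmull; exact: lipschitz_id.
  + exact: lipschitz_cmull.
  move=> j; move: u; apply: (dense_lipschitz_eq dp).
  + by apply: lipschitz_comp => //; apply: lipschitz_cmulr; exact: lipschitz_id.
  + exact: lipschitz_cmulr.
  move=> i; rewrite cmul_suml !Tsum cmul_suml; apply: eq_bigr => k _.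
  rewrite cmul_sumr !Tsum cmul_sumr; apply: eq_bigr => k' _.
  by have [k'' [<- h]] := hmul k k'; rewrite !Tp.
- apply: (dense_lipschitz_eq dp).
  + by apply: lipschitz_comp => //; apply: lipschitz_star; exact: lipschitz_id.
  + exact: lipschitz_star.
  move=> l; rewrite star_sum !Tsum star_sum; apply: eq_bigr => k _.
  by have [k' [<- h]] := hstar k; rewrite !Tp.
- by have [k [<- h]] := hone; rewrite Tp.
- by move=> a; have := TB a 0; rewrite T0 !subr0.
Qed.

End SumExtension.

Section PullbackStates.
Context {R : realType} {V W : cstarAlgType R}.

Lemma state_star_hom (T : V -> W) (w : functionals W) :
  is_star_hom T -> is_state w -> is_state ((fun a => w (T a)) : functionals V).
Proof.
move=> [lT mT sT T1 _] [lw pw w1]; split.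
- by move=> c u v; rewrite lT lw.
- by move=> a; rewrite mT sT; exact: pw.
- by rewrite T1.
Qed.

End PullbackStates.

(** The norm formulas [rg_norm] and [rc_norm] concern lists without repetition, so terms with the
    same group element have to be collected first. *)
Lemma sum_regroup (I : eqType) (T : Type) (V : zmodType) (l : seq (I * T)) (F : I * T -> V) :
  \sum_(p <- l) F p = \sum_(i <- undup (map fst l)) \sum_(p <- l | p.1 == i) F p.
Proof.
transitivity (\sum_(i <- undup (map fst l)) \sum_(p <- l) if p.1 == i then F p else 0);
  last by apply: eq_bigr => i _; rewrite -big_mkcond.
rewrite exchange_big /=.
have h (l' : seq (I * T)) : {subset map fst l' <= undup (map fst l)} ->
    \sum_(p <- l') F p =
    \sum_(p <- l') \sum_(i <- undup (map fst l)) if p.1 == i then F p else 0.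
  elim: l' => [|p l' IH] sub; first by rewrite !big_nil.
  rewrite !big_cons -IH; last by move=> i hi; apply: sub; rewrite inE hi orbT.
  rewrite (bigD1_seq p.1) ?undup_uniq //=; last by apply: sub; rewrite inE eqxx.
  by congr (_ + _); rewrite eqxx big1 ?addr0 // => i; rewrite eq_sym => /negPf->.
by apply: h => i hi; rewrite mem_undup.
Qed.

Lemma dense_rnorm (R : realType) (V : normedModType R[i]) (P : set V) (v : V) (e : R) :
  dense P -> 0 < e -> exists2 u, P u & rnorm (v - u) < e.
Proof.
move=> dP e0.
have oB : open [set u : V | rnorm (v - u) < e].
  rewrite openE => u /= ue; apply/nbhs_rnormP; exists (e - rnorm (v - u)).
    by rewrite subr_gt0.
  move=> z zu /=; have := rnormD (v - u) (u - z); rewrite addrA subrK.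
  by move: zu; lra.
have nB : [set u : V | rnorm (v - u) < e] !=set0 by exists v; rewrite /= subrr rnorm0.
by have [u [ue Pu]] := dP _ nB oB; exists u.
Qed.

Section ComplexFunctions.
Context {R : realType} {X : topologicalType}.
Implicit Types (f g : X -> R[i]^o).

Lemma continuous_cst (c : R[i]^o) : continuous (fun _ : X => c).
Proof. by move=> x; exact: cvg_cst. Qed.

Lemma continuous_add f g : continuous f -> continuous g -> continuous (fun x => f x + g x : R[i]^o).
Proof. by move=> cf cg x; apply: cvgD; [exact: cf|exact: cg]. Qed.

Lemma continuous_mul f g : continuous f -> continuous g -> continuous (fun x => f x * g x : R[i]^o).
Proof. by move=> cf cg x; apply: cvgM; [exact: cf|exact: cg]. Qed.

Lemma rnorm_conj (z : R[i]) : rnorm (conjc z : R[i]^o) = rnorm (z : R[i]^o).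
Proof. by rewrite !rnormE; case: z => a b /=; rewrite sqrrN. Qed.

Lemma continuous_conj f : continuous f -> continuous (fun x => conjc (f x) : R[i]^o).
Proof.
move=> cf x; apply/(@cvg_rnormP _ _ _ _ (nbhs_filter x)) => e e0.
near=> y; rewrite -rmorphB rnorm_conj; near: y.
exact: (cvg_rnormP _ _).1 (cf x) e e0.
Unshelve. all: by end_near. Qed.

Lemma continuous_sum (I : Type) (l : seq I) (P : pred I) (F : I -> X -> R[i]^o) :
  (forall i, continuous (F i)) -> continuous (fun x => \sum_(i <- l | P i) F i x : R[i]^o).
Proof.
move=> cF x; apply: cvg_big => [|i _]; first exact: add_continuous.
exact: cF.
Qed.

End ComplexFunctions.

(** * Calculus in the crossed product; evaluation and inclusion *)

Section CrossedProduct.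
Context {R : realType} {G : groupType} {X : topologicalType} {act : G -> X -> X}.
Context (A : reduced_crossed_product R act) (B : reduced_group_algebra R G).
Hypothesis cact : forall g, continuous (act g).
Local Notation fn := (rc_fun A).
Local Notation U := (rc_U A).
Implicit Types (f : X -> R[i]^o) (g h : G).

Lemma unitary_rep_star (D : cstarAlgType R) (V : G -> D) g :
  is_unitary_rep V -> star (V g) = V g^-1%g.
Proof.
case=> V1 VM VV; have [VV1 _] := VV g.
by rewrite -[LHS]cmul1r -V1 -(mulgV g) VM cmulA VV1 cmul1l.
Qed.

Lemma rc_U1 : U 1%g = cone. Proof. by case: (rc_U_unitary A). Qed.
Lemma rc_UM g h : U (g * h)%g = U g ** U h. Proof. by case: (rc_U_unitary A). Qed.
Lemma rc_U_star g : star (U g) = U g^-1%g. Proof. exact/unitary_rep_star/rc_U_unitary. Qed.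

Lemma rc_U_fun g f : continuous f -> U g ** fn f = fn (fun x => f (act g^-1%g x)) ** U g.
Proof.
move=> cf; rewrite -(rc_covariant A g cf) -!cmulA.
by have [_ _ /(_ g)[-> _]] := rc_U_unitary A; rewrite cmul1r.
Qed.

Lemma continuous_translate f g : continuous f -> continuous (fun x => f (act g x)).
Proof. by move=> cf x; apply: continuous_comp; [exact: cact|exact: cf]. Qed.

Lemma rc_gen_mul f g f' g' : continuous f -> continuous f' ->
  (fn f ** U g) ** (fn f' ** U g') =
  fn (fun x => f x * f' (act g^-1%g x)) ** U (g * g')%g.
Proof.
move=> cf cf'; have -> := rc_funM A cf (continuous_translate (g := g^-1%g) cf').
by rewrite rc_UM !cmulA -(cmulA (fn f) (U g)) (rc_U_fun g cf') cmulA.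
Qed.

Lemma rc_gen_star f g : continuous f ->
  star (fn f ** U g) = fn (fun x => conjc (f (act g x))) ** U g^-1%g.
Proof.
move=> cf; have h1 := rc_fun_star A cf; have h2 := rc_U_fun g^-1%g (continuous_conj cf).
by rewrite starM rc_U_star -h1 h2 invgK.
Qed.

Lemma rc_fun_cst (c : R[i]) : fn (fun=> c) = c *: cone.
Proof.
have -> : (fun _ : X => c : R[i]^o) = (fun x => c * (fun=> 1) x) by apply/funext => x; rewrite mulr1.
by have -> := rc_funZ A c (@continuous_cst R X 1); rewrite rc_fun1.
Qed.

Lemma rc_fun_sum (I : Type) (l : seq I) (P : pred I) (F : I -> X -> R[i]^o) :
  (forall i, continuous (F i)) ->
  fn (fun x => \sum_(i <- l | P i) F i x) = \sum_(i <- l | P i) fn (F i).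
Proof.
move=> cF; elim: l => [|i l IH].
  rewrite big_nil; have -> : (fun x => \sum_(i <- [::] | P i) F i x) = (fun=> 0 : R[i]^o).
    by apply/funext => x; rewrite big_nil.
  by rewrite rc_fun_cst scale0r.
rewrite big_cons; case: ifPn => Pi.
  have h := rc_funD A (cF i) (continuous_sum (l := l) (P := P) cF).
  by rewrite -IH -h; congr (fn _); apply/funext => x; rewrite big_cons Pi.
by rewrite -IH; congr (fn _); apply/funext => x; rewrite big_cons (negPf Pi).
Qed.

Lemma rnorm_rc_fun_le f (c : R) : continuous f -> 0 <= c ->
  (forall x, rnorm (f x) <= c) -> rnorm (fn f) <= c.
Proof.
move=> cf c0 fc; rewrite -lee_fin.
have := rc_norm (s := [:: 1%g]) (f := fun=> f) A isT (fun=> cf).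
rewrite big_seq1 rc_U1 cmul1r => ->.
exact: opnorm_crossed_function_le.
Qed.

(** Group elements may repeat in lists of generators, so addition is concatenation; [gen_coef]
    collects the coefficients when a norm is computed. *)
Definition generator : Type := G * {f : X -> R[i]^o | continuous f}.

Definition rc_gen (k : generator) : A := fn (sval k.2) ** U k.1.

Definition gen_coef (l : seq generator) g : X -> R[i]^o :=
  fun x => \sum_(k <- l | k.1 == g) sval k.2 x.

Lemma gen_coef_continuous (l : seq generator) g : continuous (gen_coef l g).
Proof. by apply: continuous_sum => k; exact: svalP k.2. Qed.

Lemma rc_gen_sum (l : seq generator) : \sum_(k <- l) rc_gen k =
  \sum_(g <- undup (map fst l)) fn (gen_coef l g) ** U g.
Proof.
rewrite sum_regroup; apply: eq_bigr => g _.
have -> := rc_fun_sum l (fun k => k.1 == g) (fun k : generator => svalP k.2).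
by rewrite cmul_suml; apply: eq_bigr => k /eqP <-.
Qed.

Lemma rc_gen_dense (v : A) (e : R) : 0 < e ->
  exists l, rnorm (v - \sum_(k <- l) rc_gen k) < e.
Proof.
move=> e0; have [_ [s [f [cf ->]]] he] := dense_rnorm v (rc_dense (r := A)) e0.
exists [seq (g, exist _ (f g) (cf g)) | g <- s].
by rewrite big_map.
Qed.

Lemma rg_dense_sum (v : B) (e : R) : 0 < e ->
  exists l : seq (G * R[i]), rnorm (v - \sum_(k <- l) k.2 *: rg_U B k.1) < e.
Proof.
move=> e0; have [_ [s [c ->]] he] := dense_rnorm v (rg_dense (r := B)) e0.
exists [seq (g, c g) | g <- s].
by rewrite big_map.
Qed.

Lemma rg_U1 : rg_U B 1%g = cone. Proof. by case: (rg_U_unitary B). Qed.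
Lemma rg_UM g h : rg_U B (g * h)%g = rg_U B g ** rg_U B h. Proof. by case: (rg_U_unitary B). Qed.
Lemma rg_U_star g : star (rg_U B g) = rg_U B g^-1%g.
Proof. exact/unitary_rep_star/rg_U_unitary. Qed.

Lemma rg_sum (l : seq (G * R[i])) : \sum_(k <- l) k.2 *: rg_U B k.1 =
  \sum_(g <- undup (map fst l)) (\sum_(k <- l | k.1 == g) k.2) *: rg_U B g.
Proof.
rewrite sum_regroup; apply: eq_bigr => g _.
by rewrite scaler_suml; apply: eq_bigr => k /eqP <-.
Qed.

(** Translating a coefficient does not change its value at a fixed point, which gives
    multiplicativity; [opnorm_group_le_crossed] gives contractivity. *)
Lemma evaluation_hom (x0 : X) : (forall g, act g x0 = x0) ->
  exists T : A -> B, is_star_hom T /\ forall f g, continuous f ->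
    T (fn f ** U g) = f x0 *: rg_U B g.
Proof.
move=> fix0.
have [||||||T [hT TE]] := @sum_extension _ A B generator rc_gen
    (fun k => sval k.2 x0 *: rg_U B k.1).
- exact: rc_gen_dense.
- move=> l; rewrite -lee_fin; have -> : \sum_(k <- l) sval k.2 x0 *: rg_U B k.1 =
      \sum_(g <- undup (map fst l)) gen_coef l g x0 *: rg_U B g.
    rewrite sum_regroup; apply: eq_bigr => g _.
    by rewrite scaler_suml; apply: eq_bigr => k /eqP <-.
  rewrite rc_gen_sum /rnorm rg_norm ?undup_uniq // rc_norm ?undup_uniq //.
    exact: opnorm_group_le_crossed.
  exact: gen_coef_continuous.
- move=> c [g [f cf]]; have cf' := continuous_mul (@continuous_cst R X c) cf.
  exists (g, exist _ _ cf'); rewrite /rc_gen /= scalerA; split=> //.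
  by have -> := rc_funZ A c cf; rewrite cmulZl.
- move=> [g [f cf]] [g' [f' cf']].
  have cff := continuous_mul cf (continuous_translate (g := g^-1%g) cf').
  exists ((g * g')%g, exist _ _ cff); rewrite /rc_gen /=; split.
    by rewrite rc_gen_mul.
  by rewrite fix0 cmulZl cmulZr scalerA rg_UM.
- move=> [g [f cf]]; have cf' := continuous_conj (continuous_translate (g := g) cf).
  exists (g^-1%g, exist _ _ cf'); rewrite /rc_gen /=; split.
    by rewrite rc_gen_star.
  by rewrite fix0 starZ rg_U_star.
- exists (1%g, exist _ _ (@continuous_cst R X 1)); rewrite /rc_gen /=; split.
    by rewrite rc_fun1 rc_U1 cmul1l.
  by rewrite scale1r rg_U1.
- by exists T; split=> // f g cf; exact: (TE (g, exist _ f cf)).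
Qed.

(** Scalars are viewed as constant functions, and [opnorm_crossed_le_group] gives contractivity. *)
Lemma inclusion_hom : exists T : B -> A, is_star_hom T /\ forall g, T (rg_U B g) = U g.
Proof.
have [||||||T [hT TE]] := @sum_extension _ B A (G * R[i])%type
    (fun k => k.2 *: rg_U B k.1) (fun k => k.2 *: U k.1).
- exact: rg_dense_sum.
- move=> l; rewrite -lee_fin rg_sum; have -> : \sum_(k <- l) k.2 *: U k.1 =
      \sum_(g <- undup (map fst l)) fn (fun=> \sum_(k <- l | k.1 == g) k.2) ** U g.
    rewrite sum_regroup; apply: eq_bigr => g _.
    by rewrite rc_fun_cst cmulZl cmul1l scaler_suml; apply: eq_bigr => k /eqP <-.
  rewrite /rnorm rg_norm ?undup_uniq //.
  rewrite (@rc_norm _ _ _ _ A _ (fun g _ => \sum_(k <- l | k.1 == g) k.2) (undup_uniq _)).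
    exact: opnorm_crossed_le_group.
  by move=> g; exact: continuous_cst.
- by move=> c [g z]; exists (g, c * z); rewrite /= !scalerA.
- by move=> [g z] [g' z']; exists ((g * g')%g, z * z');
    rewrite /= !cmulZl !cmulZr !scalerA rg_UM rc_UM.
- by move=> [g z]; exists (g^-1%g, conjc z); rewrite /= !starZ rg_U_star rc_U_star.
- by exists (1%g, 1); rewrite /= !scale1r rg_U1 rc_U1.
- by exists T; split=> // g; have := TE (g, 1); rewrite !scale1r.
Qed.

End CrossedProduct.

(** * Analytic generators of the flow *)

Section ComplexExponential.
Context {R : realType}.
Local Notation Re := (@complex.Re R).
Local Notation Im := (@complex.Im R).
Implicit Types (z w u : R[i]).

Definition cexp z : R[i] :=
  (expR (Re z) * cos (Im z)) +i* (expR (Re z) * sin (Im z)).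

Lemma cexpD z w : cexp (z + w) = cexp z * cexp w.
Proof.
case: z w => a b [c d]; rewrite /cexp /= expRD cosD sinD.
by apply/eqP; rewrite eq_complex /=; apply/andP; split; apply/eqP; ring.
Qed.

Lemma cexp_real (x : R) : cexp x%:C = (expR x)%:C.
Proof. by rewrite /cexp /= cos0 sin0 mulr1 mulr0. Qed.

Lemma derive_approx (f : R -> R) (d e : R) : is_derive (0 : R) 1 f d -> 0 < e ->
  exists2 r : R, 0 < r & forall x, `|x| < r -> `|f x - f 0 - d * x| <= e * `|x|.
Proof.
move=> [df dE] e0; have := df; rewrite /derivable -/('D_1 f 0) => cv.
have /cvgrPdist_lt/(_ e e0) := cv; rewrite -/('D_1 f 0) dE.
move=> /nbhs_normP[r /= r0 hr]; exists r => // x xr.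
have [->|x0] := eqVneq x 0; first by rewrite subrr mulr0 subrr normr0 mulr0.
have := hr x; rewrite /= sub0r normrN => /(_ xr x0).
rewrite [x *: 1]mulr1 addr0 => /ltW.
have xn : 0 < `|x| by rewrite normr_gt0.
rewrite -(ler_pM2r xn) -normrM mulrBl [x^-1 *: _]mulrC divfK // distrC.
by [].
Qed.

Lemma cexp_approx (e : R) : 0 < e -> exists2 r : R, 0 < r &
  forall u, rnorm (u : R[i]^o) < r ->
    rnorm (cexp u - 1 - u : R[i]^o) <= e * rnorm (u : R[i]^o).
Proof.
(* The four error terms below add up to at most [9 * d * |u|]; [d <= 1] keeps [|expR a|] below 3. *)
move=> e0; have [d [d0 d1 d2]] : exists d : R, [/\ 0 < d, d <= 1 & d <= e / 12].
  exists (Num.min 1 (e / 12)); split; first by rewrite lt_min ltr01 divr_gt0.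
    by rewrite ge_min lexx.
  by rewrite ge_min lexx orbT.
have [r1 r10 h1] := derive_approx (is_derive_expR 0) d0.
have [r2 r20 h2] := derive_approx (is_derive_cos 0) d0.
have [r3 r30 h3] := derive_approx (is_derive_sin 0) d0.
pose r := Num.min (Num.min r1 r2) (Num.min r3 d).
exists r; first by rewrite /r !lt_min r10 r20 r30 d0.
case=> a b; rewrite !lt_min => /andP[/andP[n1 n2] /andP[n3 nd]].
have ha := abs_Re_le (a +i* b : R[i]^o); have hb := abs_Im_le (a +i* b : R[i]^o).
rewrite /= in ha hb; set n := rnorm _ in n1 n2 n3 nd ha hb *.
have := h1 a (le_lt_trans ha n1); have := h2 b (le_lt_trans hb n2).
have := h3 b (le_lt_trans hb n3).
rewrite expR0 sin0 cos0 subr0 !mul1r oppr0 mul0r subr0 => s1 c1 x1.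
have E1 : `|expR a - 1| <= 2 * `|a|.
  have := ler_normD (expR a - 1 - a) a; rewrite subrK; have := normr_ge0 a; nra.
have E2 : `|expR a| <= 3.
  have := ler_normD (expR a - 1) 1; rewrite subrK normr1; lra.
apply: le_trans (rnorm_le_abs _) _ => /=.
have -> : expR a * cos b - 1 - a = (expR a - 1 - a) + expR a * (cos b - 1) by ring.
have -> : expR a * sin b - 0 - b = expR a * (sin b - b) + (expR a - 1) * b by ring.
have := ler_normD (expR a - 1 - a) (expR a * (cos b - 1)); rewrite normrM.
have := ler_normD (expR a * (sin b - b)) ((expR a - 1) * b); rewrite !normrM.
have n0 : 0 <= n := rnorm_ge0 _.
have m1 : `|expR a| * `|cos b - 1| <= 3 * (d * n).
  by rewrite ler_pM // (le_trans c1) // ler_wpM2l // ltW.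
have m2 : `|expR a| * `|sin b - b| <= 3 * (d * n).
  by rewrite ler_pM // (le_trans s1) // ler_wpM2l // ltW.
have m3 : `|expR a - 1| * `|b| <= 2 * d * n.
  by apply: ler_pM => //; lra.
have m4 : `|expR a - 1 - a| <= d * n by rewrite (le_trans x1) // ler_wpM2l // ltW.
have m5 : 9 * (d * n) <= e * n.
  by rewrite mulrA ler_wpM2r //; lra.
by move=> *; lra.
Qed.

Lemma continuous_cexp (X : topologicalType) (f : X -> R[i]^o) : continuous f ->
  continuous (fun x => cexp (f x) : R[i]^o).
Proof.
move=> cf.
have cR : continuous (fun x => Re (f x)).
  by move=> x; apply: continuous_comp; [exact: cf|exact: Re_continuous].
have cI : continuous (fun x => Im (f x)).
  by move=> x; apply: continuous_comp; [exact: cf|exact: Im_continuous].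
have cE : continuous (fun x => expR (Re (f x))).
  by move=> x; apply: continuous_comp; [exact: cR|exact: continuous_expR].
apply: continuous_complex => x.
  apply: cvgM; first exact: cE.
  by apply: continuous_comp; [exact: cI|exact: continuous_cos].
apply: cvgM; first exact: cE.
by apply: continuous_comp; [exact: cI|exact: continuous_sin].
Qed.

Lemma continuous_realC (X : topologicalType) (f : X -> R) : continuous f ->
  continuous (fun x => (f x)%:C : R[i]^o).
Proof. by move=> cf; apply: continuous_complex => // x; exact: cvg_cst. Qed.

End ComplexExponential.

Section ExponentialFamily.
Context {R : realType} {G : groupType} {X : topologicalType} {act : G -> X -> X}.
Context (A : reduced_crossed_product R act).
Context (L : X -> R) (N : R).
Hypothesis cL : continuous L.
Hypothesis LN : forall x, `|L x| <= N.
Local Notation fn := (rc_fun A).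

Definition exp_family (z : R[i]) : A := fn (fun x => cexp (- 'i%C * z * (L x)%:C)).

Lemma continuous_exponent (z : R[i]) : continuous (fun x => - 'i%C * z * (L x)%:C : R[i]^o).
Proof.
apply: continuous_mul; last exact: continuous_realC.
exact: continuous_cst.
Qed.

Lemma exp_familyD (z u : R[i]) : exp_family (z + u) = exp_family z ** exp_family u.
Proof.
rewrite /exp_family.
have <- := rc_funM A (continuous_cexp (continuous_exponent (z := z))) (continuous_cexp (continuous_exponent (z := u))).
by congr (fn _); apply/funext => x; rewrite -cexpD mulrDr mulrDl.
Qed.

(** By [exp_familyD] the increment at [z] is a product with the increment at 0. There [cexp_approx]
    is uniform over [X] because [L] is bounded, and the norm of [fn] is at most the supremum. *)
Lemma exp_family_derivable (a : A) (z : R[i]^o) :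
  derivable (fun z : R[i]^o => a ** exp_family z) z 1.
Proof.
pose D := fn (fun x => - 'i%C * 1 * (L x)%:C).
apply/derivable_rnorm; exists (a ** exp_family z ** D) => e e0.
pose b := a ** exp_family z.
have nb := rnorm_ge0 b.
pose M := Num.max N 0 + 1.
have M0 : 0 < M by rewrite /M ltr_wpDl // le_max lexx orbT.
have LM x : `|L x| <= M by rewrite (le_trans (LN x)) // /M ler_wpDr // le_max lexx.
have k0 : 0 < M * (rnorm b + 1) by rewrite mulr_gt0 // ltr_wpDl.
have [r r0 hr] := cexp_approx (divr_gt0 e0 k0).
exists (r / M); first by rewrite divr_gt0.
move=> u ur.
have u0 := rnorm_ge0 u.
have expo x : rnorm (- 'i%C * u * (L x)%:C : R[i]^o) <= rnorm u * M.
  rewrite !rnormM rnorm_real rnormN.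
  have -> : rnorm ('i%C : R[i]^o) = 1 by rewrite rnormE /= expr0n expr1n add0r sqrtr1.
  by rewrite mul1r ler_wpM2l.
have cu := continuous_cexp (continuous_exponent (z := u)).
have c1 : continuous (fun x => (cexp (- 'i%C * u * (L x)%:C) : R[i]^o) + (-1 : R[i]^o)).
  exact: (continuous_add cu (@continuous_cst R X (-1))).
have c2 : continuous (fun x => - u * (- 'i%C * 1 * (L x)%:C) : R[i]^o).
  by apply: continuous_mul; [exact: continuous_cst|exact: continuous_exponent].
have fE : exp_family u - cone - u *: D =
    fn (fun x => (cexp (- 'i%C * u * (L x)%:C) + (-1)) + - u * (- 'i%C * 1 * (L x)%:C)).
  have -> := rc_funD A c1 c2.
  have -> := rc_funZ A (- u) (continuous_exponent (z := 1)).
  have -> := rc_funD A cu (@continuous_cst R X (-1)).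
  by rewrite rc_fun_cst scaleN1r scaleNr.
have -> : a ** exp_family (z + u) - a ** exp_family z - u *: (a ** exp_family z ** D) =
    b ** (exp_family u - cone - u *: D).
  by rewrite exp_familyD !cmulBr cmul1r cmulZr cmulA.
apply: le_trans (rnorm_cmul _ _) _.
have bd : rnorm (exp_family u - cone - u *: D) <= e / (M * (rnorm b + 1)) * (rnorm u * M).
  rewrite fE; apply: rnorm_rc_fun_le.
  - exact: (continuous_add c1 c2).
  - by rewrite mulr_ge0 ?mulr_ge0 ?invr_ge0 // ltW.
  - move=> x; have -> : - u * (- 'i%C * 1 * (L x)%:C) = - (- 'i%C * u * (L x)%:C) by ring.
    apply: le_trans (hr _ _) _.
      by apply: le_lt_trans (expo x) _; rewrite -ltr_pdivlMr.
    by rewrite ler_wpM2l // divr_ge0 // ltW.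
apply: le_trans (ler_wpM2l nb bd) _.
have -> : rnorm b * (e / (M * (rnorm b + 1)) * (rnorm u * M)) =
   (rnorm b / (rnorm b + 1)) * (e * rnorm u).
  by field; rewrite !gt_eqF // ltr_wpDl.
rewrite ler_piMl ?mulr_ge0 ?(ltW e0) // ler_pdivrMr ?mul1r ?lerDl //.
by rewrite ltr_wpDl.
Qed.

End ExponentialFamily.

(** * KMS states are supported at the spine *)

Section RealContinuity.
Context {R : realType}.

Lemma continuous_mull (T : topologicalType) (c : R) (f : T -> R) : continuous f ->
  continuous (fun x => c * f x).
Proof. by move=> cf x; apply: cvgM; [exact: cvg_cst|exact: cf]. Qed.

Lemma continuous_cstr (T : topologicalType) (c : R) : continuous (fun _ : T => c).
Proof. by move=> x; exact: cvg_cst. Qed.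

Lemma continuous_subr (T : topologicalType) (f f' : T -> R) : continuous f -> continuous f' ->
  continuous (fun x => f x - f' x).
Proof. by move=> cf cf' x; apply: cvgB; [exact: cf|exact: cf']. Qed.

Lemma continuous_addr (T : topologicalType) (f f' : T -> R) : continuous f -> continuous f' ->
  continuous (fun x => f x + f' x).
Proof. by move=> cf cf' x; apply: cvgD; [exact: cf|exact: cf']. Qed.

Lemma continuous_mulr (T : topologicalType) (f f' : T -> R) : continuous f -> continuous f' ->
  continuous (fun x => f x * f' x).
Proof. by move=> cf cf' x; apply: cvgM; [exact: cf|exact: cf']. Qed.

Lemma continuous_combination (T : topologicalType) (I : Type) (l : seq I)
    (c : I -> R) (F : I -> T -> R) :
  (forall g, continuous (F g)) -> continuous (fun x => \sum_(g <- l) c g * F g x).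
Proof.
move=> cF x; apply: cvg_big => [|g _]; first exact: add_continuous.
exact: continuous_mull.
Qed.

End RealContinuity.

Section KMS.
Context {R : realType} {G : groupType} {mu : G -> R}.
Context {M : martin_compactification mu}.
Context (A : reduced_crossed_product R (boundary_act M)) (alpha : R -> A -> A).
Context (d : G -> G -> nat) (C : R).
Hypothesis rw : is_random_walk mu.
Hypothesis tr : transient mu.
Hypothesis C0 : 0 < C.
Hypothesis har : harnack mu d C.
Hypothesis moment : moment_condition mu d C.
Hypothesis mf : is_martin_flow alpha.
Local Notation X := (boundary M).
Local Notation K := (@boundary_kernel R G mu M).
Local Notation act := (boundary_act M).
Local Notation fn := (rc_fun A).
Local Notation U := (rc_U A).
Local Notation Re := (@complex.Re R).
Implicit Types (f : X -> R[i]^o) (g h s : G).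

Let K0 g x : 0 < K g x. Proof. exact: (@boundary_kernel_gt0 _ _ _ _ rw tr d C). Qed.

Let cact g : continuous (act g). Proof. exact: boundary_act_continuous. Qed.

Lemma ln_kernel_continuous g : continuous (fun x => ln (K g x)).
Proof.
move=> x; apply: continuous_comp; first exact: boundary_kernel_continuous.
exact: continuous_ln.
Qed.

Lemma continuous_bounded (f : X -> R) : continuous f -> exists2 N, 0 <= N & forall x, `|f x| <= N.
Proof.
move=> cf.
have : compact (f @` [set: X]).
  apply: continuous_compact; last exact: boundary_compact.
  by apply: continuous_subspaceT.
move=> /compact_bounded[N [_ hN]]; exists (`|N| + 1); first by rewrite addr_ge0.
move=> x; apply: (hN (`|N| + 1)); last by exists x.
by rewrite (le_lt_trans (ler_norm N)) // ltrDl.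
Qed.

Definition kernel_power g (beta : R) (x : X) : R := expR (beta * ln (K g x)).

Lemma kernel_power_continuous g beta : continuous (kernel_power g beta).
Proof.
move=> x; apply: (@continuous_comp _ _ _ (fun x => beta * ln (K g x)) expR).
  exact: (continuous_mull (@ln_kernel_continuous g)).
exact: continuous_expR.
Qed.

(* [t |-> f U_g K(g^-1, .)^(- i t)] extends to [z |-> f U_g exp(- i z ln K(g^-1, .))],
   whose value at [i beta] is [f U_g K(g^-1, .)^beta]. *)
Lemma martin_flow_entire f g : continuous f ->
  exists2 F, entire_extension alpha (fn f ** U g) F &
    forall beta, F (0 +i* beta) =
      fn f ** U g ** fn (fun x => (kernel_power g^-1%g beta x)%:C).
Proof.
move=> cf; have [_ flow] := mf.
have cL := @ln_kernel_continuous g^-1%g.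
have [N _ LN] := continuous_bounded cL.
exists (fun z => fn f ** U g ** exp_family A (fun x => ln (K g^-1%g x)) z).
  split=> [z|t]; first exact: exp_family_derivable cL LN _ _.
  rewrite flow //; congr (_ ** _); rewrite /exp_family; congr (fn _).
  apply/funext => x; rewrite /powit /cexp.
  set l := ln _; apply/eqP; rewrite eq_complex /=.
  have -> : (- 0 * t - - 1 * 0) * l - (- 0 * 0 + - 1 * t) * 0 = 0 by ring.
  have -> : (- 0 * t - - 1 * 0) * 0 + (- 0 * 0 + - 1 * t) * l = - t * l by ring.
  by rewrite expR0 !mul1r !eqxx.
move=> beta; rewrite /exp_family; congr (_ ** fn _); apply/funext => x.
rewrite /kernel_power -cexp_real; congr cexp.
by apply/eqP; rewrite eq_complex /=; apply/andP; split; apply/eqP; ring.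
Qed.

Section State.
Context (beta : R) (w : functionals A).
Hypothesis kw : kms_states alpha beta w.

Let sw : is_state w. Proof. by case: kw. Qed.

Lemma kms_generators f g f' g' : continuous f -> continuous f' ->
  w ((fn f ** U g) ** (fn f' ** U g')) =
  w ((fn f' ** U g') ** (fn f ** U g ** fn (fun x => (kernel_power g^-1%g beta x)%:C))).
Proof.
move=> cf cf'; have [_ kms] := kw.
have [F eF FE] := martin_flow_entire g cf; have [F' eF' _] := martin_flow_entire g' cf'.
by rewrite (kms _ _ F eF) ?FE //; exists F'.
Qed.

Lemma fn1U g : fn (fun=> 1) ** U g = U g.
Proof. by rewrite rc_fun1 cmul1l. Qed.

(** Quasi-invariance with density [K(g^-1, .)^beta]: the KMS condition for [a = U g] and
    [b = fn f ** U g^-1]. *)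
Lemma kms_translate f g : continuous f ->
  w (fn (fun x => f (act g^-1%g x))) = w (fn (fun x => f x * (kernel_power g^-1%g beta x)%:C)).
Proof.
move=> cf; have := kms_generators g g^-1%g (@continuous_cst R X 1) cf.
rewrite fn1U cmulA (rc_U_fun A g cf) -cmulA -rc_UM mulgV rc_U1 cmul1r => ->.
have ck := continuous_realC (@kernel_power_continuous g^-1%g beta).
have -> := rc_funM A cf ck.
by rewrite cmulA -(cmulA (fn f)) -rc_UM mulVg rc_U1 cmul1r.
Qed.

Lemma kms_kernel_power g : w (fn (fun x => (kernel_power g beta x)%:C)) = 1.
Proof.
have := kms_translate g^-1%g (@continuous_cst R X 1); rewrite invgK rc_fun1 (state1 sw) => ->.
by congr (w (fn _)); apply/funext => x; rewrite mul1r.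
Qed.

(** Integration against the measure of [w], kept as a real-valued functional on real continuous
    functions. *)
Definition kms_measure (f : X -> R) : R := Re (w (fn (fun x => (f x)%:C))).
Local Notation m := kms_measure.

Lemma kms_measureD (f f' : X -> R) : continuous f -> continuous f' ->
  m (fun x => f x + f' x) = m f + m f'.
Proof.
move=> cf cf'; rewrite /m -raddfD -(scalarD (state_scalar sw)).
have <- := rc_funD A (continuous_realC cf) (continuous_realC cf').
by congr (Re (w (fn _))); apply/funext => x; rewrite rmorphD.
Qed.

Lemma kms_measureZ (c : R) (f : X -> R) : continuous f -> m (fun x => c * f x) = c * m f.
Proof.
move=> cf; rewrite /m.
have -> : (fun x => (c * f x)%:C : R[i]^o) = (fun x => c%:C * (f x)%:C).
  by apply/funext => x; rewrite rmorphM.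
have -> := rc_funZ A c%:C (continuous_realC cf).
by rewrite (scalarZ (state_scalar sw)); case: (w _) => a b /=; rewrite mul0r subr0.
Qed.

Lemma kms_measure_ge0 (f : X -> R) : continuous f -> (forall x, 0 <= f x) -> 0 <= m f.
Proof.
move=> cf f0; have cs : continuous (fun x => Num.sqrt (f x)).
  by move=> x; apply: continuous_comp; [exact: cf|exact: sqrt_continuous].
have csC := continuous_realC cs.
have -> : m f = Re (w (star (fn (fun x => (Num.sqrt (f x))%:C)) ** fn (fun x => (Num.sqrt (f x))%:C))).
  have <- := rc_fun_star A csC.
  have <- := rc_funM A (continuous_conj csC) csC.
  congr (Re (w (fn _))); apply/funext => x.
  by rewrite conjc_real -rmorphM -expr2 sqr_sqrtr.
by have := state_pos sw (fn (fun x => (Num.sqrt (f x))%:C)); rewrite lecE => /andP[].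
Qed.

Lemma kms_measure1 : m (fun=> 1) = 1.
Proof. by rewrite /m rc_fun1 (state1 sw). Qed.

Lemma kms_measure_le (f f' : X -> R) : continuous f -> continuous f' ->
  (forall x, f x <= f' x) -> m f <= m f'.
Proof.
move=> cf cf' ff'.
have cN := continuous_mull (c := -1) cf.
rewrite -subr_ge0 -mulN1r -(kms_measureZ _ cf) -(kms_measureD cf' cN).
apply: kms_measure_ge0 => [x|x]; last by rewrite mulN1r subr_ge0.
exact: (cvgD (cf' x) (cN x)).
Qed.

Lemma kms_measure_sum (l : seq G) (c : G -> R) (F : G -> X -> R) :
  (forall g, continuous (F g)) ->
  continuous (fun x => \sum_(g <- l) c g * F g x) /\
  m (fun x => \sum_(g <- l) c g * F g x) = \sum_(g <- l) c g * m (F g).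
Proof.
move=> cF; have cG g := continuous_mull (c := c g) (cF g).
have cS l' : continuous (fun x => \sum_(g <- l') c g * F g x : R).
  exact: continuous_combination.
split=> //; elim: l => [|g l IH].
  rewrite big_nil.
  have -> : (fun x => \sum_(g <- [::]) c g * F g x) = (fun x : X => 0 * 1).
    by apply/funext => x; rewrite big_nil mul0r.
  by rewrite (kms_measureZ 0 (@continuous_cstr R X 1)) mul0r.
have -> : (fun x => \sum_(h <- g :: l) c h * F h x) =
    (fun x => c g * F g x + \sum_(h <- l) c h * F h x).
  by apply/funext => x; rewrite big_cons.
by rewrite big_cons kms_measureD // kms_measureZ // IH.
Qed.

Definition kernel_gap s (x : X) : R := bernoulli_gap beta (K s x).

Lemma kernel_gap_continuous s : continuous (kernel_gap s).
Proof.
have c1 := @continuous_cstr R X 1.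
have c2 := continuous_subr (@kernel_power_continuous s beta) c1.
have c3 := continuous_subr (@boundary_kernel_continuous R G mu M s) c1.
exact: continuous_mull (continuous_subr c2 (continuous_mull c3)).
Qed.

Hypothesis b0 : beta != 0.
Hypothesis b1 : beta != 1.

Lemma kernel_gap_ge0 s x : 0 <= kernel_gap s x.
Proof. exact: bernoulli_gap_ge0. Qed.

Let c1 : continuous (fun _ : X => 1 : R).
Proof. exact: continuous_cstr. Qed.

(** Since [K(s, .)^beta] has integral 1, the power and the constant 1 in the gap cancel and the
    linear term is left. *)
Lemma kms_measure_gap s : m (kernel_gap s) = bernoulli_sign beta * beta * (1 - m (K s)).
Proof.
have cK := @boundary_kernel_continuous R G mu M s.
have cP := @kernel_power_continuous s beta.
have c2 := continuous_mull (c := - beta) cK.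
have c3 := continuous_mull (c := beta - 1) c1.
have c4 : continuous (fun x => kernel_power s beta x + (- beta * K s x)).
  exact: continuous_addr.
have c5 : continuous (fun x => (kernel_power s beta x + (- beta * K s x)) + (beta - 1) * 1).
  exact: continuous_addr.
have -> : kernel_gap s = fun x => bernoulli_sign beta *
    ((kernel_power s beta x + (- beta * K s x)) + (beta - 1) * 1).
  by apply/funext => x; rewrite /kernel_gap /bernoulli_gap /kernel_power; ring.
rewrite (kms_measureZ _ c5) (kms_measureD c4 c3) (kms_measureD cP c2).
rewrite (kms_measureZ _ cK) (kms_measureZ _ c1) kms_measure1.
have -> : m (kernel_power s beta) = 1 by rewrite /kms_measure kms_kernel_power.
by ring.
Qed.

(* Summing over [mu] the gaps average to [1 - sum_g mu g * K g = 0]. *)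
Lemma kms_measure_gap0 s : mu s * m (kernel_gap s) = 0.
Proof.
have mu0 g : 0 <= mu g by case: rw => _ /(_ g)/andP[].
have mg0 g : 0 <= mu g * m (kernel_gap g).
  rewrite mulr_ge0 // kms_measure_ge0 //; first exact: kernel_gap_continuous.
  exact: kernel_gap_ge0.
apply/eqP; rewrite eq_le mg0 andbT; apply/ler_addgt0Pl => e e0; rewrite addr0.
have nb : 0 < `|beta| by rewrite normr_gt0.
(* By [kms_measure_gap] the gaps sum to [beta], up to sign, times a difference of two numbers in
   [[1 - e / |beta|, 1]], hence to at most [e]; each summand is nonnegative. *)
have [l [sl ml hl]] := boundary_kernel_sum_near1 (M := M) rw tr C0 har moment s (divr_gt0 e0 nb).
have [cS mS] := kms_measure_sum l mu (@boundary_kernel_continuous R G mu M).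
have [ct mt] : 1 - e / `|beta| <= \sum_(g <- l) mu g * m (K g) /\
    \sum_(g <- l) mu g * m (K g) <= 1.
  have ccst (c : R) : m (fun=> c * 1) = c by rewrite (kms_measureZ c c1) kms_measure1 mulr1.
  rewrite -mS; split.
    rewrite -[leLHS]ccst; apply: kms_measure_le => //; first exact: continuous_mull.
    by move=> x; rewrite mulr1; case/andP: (hl x).
  rewrite -[leRHS]ccst; apply: kms_measure_le => //; first exact: continuous_mull.
  by move=> x; rewrite mulr1; case/andP: (hl x).
apply: (@le_trans _ _ (\sum_(g <- l) mu g * m (kernel_gap g))).
  by rewrite (big_rem s) //= lerDl sumr_ge0.
have -> : \sum_(g <- l) mu g * m (kernel_gap g) = bernoulli_sign beta * beta *
    (\sum_(g <- l) mu g - \sum_(g <- l) mu g * m (K g)).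
  rewrite -sumrB mulr_sumr; apply: eq_bigr => g _.
  by rewrite kms_measure_gap; ring.
apply: le_trans (ler_norm _) _; rewrite !normrM abs_bernoulli_sign mul1r mulrC.
rewrite -ler_pdivlMr // ler_norml; move/andP: ml => [m1 m2].
by move: m1 m2 ct mt; lra.
Qed.

(** By quasi-invariance a translate of the gap has the integral of the gap times a bounded density,
    which is 0 when weighted by [mu s]. *)
Lemma kms_measure_translated_gap g s :
  m (fun x => mu s * kernel_gap s (act g x)) = 0.
Proof.
have mu0 : 0 <= mu s by case: rw => _ /(_ s)/andP[].
have cg := @kernel_gap_continuous s.
have cga : continuous (fun x => kernel_gap s (act g x)).
  by move=> x; apply: continuous_comp; [exact: cact|exact: cg].
have cp := @kernel_power_continuous g beta.
have cpg : continuous (fun x => kernel_gap s x * kernel_power g beta x).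
  exact: continuous_mulr.
have E : m (fun x => kernel_gap s (act g x)) = m (fun x => kernel_gap s x * kernel_power g beta x).
  rewrite /kms_measure; congr Re; have := kms_translate g^-1%g (continuous_realC cg).
  rewrite invgK => ->; congr (w (fn _)); apply/funext => x.
  by rewrite [RHS]rmorphM.
have [N N0 hN] := continuous_bounded cp.
have p0 x : 0 <= kernel_power g beta x by rewrite ltW // expR_gt0.
apply/eqP; rewrite eq_le; apply/andP; split; last first.
  apply: kms_measure_ge0; first exact: continuous_mull.
  by move=> x; rewrite mulr_ge0 // kernel_gap_ge0.
rewrite (kms_measureZ _ cga) E.
apply: (@le_trans _ _ (mu s * (N * m (kernel_gap s)))).
  rewrite ler_wpM2l // -(kms_measureZ _ cg); apply: kms_measure_le => //.
    exact: continuous_mull.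
  move=> x; rewrite mulrC ler_wpM2r ?kernel_gap_ge0 //.
  by apply: le_trans (hN x); exact: ler_norm.
by rewrite mulrCA kms_measure_gap0 mulr0.
Qed.

(** The cocycle identity reads [K(s, h^-1 x) K(h, x) = K(h s, x)], so vanishing gaps at all
    translates allow the letters of a word in the support to be removed one by one. *)
Lemma kernel_gaps_eq0 (x : X) :
  (forall g s, mu s * kernel_gap s (act g x) = 0) -> forall g, K g x = 1.
Proof.
move=> h; have mul h' s : 0 < mu s -> K (h' * s)%g x = K h' x.
  move=> ms; have := boundary_kernel_cocycle rw tr s h'^-1%g x; rewrite invgK => <-.
  suff -> : K s (act h'^-1%g x) = 1 by rewrite mul1r.
  apply: (bernoulli_gap_eq0 b0 b1); first exact: K0.
  have /eqP := h h'^-1%g s; rewrite mulf_eq0 gt_eqF //= => /eqP.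
  by [].
have word l h' : (forall s, s \in l -> 0 < mu s) -> K (h' * \prod_(s <- l) s)%g x = K h' x.
  elim: l h' => [|s l IH] h' hl; first by rewrite big_nil mulg1.
  rewrite big_cons mulgA IH; first by apply: mul; apply: hl; rewrite inE eqxx.
  by move=> s' hs'; apply: hl; rewrite inE hs' orbT.
move=> g; have [_ _ _ /(_ g)[n _ [l [_ hl <-]]]] := rw.
by rewrite -[X in K X](mul1g (\prod_(s <- l) s)%g) word // boundary_kernel1.
Qed.

Section Spine.
Context (xi0 : X).
Hypothesis spine : is_spine xi0.

(** This is how the statement that [m] is the Dirac mass at the spine is used. The common zeros of
    the translated gaps reduce to the spine because the kernels separate points. *)
Lemma kms_measure_null (f : X -> R) : continuous f -> (forall x, 0 <= f x) ->
  f xi0 = 0 -> m f = 0.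
Proof.
apply: (@positive_functional_null R X m (G * G)%type
  (fun p x => mu p.2 * kernel_gap p.2 (act p.1 x)) (1%g, 1%g)).
- exact: boundary_compact.
- exact: kms_measureD.
- exact: kms_measureZ.
- exact: kms_measure_ge0.
- exact: kms_measure1.
- move=> [g s] /=; apply: continuous_mull => x.
  by apply: continuous_comp; [exact: cact|exact: kernel_gap_continuous].
- move=> [g s] x /=; rewrite mulr_ge0 ?kernel_gap_ge0 //.
  by case: rw => _ /(_ s)/andP[].
- by move=> [g s]; exact: kms_measure_translated_gap.
- move=> x h; apply: boundary_separates => g; rewrite spine.
  by apply: kernel_gaps_eq0 => g' s; exact: (h (g', s)).
Qed.

Lemma kms_state_evaluation f g : continuous f ->
  w (fn f ** U g) = f xi0 * w (U g).
Proof.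
move=> cf; pose D x : R[i]^o := f x + - f xi0.
have cD : continuous D := continuous_add cf (@continuous_cst R X (- f xi0)).
have cDc := continuous_conj cD.
have E : fn f ** U g = fn D ** U g + f xi0 *: U g.
  have -> := rc_funD A cf (@continuous_cst R X (- f xi0)).
  by rewrite rc_fun_cst scaleNr cmulBl cmulZl cmul1l subrK.
rewrite E (scalarD (state_scalar sw)) (scalarZ (state_scalar sw)).
suff -> : w (fn D ** U g) = 0 by rewrite add0r.
(* [state_null] applies to products [star x ** y], so [fn D] is written as the adjoint of its
   conjugate; then [star x ** x] is the function [|D|^2], which vanishes at the spine. *)
have starD : star (fn (fun x => conjc (D x))) = fn D.
  have <- := rc_fun_star A cDc.
  by congr (fn _); apply/funext => x; rewrite conjcK.
rewrite -starD; apply: (state_null sw).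
have DD : star (fn (fun x => conjc (D x))) ** fn (fun x => conjc (D x)) =
    fn (fun x => (rnorm (D x) ^+ 2)%:C).
  rewrite starD; have <- := rc_funM A cD cDc.
  congr (fn _); apply/funext => x; rewrite rnorm_sqr; case: (D x) => a b.
  by apply/eqP; rewrite eq_complex /=; apply/andP; split; apply/eqP; ring.
have cn : continuous (fun x => rnorm (D x) ^+ 2).
  have -> : (fun x => rnorm (D x) ^+ 2) = (fun x => Re (D x) ^+ 2 + complex.Im (D x) ^+ 2).
    by apply/funext => x; rewrite rnorm_sqr.
  have cR : continuous (fun x => Re (D x)).
    by move=> x; apply: continuous_comp; [exact: cD|exact: Re_continuous].
  have cI : continuous (fun x => complex.Im (D x)).
    by move=> x; apply: continuous_comp; [exact: cD|exact: Im_continuous].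
  exact: continuous_addr (continuous_mulr cR cR) (continuous_mulr cI cI).
have := kms_measure_null cn (fun x => sqr_ge0 (rnorm (D x))).
rewrite {1}/D subrr rnorm0 expr0n => /(_ erefl); rewrite /kms_measure -DD.
have := state_pos sw (fn (fun x => conjc (D x))).
rewrite lecE => /andP[/eqP i0 _] r0.
by apply/eqP; rewrite eq_complex r0 i0 /= eqxx.
Qed.

(** The KMS condition brings in the factor [K(g^-1, .)^beta], which evaluates to 1 at the fixed
    point [xi0]. *)
Lemma kms_state_tracial_on_group g h : w (U g ** U h) = w (U h ** U g).
Proof.
have := kms_generators g h (@continuous_cst R X 1) (@continuous_cst R X 1).
rewrite !fn1U => ->; have cp := continuous_realC (@kernel_power_continuous g^-1%g beta).
rewrite cmulA -!rc_UM (rc_U_fun A _ cp).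
rewrite (kms_state_evaluation _ (continuous_translate cact cp)).
by rewrite /kernel_power spine_fixed // spine ln1 mulr0 expR0 mul1r.
Qed.

End Spine.
End State.
End KMS.

(** * Traces and KMS states *)

Lemma ptws_pullback_continuous (I : Type) (J : eqType) (K : topologicalType) (T : I -> J) :
  continuous (fun w : {ptws J -> K} => (fun a => w (T a)) : {ptws I -> K}).
Proof.
move=> w; apply/cvg_sup; first exact/fmap_filter/nbhs_filter.
move=> a V; rewrite nbhsE => -[_ [[W oW <-] Wx] WV].
have := @proj_continuous J (fun=> K) (T a) w W (open_nbhs_nbhs (conj oW Wx)).
by apply: (@filterS _ (nbhs w)) => u Wu; exact: WV.
Qed.

Lemma pullback_continuous (R : realType) (V W : cstarAlgType R) (T : V -> W) :
  continuous (fun w : functionals W => (fun a => w (T a)) : functionals V).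
Proof. exact: (@ptws_pullback_continuous V W R[i]^o T). Qed.

Lemma star_hom_sum (R : realType) (V W : cstarAlgType R) (T : V -> W) (I : Type)
    (l : seq I) (F : I -> V) :
  is_star_hom T -> T (\sum_(i <- l) F i) = \sum_(i <- l) T (F i).
Proof.
move=> [lT _ _ _ _].
have TD u v : T (u + v) = T u + T v by rewrite -[u]scale1r lT !scale1r.
have T0 : T 0 = 0 by apply: (addrI (T 0)); rewrite -TD !addr0.
by elim/big_rec2: _ => [//|i _ y _ <-]; rewrite TD.
Qed.

Lemma star_homZ (R : realType) (V W : cstarAlgType R) (T : V -> W) (c : R[i]) (v : V) :
  is_star_hom T -> T (c *: v) = c *: T v.
Proof.
move=> hT; have T0 : T 0 = 0 by have := @star_hom_sum _ _ _ _ _ [::] id hT; rewrite !big_nil.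
by have [lT _ _ _ _] := hT; rewrite -[c *: v]addr0 lT T0 addr0.
Qed.

Section TraceToKMS.
Context {R : realType} {G : groupType} {mu : G -> R}.
Context {M : martin_compactification mu}.
Context (A : reduced_crossed_product R (boundary_act M)) (B : reduced_group_algebra R G).
Context (alpha : R -> A -> A) (xi0 : boundary M) (pi : A -> B).
Hypothesis rw : is_random_walk mu.
Hypothesis tr : transient mu.
Hypothesis mf : is_martin_flow alpha.
Hypothesis spine : is_spine xi0.
Hypothesis homp : is_star_hom pi.
Hypothesis pE : forall (f : boundary M -> R[i]^o) g, continuous f ->
  pi (rc_fun A f ** rc_U A g) = f xi0 *: rg_U B g.
Hypothesis K0 : forall g (x : boundary M), 0 < boundary_kernel g x.
Local Notation fn := (rc_fun A).
Local Notation U := (rc_U A).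

Lemma powit_kernel_continuous g (t : R) :
  continuous (fun x : boundary M => powit (boundary_kernel g x) t : R[i]^o).
Proof.
have cl : continuous (fun x : boundary M => t * ln (boundary_kernel g x)).
  apply: continuous_mull => x; apply: continuous_comp.
    exact: boundary_kernel_continuous.
  exact: continuous_ln.
apply: continuous_complex => x; (apply: continuous_comp; first exact: cl).
  exact: continuous_cos.
exact: continuous_sin.
Qed.

Lemma powit1 (t : R) : powit 1 t = 1 :> R[i].
Proof. by rewrite /powit ln1 mulr0 cos0 sin0. Qed.

Lemma pi_fun (f : boundary M -> R[i]^o) : continuous f -> pi (fn f) = f xi0 *: cone.
Proof. by move=> cf; rewrite -[fn f]cmul1r -rc_U1 pE // rg_U1. Qed.

(** The flow multiplies a generator by a power of the kernel, and [pi] evaluates this power at the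
    spine, where the kernel is 1. *)
Lemma flow_generator t k : pi (alpha t (rc_gen A k)) = pi (rc_gen A k).
Proof.
case: k => g [f cf]; rewrite /rc_gen /=; have [_ ->] := mf; last by [].
have [_ -> _ _ _] := homp; rewrite (pi_fun (@powit_kernel_continuous _ _)).
by rewrite spine powit1 scale1r cmul1r.
Qed.

Lemma flow1 t : alpha t cone = cone.
Proof.
have [_ E] := mf.
have {1}<- : fn (fun=> 1) ** U 1%g = cone by rewrite rc_fun1 cmul1l rc_U1.
have -> := E t 1%g _ (@continuous_cst R _ 1); rewrite rc_fun1 cmul1l rc_U1 cmul1l.
rewrite -rc_fun1; congr (fn _); apply/funext => x.
by rewrite invg1 boundary_kernel1 // powit1.
Qed.

Section Trace.
Context (tau : functionals B).
Hypothesis trt : tracial_states B tau.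
Local Notation w := ((fun a => tau (pi a)) : functionals A).

Let stau : is_state tau. Proof. by case: trt. Qed.
Let sw : is_state w. Proof. exact: state_star_hom. Qed.

Lemma state_flow t : is_state ((fun a => w (alpha t a)) : functionals A).
Proof.
have [fl _] := mf; have [/(_ t)[lt mt st] _ _ _] := fl.
have [lw pw w1] := sw; split.
- by move=> c u v; rewrite lt lw.
- by move=> a; rewrite mt st; exact: pw.
- by rewrite flow1.
Qed.

(* The Cauchy-Schwarz inequality for the flow-invariant state bounds
   [x |-> w (b ** alpha t x)], although [alpha t] is not known to be bounded. *)
Lemma trace_flow t b a : w (b ** alpha t a) = w (b ** a).
Proof.
have [fl _] := mf; have [/(_ t)[lt mt st] _ _ _] := fl.
have [lp mp _ _ _] := homp.
have lipw : lipschitz_map (fun x => w (b ** alpha t x) : R[i]^o).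
  exists (rnorm b) => u v.
  have aB : alpha t u - alpha t v = alpha t (u - v).
    have -> : u - v = -1 *: v + u by rewrite scaleN1r addrC.
    by rewrite lt scaleN1r addrC.
  rewrite -(scalarB (state_scalar sw)) -cmulBr aB.
  rewrite -(@ler_pXn2r _ 2) ?nnegrE ?mulr_ge0 ?rnorm_ge0 // exprMn.
  rewrite -{1}[b]starK; apply: le_trans (state_cauchy_schwarz sw _ _) _.
  apply: ler_pM; try by have := state_pos sw (star b); rewrite lecE => /andP[].
  - by have := state_pos sw (alpha t (u - v)); rewrite lecE => /andP[].
  - by rewrite -(rnorm_star b); exact: state_starmul_le sw (star b).
  - by rewrite -st -mt; exact: state_starmul_le (state_flow t) (u - v).
have lipw' : lipschitz_map (fun x => w (b ** x) : R[i]^o).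
  by apply: (lipschitz_state sw); apply: lipschitz_cmull; exact: lipschitz_id.
suff gen l : w (b ** alpha t (\sum_(k <- l) rc_gen A k)) = w (b ** \sum_(k <- l) rc_gen A k).
  exact: (dense_lipschitz_eq (@rc_gen_dense _ _ _ _ A) lipw lipw' gen a).
have asum : alpha t (\sum_(k <- l) rc_gen A k) = \sum_(k <- l) alpha t (rc_gen A k).
  have aD u v : alpha t (u + v) = alpha t u + alpha t v by rewrite -[u]scale1r lt !scale1r.
  have a0 : alpha t 0 = 0 by apply: (addrI (alpha t 0)); rewrite -aD !addr0.
  by elim/big_rec2: _ => [//|k _ y _ <-]; rewrite aD.
rewrite asum !cmul_sumr !(scalar_sum (state_scalar sw)); apply: eq_bigr => k _.
by rewrite [pi (b ** alpha t _)]mp [pi (b ** rc_gen A k)]mp flow_generator.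
Qed.

Lemma trace_kms beta : kms_states alpha beta w.
Proof.
split=> // a b F [dF Ft] _.
have [_ mp _ _ _] := homp; have [_ trace] := trt.
have -> : w (a ** b) = w (b ** a) by rewrite /= !mp trace.
apply/esym; apply: (@entire_constant_on_real_line R (fun z => w (b ** F z))); last first.
  by move=> t; rewrite Ft trace_flow.
(* The functional [x |-> w (b ** x)] is bounded by [|b|], so it carries the derivative [D] of [F] to
   [w (b ** D)]; the 1 added to [|b|] avoids division by 0. *)
move=> z; have /derivable_rnorm[D hD] := dF z; apply/derivable_rnorm.
exists (w (b ** D)) => e e0.
have nb : 0 < rnorm b + 1 by rewrite ltr_wpDl // rnorm_ge0.
have [r r0 hr] := hD _ (divr_gt0 e0 nb); exists r => // u /hr H.
have lw := state_scalar sw.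
rewrite -[u *: _](scalarZ lw) -!(scalarB lw) -cmulZr -!cmulBr.
apply: le_trans (state_bound sw _) _; apply: le_trans (rnorm_cmul _ _) _.
apply: le_trans (ler_wpM2l (rnorm_ge0 b) H) _.
rewrite mulrA ler_wpM2r ?rnorm_ge0 // mulrCA ler_piMr ?(ltW e0) //.
by rewrite ler_pdivrMr // mul1r lerDl.
Qed.

End Trace.
End TraceToKMS.

Theorem proposition6p1 (R : realType) (G : groupType) (mu : G -> R)
    (S : set G) (d : G -> G -> nat) (C : R)
    (M : martin_compactification mu)
    (A : reduced_crossed_product R (boundary_act M))
    (B : reduced_group_algebra R G)
    (alpha : R -> A -> A) (xi0 : boundary M) (beta : R) :
  is_random_walk mu ->
  transient mu ->
  finite_set S ->
  (forall g, S g -> S g^-1%g) ->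
  semigroup_generates S ->
  is_word_metric S d ->
  0 < C ->
  harnack mu d C ->
  moment_condition mu d C ->
  is_martin_flow alpha ->
  is_spine xi0 ->
  beta != 0 ->
  beta != 1 ->
  exists omega : functionals B -> functionals A,
    affine_homeomorphism (tracial_states B) (kms_states alpha beta) omega /\
    forall tau, tracial_states B tau ->
      forall (f : boundary M -> R[i]^o) (g : G), continuous f ->
        omega tau (rc_fun A f ** rc_U A g) = f xi0 * tau (rg_U B g).
Proof.
move=> rw tr _ _ _ _ C0 har moment mf spine b0 b1.
have fix0 g : boundary_act M g xi0 = xi0 by exact: spine_fixed.
have cact := @boundary_act_continuous R G mu M.
have K0 := @boundary_kernel_gt0 R G mu M rw tr d C C0 har.
have [pi [homp pE]] := evaluation_hom A B cact fix0.
have [iota [homi iE]] := inclusion_hom A B.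
have lp := star_hom_lipschitz homp; have li := star_hom_lipschitz homi.
have piK x : pi (iota x) = x.
  move: x; apply: (dense_lipschitz_eq (@rg_dense_sum _ _ B)).
  - exact: lipschitz_comp.
  - exact: lipschitz_id.
  move=> l; rewrite (star_hom_sum _ _ homi) (star_hom_sum _ _ homp).
  apply: eq_bigr => k _; rewrite (star_homZ _ _ homi) (star_homZ _ _ homp) iE.
  by rewrite -(fn1U A k.1) pE ?scale1r //; exact: continuous_cst.
pose omega (w : functionals B) : functionals A := fun a => w (pi a).
pose omega' (w : functionals A) : functionals B := fun x => w (iota x).
have omegaK w : omega' (omega w) = w by apply/funext => x; rewrite /omega /omega' piK.
have omega'K w : kms_states alpha beta w -> omega (omega' w) = w.
  move=> kw; have sw : is_state w by case: kw.
  apply/funext; rewrite /omega /omega'.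
  apply: (@dense_lipschitz_eq _ A R[i]^o _ _ _ _ (@rc_gen_dense _ _ _ _ A)).
  - by apply: lipschitz_state => //; exact: lipschitz_comp.
  - by apply: lipschitz_state => //; exact: lipschitz_id.
  (* On a generator [iota (pi (f U_g))] is [f xi0 U_g], and a KMS state takes the same value on it
     as on [f U_g]. *)
  move=> l; rewrite (star_hom_sum _ _ homp) (star_hom_sum _ _ homi).
  rewrite !(scalar_sum (state_scalar sw)); apply: eq_bigr => -[g [f cf]] _.
  rewrite /rc_gen /= pE // (star_homZ _ _ homi) iE (scalarZ (state_scalar sw)).
  by rewrite (kms_state_evaluation rw tr C0 har moment mf kw b0 b1 spine g cf).
have kms_trace w : kms_states alpha beta w -> tracial_states B (omega' w).
  move=> kw; have sw : is_state w by case: kw.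
  split; first exact: state_star_hom.
  have [_ mi _ _ _] := homi; rewrite /omega' => x y; rewrite !mi.
  (* Both sides are bilinear and bounded, so density in each argument reduces traciality to the
     canonical unitaries. *)
  move: y; apply: (@dense_lipschitz_eq _ B R[i]^o _ _ _ _ (@rg_dense_sum _ _ B)).
  - by apply: lipschitz_state => //; exact: lipschitz_cmull.
  - by apply: lipschitz_state => //; exact: lipschitz_cmulr.
  move=> l'; move: x; apply: (@dense_lipschitz_eq _ B R[i]^o _ _ _ _ (@rg_dense_sum _ _ B)).
  - by apply: lipschitz_state => //; exact: lipschitz_cmulr.
  - by apply: lipschitz_state => //; exact: lipschitz_cmull.
  move=> l; rewrite !(star_hom_sum _ _ homi) !cmul_suml !(scalar_sum (state_scalar sw)).
  under eq_bigr do rewrite cmul_sumr (scalar_sum (state_scalar sw)).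
  under [RHS]eq_bigr do rewrite cmul_sumr (scalar_sum (state_scalar sw)).
  rewrite exchange_big; apply: eq_bigr => k _; apply: eq_bigr => k' _.
  rewrite !(star_homZ _ _ homi) !iE !cmulZl !cmulZr !(scalarZ (state_scalar sw)).
  rewrite (kms_state_tracial_on_group rw tr C0 har moment mf kw b0 b1 spine).
  by rewrite mulrCA.
exists omega; split; last first.
  move=> tau [stau _] f g cf; rewrite /omega pE //.
  exact: (scalarZ (state_scalar stau)).
split.
- split.
  + by move=> tau ht; apply: (trace_kms rw tr mf spine homp pE K0 ht).
  + by move=> u v _ _ uv; rewrite -(omegaK u) uv omegaK.
  + move=> w kw; exists (omega' w); first exact: kms_trace.
    exact: omega'K.
- by apply: continuous_subspaceT; exact: pullback_continuous.
- exists omega'; first by move=> u _; exact: omegaK.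
  by apply: continuous_subspaceT; exact: pullback_continuous.
(* Composition with [pi] commutes with convex combinations by computation. *)
- by [].
Qed.
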